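(* Let $\beta>0$ and $0<\gamma<1/1000$ be constants. There exist a constant $\varepsilon=\varepsilon(\beta,\gamma)>0$ and $n_0$ such that the following holds for all $n\ge n_0$. Let $G$ be a $d$-regular $(\beta,\gamma)$-expander (directed or undirected) with $n$ vertices, where $200<d<n$. Then Router has a strategy to win the $r$-Routing game on $G$ for $r=\varepsilon n d/\log n$. Moreover, Router can respond to each request in $O(n^3d^3)$ time, and each path in $\mathcal P$ has length $O(\log n)$.
   Context: A digraph is $d$-regular if every vertex has in-degree and out-degree $d$. For a (di)graph $G$ and $S\subseteq V(G)$, $e_G(S)$ denotes the number of edges with both endpoints in $S$. Expander: an $n$-vertex $d$-regular (undirected) graph $G$ is a $(\beta,\gamma)$-expander if for every $S\subseteq V(G)$ with $|S|\le n/2$ we have $e_G(S)\le \gamma d|S|$ if $|S|\le \beta n$, and $e_G(S)\le d|S|/3$ if $\beta n<|S|\le n/2$. A $d$-regular digraph $D$ is a $(\beta,\gamma)$-expander if the $2d$-regular (multi)graph obtained from $D$ by ignoring edge directions is a $(\beta,\gamma)$-expander. The $r$-Routing game on a $d$-regular (di)graph $G$ is played by Adversary and Router. Router maintains a family $\mathcal P$ of pairwise edge-disjoint paths in $G$, initially empty. In each turn Adversary makes one of two requests, and each request must be fulfilled by Router before the next one is revealed: (1) Find-Path $a$ $b$: given vertices $a,b\in V(G)$ such that each of $a$ and $b$ is an endpoint of fewer than $d/200$ paths in $\mathcal P$, and such that $|\mathcal P|<r$, Router must find a path from $a$ to $b$ (a directed path from $a$ to $b$ if $G$ is directed) that is edge-disjoint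 from all paths in $\mathcal P$; this path is added to $\mathcal P$. If no such path is found, Router loses. (2) Remove-Path $P$: a given path $P\in\mathcal P$ is removed from $\mathcal P$. Router wins the $r$-Routing game if she can satisfy every (infinite) sequence of such requests. *)

(* Defs.v *)
From HB Require Import structures.
From mathcomp Require Import all_boot all_order all_algebra.
From mathcomp Require Import reals exp.

Set Implicit Arguments.
Unset Strict Implicit.
Unset Printing Implicit Defensive.

Import Order.TTheory GRing.Theory Num.Theory.

(** * Graphs and digraphs

    Finite simple graphs and digraphs on the labelled vertex set [{0, ..., n-1}].
    A digraph may contain both arcs [(u, v)] and [(v, u)]. *)

Record graph (n : nat) := Graph {
  directed : bool;
  adj : rel 'I_n;
  adj_irr : irreflexive adj;
  adj_sym : ~~ directed -> symmetric adj
}.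

(** An edge of a graph is an unordered pair, an arc of a digraph an ordered one. *)
Definition edge_type (n : nat) : finType := ({set 'I_n} + 'I_n * 'I_n)%type.

Definition edge (n : nat) (G : graph n) (u v : 'I_n) : edge_type n :=
  if directed G then inr (u, v) else inl [set u; v].

Definition ends (n : nat) (x : edge_type n) : {set 'I_n} :=
  match x with inl A => A | inr (u, v) => [set u; v] end.

Definition edges (n : nat) (G : graph n) : {set edge_type n} :=
  [set edge G u.1 u.2 | u : 'I_n * 'I_n & adj G u.1 u.2].

(** For a digraph this is also the number of edges inside [S] of the multigraph
    obtained by ignoring directions: antiparallel arcs are counted twice. *)
Definition edges_in (n : nat) (G : graph n) (S : {set 'I_n}) : nat :=
  #|[set x in edges G | ends x \subset S]|.

Definition regular (n : nat) (G : graph n) (d : nat) : Prop :=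
  forall v : 'I_n, #|[set u | adj G v u]| = d /\ #|[set u | adj G u v]| = d.

(** Degree of the underlying undirected (multi)graph of a [d]-regular [G]. *)
Definition underlying_degree (n : nat) (G : graph n) (d : nat) : nat :=
  if directed G then 2 * d else d.

Definition expander (R : realType) (n : nat) (G : graph n) (d : nat)
    (beta gamma : R) : Prop :=
  regular G d /\
  forall S : {set 'I_n}, 2 * #|S| <= n ->
    let D := (underlying_degree G d)%:R%R : R in
    let s := #|S|%:R%R : R in
    let e := (edges_in G S)%:R%R : R in
    ((s <= beta * n%:R -> e <= gamma * D * s) /\
     (beta * n%:R < s -> e <= D * s / 3%:R))%R.

(** * Paths, given by their nonempty vertex sequences *)

Definition is_path (n : nat) (G : graph n) (a b : 'I_n) (q : seq 'I_n) : bool :=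
  if q is x :: p then [&& x == a, path (adj G) x p, last x p == b & uniq q]
  else false.

Definition path_edges (n : nat) (G : graph n) (q : seq 'I_n) : seq (edge_type n) :=
  if q is x :: p then pairmap (edge G) x p else [::].

Definition path_length (n : nat) (q : seq 'I_n) : nat := (size q).-1.

Definition edge_disjoint (n : nat) (G : graph n) (q q' : seq 'I_n) : bool :=
  ~~ has [in path_edges G q] (path_edges G q').

Definition endpoint (n : nat) (v : 'I_n) (q : seq 'I_n) : bool :=
  if q is x :: p then (v == x) || (v == last x p) else false.

(** * The routing game *)

Inductive request (n : nat) :=
  | FindPath of 'I_n & 'I_n
  | RemovePath of seq 'I_n.

(** The family is a multiset, since a request [FindPath a a] is answered by the
    path of length 0 at [a], of which there may be several copies. *)
Definition family_of_paths (n : nat) := seq (seq 'I_n).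

Definition legal (R : realType) (n : nat) (d : nat) (r : R)
    (P : family_of_paths n) (q : request n) : Prop :=
  match q with
  | FindPath a b =>
      [/\ 200 * count (endpoint a) P < d, 200 * count (endpoint b) P < d
        & ((size P)%:R < r)%R]
  | RemovePath p => p \in P
  end.

Definition fulfilled (n : nat) (G : graph n) (P : family_of_paths n)
    (q : request n) (answer : seq 'I_n) : Prop :=
  match q with
  | FindPath a b => is_path G a b answer /\ all (edge_disjoint G answer) P
  | RemovePath _ => True
  end.

(** Router sees all requests made so far, the current one last; the value on a
    history ending with [RemovePath] is irrelevant. *)
Definition strategy (n : nat) := seq (request n) -> seq 'I_n.

(** The family after the first [t] requests of the sequence [w]. *)
Fixpoint family (n : nat) (sigma : strategy n) (w : nat -> request n) (t : nat) :
    family_of_paths n :=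
  if t is t'.+1 then
    match w t' with
    | FindPath _ _ => sigma (mkseq w t) :: family sigma w t'
    | RemovePath p => rem p (family sigma w t')
    end
  else [::].

Definition legal_before (R : realType) (n : nat) (d : nat) (r : R)
    (sigma : strategy n) (w : nat -> request n) (t : nat) : Prop :=
  forall i, i < t -> legal d r (family sigma w i) (w i).

Definition wins (R : realType) (n : nat) (G : graph n) (d : nat) (r : R)
    (sigma : strategy n) : Prop :=
  forall (w : nat -> request n) (t : nat),
    legal_before d r sigma w t.+1 ->
    fulfilled G (family sigma w t) (w t) (sigma (mkseq w t.+1)).

Definition short_paths (R : realType) (n : nat) (d : nat) (r : R)
    (sigma : strategy n) (len : R) : Prop :=
  forall (w : nat -> request n) (t : nat),
    legal_before d r sigma w t ->
    forall q, q \in family sigma w t -> ((path_length q)%:R <= len)%R.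

(** * Running time: a word RAM

    Programs act on finitely many named arrays of words; a scalar variable is
    an array of which only cell 0 is used. Words are natural numbers below [W],
    every arithmetic or memory operation costs one unit. *)

Inductive binop := Add | Sub | Mul | Div | Lt | Eq.

Inductive expr :=
  | Const of nat
  | Get of nat & expr
  | Bin of binop & expr & expr.

Inductive cmd :=
  | Skip
  | Set_ of nat & expr & expr
  | Seq of cmd & cmd
  | If of expr & cmd & cmd
  | While of expr & cmd.

Definition store := nat -> nat -> nat.

Definition update (s : store) (x i v : nat) : store :=
  fun y j => if (y == x) && (j == i) then v else s y j.

Definition eval_binop (o : binop) (a b : nat) : nat :=
  match o with
  | Add => a + b
  | Sub => a - b
  | Mul => a * b
  | Div => a %/ b
  | Lt => a < b
  | Eq => a == b
  end.

Fixpoint eval (W : nat) (s : store) (e : expr) : nat :=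
  match e with
  | Const k => k %% W
  | Get x e1 => s x (eval W s e1)
  | Bin o e1 e2 => eval_binop o (eval W s e1) (eval W s e2) %% W
  end.

Fixpoint cost (e : expr) : nat :=
  match e with
  | Const _ => 1
  | Get _ e1 => (cost e1).+1
  | Bin _ e1 e2 => (cost e1 + cost e2).+1
  end.

(** [exec W c s k s']: started in [s], the program [c] halts in [s'] after [k]
    units of time. *)
Inductive exec (W : nat) : cmd -> store -> nat -> store -> Prop :=
  | ExecSkip s : exec W Skip s 1 s
  | ExecSet x e1 e2 s :
      exec W (Set_ x e1 e2) s (cost e1 + cost e2).+1
        (update s x (eval W s e1) (eval W s e2))
  | ExecSeq c1 c2 s k1 s1 k2 s2 :
      exec W c1 s k1 s1 -> exec W c2 s1 k2 s2 ->
      exec W (Seq c1 c2) s (k1 + k2).+1 s2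
  | ExecIf e c1 c2 s k s' :
      exec W (if eval W s e != 0 then c1 else c2) s k s' ->
      exec W (If e c1 c2) s (cost e + k).+1 s'
  | ExecWhileStop e c s :
      eval W s e = 0 -> exec W (While e c) s (cost e).+1 s
  | ExecWhileStep e c s k1 s1 k2 s2 :
      eval W s e != 0 -> exec W c s k1 s1 -> exec W (While e c) s1 k2 s2 ->
      exec W (While e c) s (cost e + k1 + k2).+1 s2.

(** * Router as a program

    Array 0 initially holds the parameters, array 1 the adjacency matrix in
    row-major order, and all other cells are 0: there is no preprocessing. *)

Definition initial_store (n : nat) (G : graph n) (d : nat) : store :=
  fun x i =>
    match x with
    | 0 => nth 0 [:: nat_of_bool (directed G); n; d] i
    | 1 => nth 0 [seq nat_of_bool (adj G u v) | u <- enum 'I_n, v <- enum 'I_n] i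
    | _ => 0
    end.

Definition encode_request (n : nat) (q : request n) : seq nat :=
  match q with
  | FindPath a b => [:: 0; nat_of_ord a; nat_of_ord b]
  | RemovePath p => [:: 1, size p & map val p]
  end.

(** The current request is placed in array 2; the rest of the store persists
    from one turn to the next. *)
Definition receive (n : nat) (q : request n) (s : store) : store :=
  fun x i => if x == 2 then nth 0 (encode_request q) i else s x i.

(** The answer is read off array 3: number of vertices, then the vertices. *)
Definition answer (s : store) : seq nat := [seq s 3 i.+1 | i <- iota 0 (s 3 0)].

(** [run W c G d w t s]: [s] is the store after the first [t] requests of [w]. *)
Inductive run (W : nat) (c : cmd) (n : nat) (G : graph n) (d : nat)
    (w : nat -> request n) : nat -> store -> Prop :=
  | Run0 : run W c G d w 0 (initial_store G d)
  | RunS t s k s' :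
      run W c G d w t s -> exec W c (receive (w t) s) k s' ->
      run W c G d w t.+1 s'.

(** [c] plays [sigma] and handles each request within [T] units of time. *)
Definition implements (R : realType) (W : nat) (c : cmd) (n : nat) (G : graph n)
    (d : nat) (r : R) (sigma : strategy n) (T : nat) : Prop :=
  forall (w : nat -> request n) (t : nat) (s : store),
    legal_before d r sigma w t.+1 -> run W c G d w t s ->
    exists k s', [/\ exec W c (receive (w t) s) k s', k <= T
      & if w t is FindPath _ _
        then answer s' = map val (sigma (mkseq w t.+1)) else True].

(* Main.v *)
(** For every path [P] from [a] to [b] in the family, Router keeps reserved the
    arcs of an [a]-[b] walk of length [O(log n)] containing [P], together with
    a vertex of this walk, its token. The invariant is that small sets can be
    escaped along free arcs: if [X] has at most [n / Q] vertices, then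
    [d / 4 * |X|] plus the number of tokens in [X] is at most the number of free
    arcs leaving [X] plus the number of walks that start in [X]. As the graph is
    regular, the same holds for the free arcs entering [X] and the ends of walks.

    On a request for a path from [a] to [b], one peels off a small set [B] such
    that every other vertex has at least [9 d / 10] free arcs to, and from, the
    complement of [B]. By Hall's condition, which is the invariant for subsets
    of [B], there is a flow along free arcs that carries [d / 4] units, plus the
    tokens and minus the starts, from every vertex of [B] out of [B]. A ball in
    the graph of the flow grows by a constant factor as long as it lies in [B],
    because small sets span few arcs, so the flow takes [a] out of [B] within
    [O(log n)] steps. Likewise a flow in the reversed arcs leads to [b].
    Outside [B] the free arcs expand up to half of the vertices, which joins
    the two exits. The token of the new walk is put where it leaves [B]: the
    rest of the flow then witnesses the invariant for the new reservation. The
    answer is a simple path inside the reserved walk. If the path is removed,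
    its walk becomes free, and the invariant persists, since a walk that starts
    in [X] and whose token is outside [X] has an arc that leaves [X].

    An undirected graph is treated as a symmetric digraph in which every walk
    is reserved together with its reversal. *)

From mathcomp Require Import all_boot all_order all_algebra.
From mathcomp Require Import boolp reals exp.
From mathcomp Require Import zify lra.
Require Import Defs.

Set Implicit Arguments.
Unset Strict Implicit.
Unset Printing Implicit Defensive.

(** Spelled out because the finite type inferred in [{set 'I_n}] is only
    convertible to this one, and [lia] would see distinct atoms. *)
Local Notation vertices n := (fintype_ordinal__canonical__fintype_Finite n).

(** * Counting arcs *)

Section Counting.

Variable V : finType.
Implicit Types (w : V -> V -> nat) (X Y : {set V}).

(** Paths are removed in any order, so the invariant must not depend on how the present family
    arose. A start in [X] excuses [X] from one free arc, and the excuse ends with the walk. The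
    token is a deposit against that moment: a set that contains a whole walk gets no leaving arc
    back when the walk is freed, but it has had to keep one more for the token. Outside [B] a
    deposit is cheap, as [9 d / 10] free arcs face a quota of [d / 4]; inside [B] there may be no
    slack. A flow from all of [B] is computed although one path is wanted, because what is left
    after one path is taken out certifies the invariant for every subset of [B] at once. The bound
    on [gamma] makes small sets span at most [d / 500] arcs per vertex, against a demand of at least
    [d / 5]. Sets up to one half span at most [2 d / 3], against [9 d / 10]. The family reserves at
    most [r] times [O(log n)] arcs, a small constant fraction of [n d]; this keeps [B] small and
    fixes [r]. The strategy is by definition what the program answers, so one analysis of a turn
    yields correctness, lengths and running time. *)

Definition cnt w X Y := \sum_(u in X) \sum_(v in Y) w u v.

Lemma leq_cnt w w' X Y :
  (forall u v, u \in X -> v \in Y -> w u v <= w' u v) -> cnt w X Y <= cnt w' X Y.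
Proof. by move=> H; apply: leq_sum => u uX; apply: leq_sum => v vY; apply: H. Qed.

Lemma eq_cnt w w' X Y :
  (forall u v, u \in X -> v \in Y -> w u v = w' u v) -> cnt w X Y = cnt w' X Y.
Proof. by move=> H; apply: eq_bigr => u uX; apply: eq_bigr => v vY; apply: H. Qed.

Lemma cntD w w' X Y : cnt (fun u v => w u v + w' u v) X Y = cnt w X Y + cnt w' X Y.
Proof. by rewrite /cnt -big_split; apply: eq_bigr => u _; rewrite big_split. Qed.

Lemma cnt_sum (T : Type) (s : seq T) (w : T -> V -> V -> nat) X Y :
  cnt (fun u v => \sum_(p <- s) w p u v) X Y = \sum_(p <- s) cnt (w p) X Y.
Proof.
rewrite /cnt [RHS]exchange_big; apply: eq_bigr => u _.
by rewrite [RHS]exchange_big.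
Qed.

Lemma cntT w X Y : cnt (fun u v => w v u) X Y = cnt w Y X.
Proof. by rewrite /cnt exchange_big. Qed.

Lemma cnt_sym w X Y : (forall u v, w u v = w v u) -> cnt w X Y = cnt w Y X.
Proof. by move=> H; rewrite -cntT; apply: eq_cnt => u v _ _; rewrite H. Qed.

Lemma cnt1 w x Y : cnt w [set x] Y = \sum_(v in Y) w x v.
Proof. by rewrite /cnt big_set1. Qed.

Lemma cntE w X Y : cnt w X Y = \sum_(u in X) cnt w [set u] Y.
Proof. by apply: eq_bigr => u _; rewrite cnt1. Qed.

Lemma cntEr w X Y : cnt w X Y = \sum_(v in Y) cnt w X [set v].
Proof. by rewrite -cntT cntE; apply: eq_bigr => v _; rewrite cntT. Qed.

Lemma cntIDl w X Y B : cnt w X Y = cnt w (X :&: B) Y + cnt w (X :\: B) Y.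
Proof. by rewrite /cnt (big_setID B). Qed.

Lemma cntIDr w X Y B : cnt w X Y = cnt w X (Y :&: B) + cnt w X (Y :\: B).
Proof. by rewrite -![cnt w X _]cntT; apply: cntIDl. Qed.

Lemma cntCr w X Y : cnt w X setT = cnt w X Y + cnt w X (~: Y).
Proof. by rewrite (cntIDr _ _ _ Y) setTI setTD. Qed.

Lemma cntCl w X Y : cnt w setT X = cnt w Y X + cnt w (~: Y) X.
Proof. by rewrite (cntIDl _ _ _ Y) setTI setTD. Qed.

Lemma cntSr w X Y Y' : Y \subset Y' -> cnt w X Y <= cnt w X Y'.
Proof. by move=> /setIidPr sub; rewrite (cntIDr _ X Y' Y) sub leq_addr. Qed.

Lemma cntSl w X X' Y : X \subset X' -> cnt w X Y <= cnt w X' Y.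
Proof. by move=> sub; rewrite -cntT -(cntT w Y X'); apply: cntSr. Qed.

Lemma cntUr w X x Y : x \notin Y -> cnt w X (x |: Y) = cnt w X [set x] + cnt w X Y.
Proof. by move=> xY; rewrite /cnt -big_split; apply: eq_bigr => u _ /=; rewrite big_setU1 // big_set1. Qed.

Lemma cntUl w X x Y : x \notin X -> cnt w (x |: X) Y = cnt w [set x] Y + cnt w X Y.
Proof. by move=> xX; rewrite /cnt big_setU1 // big_set1. Qed.

(** Summing the equations of the vertices of [X] counts the arcs inside [X] once on either side, so
    they cancel. *)
Lemma cnt_net w (dem : V -> nat) X :
  (forall x, x \in X -> cnt w [set x] setT = cnt w setT [set x] + dem x) ->
  cnt w X (~: X) = cnt w (~: X) X + \sum_(x in X) dem x.
Proof.
move=> H; have : cnt w X setT = cnt w setT X + \sum_(x in X) dem x.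
  by rewrite cntE cntEr -big_split; apply: eq_bigr => x /H.
by rewrite (cntCr _ _ X) (cntCl _ _ X); lia.
Qed.

Definition arcs (x : V) (p : seq V) : seq (V * V) := pairmap pair x p.
Definition arcw (x : V) (p : seq V) (u v : V) : nat := count_mem (u, v) (arcs x p).

Lemma cnt_arcs x p X Y :
  cnt (arcw x p) X Y = count (fun e => (e.1 \in X) && (e.2 \in Y)) (arcs x p).
Proof.
rewrite /arcw; elim: (arcs x p) => [|[u v] l IH] /=.
  by rewrite /cnt big1 // => u _; rewrite big1.
rewrite cntD IH; congr (_ + _).
rewrite /cnt.
have E u' : u' \in X -> \sum_(v' in Y) ((u, v) == (u', v')) = ((u == u') && (v \in Y) : nat).
  move=> _; have [<-|ne] := eqVneq u u' => /=; last first.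
    by rewrite big1 // => v' _; rewrite xpair_eqE (negPf ne).
  case: (boolP (v \in Y)) => vY; last first.
    rewrite big1 // => v' v'Y; rewrite xpair_eqE eqxx /=.
    by case: eqP v'Y vY => // -> ->.
  rewrite (bigD1 v) //= eqxx big1 ?addn0 // => v' /andP[_ ne].
  by rewrite xpair_eqE eq_sym (negPf ne) andbF.
rewrite (eq_bigr _ E).
case: (boolP (u \in X)) => uX /=; last first.
  by rewrite big1 // => u' u'X; case: eqP u'X uX => // -> ->.
rewrite (bigD1 u) //= eqxx big1 ?addn0 // => u' /andP[_ ne].
by rewrite eq_sym (negPf ne).
Qed.

(** Crossings of the boundary of [X] alternate in direction along a walk; only the two ends of the
    walk unbalance them. *)
Lemma arcs_net x p X :
  cnt (arcw x p) X (~: X) + (last x p \in X) = cnt (arcw x p) (~: X) X + (x \in X).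
Proof.
rewrite !cnt_arcs; elim: p x => [|y p IH] x //=.
by have := IH y; rewrite !inE; lia.
Qed.

Lemma arcw_path (r : rel V) x p u v : path r x p -> 0 < arcw x p u v -> r u v.
Proof.
rewrite /arcw -has_count has_pred1; elim: p x => //= y p IH x /andP[rxy pth].
by rewrite inE => /orP[/eqP[-> ->]|/(IH _ pth)].
Qed.

Lemma arcw_mem x p u v : 0 < arcw x p u v -> (u \in belast x p) /\ (v \in p).
Proof.
rewrite /arcw -has_count has_pred1; elim: p x => //= y p IH x.
rewrite !inE => /orP[/eqP[-> ->]|/IH[-> ->]]; first by rewrite !eqxx.
by rewrite !orbT.
Qed.

Lemma arcw_le1 x p u v : uniq (x :: p) -> arcw x p u v <= 1.
Proof.
elim: p x => // y p IH x /= /andP[xp up].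
have := IH y up; rewrite /arcw /= xpair_eqE.
have [exu|] := eqVneq x u => //= H; subst u.
case: (posnP (arcw y p x v)) H => [|/arcw_mem[/mem_belast xyp _]].
  by rewrite /arcw => ->; case: eqP.
by rewrite xyp in xp.
Qed.

(** The first vertex of a simple path never recurs, so the arc that leaves it cannot be traversed
    backwards later. *)
Lemma arcw_anti x p u v : uniq (x :: p) -> 0 < arcw x p u v -> arcw x p v u = 0.
Proof.
elim: p x => // y p IH x /= /andP[xp up].
have := IH y up; rewrite /arcw /= !xpair_eqE.
have memL a b : 0 < count_mem (a, b) (arcs y p) -> (a \in y :: p) /\ (b \in p).
  by move=> H; have [/mem_belast ? ?] := @arcw_mem y p a b H.
have nx v' : count_mem (x, v') (arcs y p) = 0.
  by apply/eqP; rewrite -leqn0 leqNgt; apply/negP => /memL[]; rewrite (negPf xp).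
have xN : x \notin p by move: xp; rewrite inE negb_or => /andP[].
have xy : x != y by move: xp; rewrite inE negb_or => /andP[].
have nx' v' : count_mem (v', x) (arcs y p) = 0.
  by apply/eqP; rewrite -leqn0 leqNgt; apply/negP => /memL[_]; rewrite (negPf xN).
have [<-|ne] := eqVneq x u; have [ev|ne'] := eqVneq x v => //=.
- by subst v; rewrite nx eq_sym (negPf xy).
- by rewrite nx' nx.
- by subst v; rewrite nx' nx; case: eqP => // eyu; rewrite eyu in xy.
Qed.

Lemma cnt_arcs_all x p : cnt (arcw x p) setT setT = size p.
Proof.
rewrite cnt_arcs (eq_count (a2 := predT)) ?count_predT ?size_pairmap // => e.
by rewrite !inE.
Qed.

Definition nbh (r : rel V) (A : {set V}) := A :|: [set v | [exists u in A, r u v]].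
Definition ball (r : rel V) x i := iter i (nbh r) [set x].

Lemma ball_path r x i v :
  v \in ball r x i -> exists p, [/\ path r x p, last x p = v & size p <= i].
Proof.
elim: i v => [|i IH] v /=; first by rewrite inE => /eqP->; exists [::].
rewrite in_setU => /orP[/IH[p [H1 H2 H3]]|]; first by exists p; split=> //; lia.
rewrite inE => /existsP[u /andP[/IH[p [H1 H2 H3]] ruv]].
exists (rcons p v); rewrite rcons_path last_rcons H1 H2 ruv size_rcons.
by split.
Qed.

Definition radius := 4 * (trunc_log 2 #|V|).+1.

(** [5 ^ 4 * 2 <= 6 ^ 4], so four steps double the ball. *)
Lemma ball_escape (P : pred {set V}) (r : rel V) x :
  (forall A : {set V}, x \in A -> P A -> P (nbh r A) -> 6 * #|A| <= 5 * #|nbh r A|) ->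
  exists2 i, i <= radius & ~~ P (ball r x i).
Proof.
move=> grow; case: (boolP [exists i : 'I_radius.+1, ~~ P (ball r x i)]).
  by move=> /existsP[i Pi]; exists i => //; rewrite -ltnS.
rewrite negb_exists => /forallP all; exfalso.
have Pb i : i <= radius -> P (ball r x i).
  by move=> lei; have := all (inord i); rewrite negbK inordK.
have xb i : x \in ball r x i by elim: i => [|i IH] /=; rewrite !inE ?IH.
have sz i : i <= radius -> 6 ^ i <= 5 ^ i * #|ball r x i|.
  elim: i => [|i IH] lei; first by rewrite /= cards1.
  have := grow _ (xb i) (Pb i (ltnW lei)) (Pb i.+1 lei).
  have {IH} := IH (ltnW lei); rewrite /ball iterS -/(ball r x i) !expnS.
  set a := #|ball r x i|; set b := #|nbh _ _|; set e := 5 ^ i; set f := 6 ^ i.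
  move=> H1 H2; nia.
have := sz radius (leqnn _); rewrite /radius !expnM.
set j := (trunc_log _ _).+1; have jn : #|V| < 2 ^ j by apply: trunc_log_ltn => //.
have h : (2 * 5 ^ 4) ^ j <= (6 ^ 4) ^ j by rewrite leq_exp2r.
rewrite expnMn in h; move=> H.
have le : #|ball r x (4 * j)| <= #|V| by apply: max_card.
have e0 : 0 < (5 ^ 4) ^ j by rewrite expn_gt0.
move: H h le jn e0; set a := #|ball _ _ _|; set b := (5 ^ 4) ^ j; set c := (6 ^ 4) ^ j.
set t := 2 ^ j; nia.
Qed.

End Counting.

Definition ind (V : finType) (r : rel V) (u v : V) : nat := r u v.

(** * Flows out of a set *)

Section Flow.

Variables (V : finType) (free : rel V) (B : {set V}).
Implicit Types (f : rel V) (dem sent : V -> nat).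

(** The cut condition for a flow with unit capacities on the free arcs, sources in [B] and the
    complement of [B] as sink. *)
Definition hall dem := forall Y : {set V},
  Y \subset B -> \sum_(x in Y) dem x <= cnt (ind free) Y (~: Y).

(** [f] may send flow to the outside of [B], but no arc carries flow in both
    directions. *)
Definition preflow f sent :=
  [/\ forall u v, f u v -> free u v,
      forall u v, f u v -> u \in B,
      forall u v, f u v -> ~~ f v u
    & forall x, x \in B ->
        cnt (ind f) [set x] setT = cnt (ind f) setT [set x] + sent x].

(** The residual graph for unit capacities. Tails lie in [B], so a path in it ends as soon as it
    leaves [B]. *)
Definition residual f : rel V :=
  fun u v => (u \in B) && (f v u || free u v && ~~ f u v).

Definition augmented f x p : rel V := fun u v =>
  (0 < arcw x p u v) && ~~ f v u || f u v && (arcw x p v u == 0).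

Lemma preflow0 : preflow (fun _ _ => false) (fun _ => 0).
Proof.
split=> // x _; rewrite /cnt addn0 !big1 // => u _; rewrite big1 //.
Qed.

(** Max-flow min-cut: if the set reachable from [x0] stayed in [B], every free arc leaving it would
    carry flow and no flow would enter it. It would then send all that its cut admits, and yet less
    than it demands. *)
Lemma augmenting_path f sent dem x0 :
  hall dem -> preflow f sent -> (forall x, x \in B -> sent x <= dem x) ->
  x0 \in B -> sent x0 < dem x0 ->
  exists p, path (residual f) x0 p /\ last x0 p \notin B.
Proof.
move=> hl [ffree fB fanti net] le x0B lt.
set X := [set v | connect (residual f) x0 v].
case: (boolP (X \subset B)) => [XB|/subsetPn[v]]; last first.
  by rewrite inE => /connectP[p pth ->] vB; exists p.
exfalso; have x0X : x0 \in X by rewrite inE connect0.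
have clos u v : u \in X -> v \notin X -> f v u = false /\ (free u v -> f u v).
  move=> uX vX; have uB := subsetP XB _ uX.
  have : ~~ residual f u v.
    apply: contra vX => ruv; rewrite inE; apply: connect_trans (connect1 ruv).
    by rewrite inE in uX.
  by rewrite /residual uB /= negb_or => /andP[/negbTE-> H]; split=> // fr; move: H; rewrite fr /= negbK.
have := hl _ XB; rewrite leqNgt => /negP; apply.
have E : cnt (ind f) X (~: X) = cnt (ind f) (~: X) X + \sum_(x in X) sent x.
  by apply: cnt_net => x /(subsetP XB)/net.
have Z : cnt (ind f) (~: X) X = 0.
  rewrite /cnt big1 // => u uX; rewrite big1 // => v vX.
  by rewrite inE in uX; rewrite /ind (clos _ _ vX uX).1.
rewrite Z in E.
apply: leq_ltn_trans (_ : cnt (ind f) X (~: X) < _).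
  apply: leq_cnt => u v uX; rewrite inE => vX; rewrite /ind.
  by case: (clos _ _ uX vX) => _; case: (free u v) => // ->.
have S : \sum_(i in X | i != x0) sent i <= \sum_(i in X | i != x0) dem i.
  by apply: leq_sum => x /andP[/(subsetP XB)/le].
by rewrite E (bigD1 x0) //= [in X in _ < X](bigD1 x0) //=; lia.
Qed.

Lemma arcs_net1 (x : V) p (y : V) :
  cnt (arcw x p) [set y] setT + (last x p == y) = cnt (arcw x p) setT [set y] + (x == y).
Proof.
have := arcs_net x p [set y]; rewrite !inE.
rewrite (cntCr _ [set y] [set y]) (cntCl _ [set y] [set y]); lia.
Qed.

Lemma preflow_augmented f sent x0 p :
  preflow f sent -> path (residual f) x0 p -> uniq (x0 :: p) ->
  x0 \in B -> last x0 p \notin B ->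
  preflow (augmented f x0 p) (fun x => sent x + (x == x0)).
Proof.
move=> [ffree fB fanti net] pth up x0B lB.
have arc u v : 0 < arcw x0 p u v -> [/\ u \in B, f v u || free u v && ~~ f u v & arcw x0 p v u = 0].
  by move=> A; have /andP[H1 H2] := arcw_path pth A; split=> //; apply: arcw_anti.
split.
- move=> u v /orP[/andP[/arc[_ H _] nf]|/andP[/ffree]] //.
  by move: H; rewrite (negPf nf) /= => /andP[].
- by move=> u v /orP[/andP[/arc[]]|/andP[/fB]].
- move=> u v; rewrite /augmented.
  have A0 : 0 < arcw x0 p u v -> arcw x0 p v u = 0 by move=> /arc[].
  have f0 := @fanti u v; move: A0 f0.
  case: (arcw x0 p u v) => [|a]; case: (arcw x0 p v u) => [|b] //;
    case: (f u v); case: (f v u) => //= A0 f0; try by [have := A0 isT | have := f0 isT].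
move=> x xB.
(* Stated without subtraction: the net value of [augmented] on a pair is that of [f] plus that of
   the path. Summed over one end, this is conservation. *)
have E u v : ind (augmented f x0 p) u v + ind f v u + arcw x0 p v u
    = ind (augmented f x0 p) v u + ind f u v + arcw x0 p u v.
  rewrite /ind /augmented.
  have A0 : 0 < arcw x0 p u v -> arcw x0 p v u = 0 by move=> /arc[].
  have f0 := @fanti u v.
  have res a b : 0 < arcw x0 p a b -> f b a || ~~ f a b.
    by move=> /arc[_ /orP[->//|/andP[_ ->]] _]; rewrite orbT.
  have r1 := res u v; have r2 := res v u; move: A0 f0 r1 r2.
  have := @arcw_le1 _ x0 p u v up; have := @arcw_le1 _ x0 p v u up.
  case: (arcw x0 p u v) => [|[|a]]; case: (arcw x0 p v u) => [|[|b]] //;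
    case: (f u v); case: (f v u) => //= _ _ A0 f0 r1 r2;
    by [have := A0 isT | have := f0 isT | have := r1 isT | have := r2 isT].
have S : cnt (ind (augmented f x0 p)) [set x] setT + cnt (ind f) setT [set x] + cnt (arcw x0 p) setT [set x]
   = cnt (ind (augmented f x0 p)) setT [set x] + cnt (ind f) [set x] setT + cnt (arcw x0 p) [set x] setT.
  rewrite -(cntT _ [set x] setT) -[in X in _ + X](cntT _ [set x] setT).
  rewrite -[in X in _ = X + _ + _](cntT _ [set x] setT) -!cntD.
  by apply: eq_cnt => u v _ _; apply: E.
have := net _ xB; have := arcs_net1 x0 p x.
have -> : (last x0 p == x) = false by apply/negP => /eqP lx; rewrite lx xB in lB.
rewrite [x == x0]eq_sym; lia.
Qed.

(** At least [d / 5] flow arcs per vertex start in [A], and all of them end in [nbh f A]. While this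
    neighbourhood lies in [B], it spans at most [d / 500] arcs per vertex, so it is at least 100
    times as large as [A]. *)
Lemma flow_short (adj : rel V) d f dem a :
  preflow f dem -> (forall u v, free u v -> adj u v) -> 0 < d ->
  (forall x, x \in B -> d <= 5 * dem x) ->
  (forall X : {set V}, X \subset B -> 500 * cnt (ind adj) X X <= d * #|X|) ->
  exists p, [/\ path f a p, last a p \notin B & size p <= radius V].
Proof.
move=> [ffree fB fanti net] fadj d0 ddem sp.
have [i lei] : exists2 i, i <= radius V & ~~ (ball f a i \subset B).
  apply: (@ball_escape _ (fun A => A \subset B)) => A aA AB A'B.
  have H1 : cnt (ind f) A setT = cnt (ind f) setT A + \sum_(x in A) dem x.
    by rewrite cntE cntEr -big_split; apply: eq_bigr => x /(subsetP AB)/net.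
  have H2 : cnt (ind f) A setT <= cnt (ind adj) (nbh f A) (nbh f A).
    rewrite (cntCr _ _ (nbh f A)) [X in _ + X](_ : _ = 0).
      rewrite addn0; apply: leq_trans (cntSl _ _ (subsetUl _ _)).
      by apply: leq_cnt => u v _ _; rewrite /ind; case fuv: (f u v) => //; rewrite fadj // ffree.
    rewrite /cnt big1 // => u uA; rewrite big1 // => v; rewrite !inE negb_or => /andP[_ /existsP H].
    by rewrite /ind; case fuv: (f u v) => //; case: H; exists u; rewrite uA.
  have H3 : d * #|A| <= 5 * \sum_(x in A) dem x.
    rewrite mulnC -sum_nat_const big_distrr; apply: leq_sum => x /(subsetP AB)/ddem //.
  have := sp _ A'B; nia.
move=> /subsetPn[v /ball_path[p [H1 H2 H3]] vB]; exists p; split=> //; first by rewrite H2.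
lia.
Qed.

(** Taking a path out of the flow leaves a flow with one unit less at [a], and this flow uses arcs
    of [free'] only. Its net value across the boundary of [Y] is therefore a lower bound for the
    number of such arcs. *)
Lemma flow_remove (free' : rel V) f dem a p (Y : {set V}) :
  preflow f dem -> path f a p -> uniq (a :: p) -> last a p \notin B ->
  (forall u v, f u v -> arcw a p u v = 0 -> free' u v) -> Y \subset B ->
  \sum_(x in Y) dem x <= cnt (ind free') Y (~: Y) + (a \in Y).
Proof.
move=> [ffree fB fanti net] pth up lB H YB.
have E : cnt (ind f) Y (~: Y) = cnt (ind f) (~: Y) Y + \sum_(x in Y) dem x.
  by apply: cnt_net => x /(subsetP YB)/net.
have N := arcs_net a p Y.
have lY : (last a p \in Y) = false by apply: contraNF lB; apply: (subsetP YB).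
have le X Z : cnt (arcw a p) X Z <= cnt (ind f) X Z.
  apply: leq_cnt => u v _ _; have := @arcw_le1 _ a p u v up; have := @arcw_path _ f a p u v pth.
  by rewrite /ind; case: (arcw a p u v) => [|[|w]] // /(_ isT)->.
have H1 : cnt (ind f) Y (~: Y) <= cnt (ind free') Y (~: Y) + cnt (arcw a p) Y (~: Y).
  rewrite -cntD; apply: leq_cnt => u v _ _; have := @arcw_path _ f a p u v pth.
  rewrite /ind; case fuv: (f u v) => //; have := H _ _ fuv.
  by case: (arcw a p u v) => [|w] //= => [->//|]; lia.
have := le (~: Y) Y; rewrite lY in N; lia.
Qed.

End Flow.

(** * Expansion outside the peeled set *)

Section Expansion.

Variables (V : finType) (adj : rel V) (d : nat) (B : {set V}).
Hypothesis d_gt0 : 0 < d.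
Hypothesis half_sparse : forall X : {set V},
  2 * #|X| <= #|V| -> 3 * cnt (ind adj) X X <= 2 * d * #|X|.

(** [A] has [9 d / 10] arcs per vertex into its neighbourhood, and sets up to one half span at most
    [2 d / 3] per vertex, so the growth is by a factor [27 / 20]. The disjunction allows [r] to run
    along the arcs or against them. *)
Lemma ball_half (r : rel V) z :
  z \notin B -> (forall u v, r u v -> v \notin B) ->
  (forall u v, r u v -> adj u v) \/ (forall u v, r u v -> adj v u) ->
  (forall v, v \notin B -> 9 * d <= 10 * cnt (ind r) [set v] setT) ->
  exists2 i, i <= radius V & #|V| < 2 * #|ball r z i|.
Proof.
move=> zB rB radj deg.
have [i lei] : exists2 i, i <= radius V &
    ~~ ((2 * #|ball r z i| <= #|V|) && (ball r z i \subset ~: B)).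
  apply: (@ball_escape _ (fun A => (2 * #|A| <= #|V|) && (A \subset ~: B))).
  move=> A zA /andP[_ AB] /andP[small _].
  have H2 : cnt (ind r) A setT <= cnt (ind adj) (nbh r A) (nbh r A).
    have R1 : cnt (ind r) A setT <= cnt (ind r) (nbh r A) (nbh r A).
      rewrite (cntCr _ _ (nbh r A)) [X in _ + X](_ : _ = 0).
        by rewrite addn0; apply: cntSl (subsetUl _ _).
      rewrite /cnt big1 // => u uA; rewrite big1 // => v; rewrite !inE negb_or => /andP[_ /existsP H].
      by rewrite /ind; case fuv: (r u v) => //; case: H; exists u; rewrite uA.
    apply: leq_trans R1 _; case: radj => radj.
      by apply: leq_cnt => u v _ _; rewrite /ind; case ruv: (r u v) => //; rewrite radj.
    rewrite -[leqRHS]cntT; apply: leq_cnt => u v _ _.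
    by rewrite /ind; case ruv: (r u v) => //; rewrite radj.
  have H3 : 9 * d * #|A| <= 10 * cnt (ind r) A setT.
    rewrite mulnC -sum_nat_const cntE big_distrr; apply: leq_sum => x /(subsetP AB).
    by rewrite inE => /deg.
  have := half_sparse small; nia.
rewrite negb_and => /orP[H|/negP[]]; first by exists i => //; rewrite ltnNge.
elim: i {lei} => [|i IH]; first by rewrite sub1set inE.
rewrite subUset IH /=; apply/subsetP => v; rewrite !inE => /existsP[u /andP[_ /rB]] //.
Qed.

(** The forward ball from [z] and the backward ball from [z'] each contain more than half of the
    vertices, so they meet. *)
Lemma path_outside (free : rel V) z z' :
  (forall u v, free u v -> adj u v) ->
  (forall v, v \notin B -> 9 * d <= 10 * cnt (ind free) [set v] (~: B)) ->
  (forall v, v \notin B -> 9 * d <= 10 * cnt (ind free) (~: B) [set v]) ->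
  z \notin B -> z' \notin B ->
  exists p, [/\ path (fun u v => [&& free u v, u \notin B & v \notin B]) z p,
    last z p = z' & size p <= 2 * radius V].
Proof.
move=> fadj dout din zB z'B; set r : rel V := fun u v => _.
have [i lei bi] : exists2 i, i <= radius V & #|V| < 2 * #|ball r z i|.
  apply: ball_half => // [u v /and3P[] //|| v vB].
    by left=> u v /and3P[/fadj].
  apply: leq_trans (dout _ vB) _; rewrite leq_mul2l /=.
  apply: leq_trans (_ : cnt (ind r) [set v] (~: B) <= _); last by apply: cntSr; apply: subsetT.
  by apply: leq_cnt => u w; rewrite !inE => /eqP-> wB; rewrite /ind /r vB wB !andbT.
have [j lej bj] : exists2 i, i <= radius V & #|V| < 2 * #|ball (fun u v => r v u) z' i|.
  apply: ball_half => // [u v /and3P[] //|| v vB].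
    by right=> u v /and3P[/fadj].
  apply: leq_trans (din _ vB) _; rewrite leq_mul2l /=.
  apply: leq_trans (_ : cnt (ind r) (~: B) [set v] <= _).
    by apply: leq_cnt => u w; rewrite !inE => wB /eqP->; rewrite /ind /r vB wB !andbT.
  by rewrite -cntT; apply: cntSr; apply: subsetT.
have [v] : exists v, v \in ball r z i :&: ball (fun u v => r v u) z' j.
  apply/set0Pn; rewrite -card_gt0.
  have := cardsUI (ball r z i) (ball (fun u v => r v u) z' j).
  have : #|ball r z i :|: ball (fun u v => r v u) z' j| <= #|V| by apply: max_card.
  lia.
rewrite inE => /andP[/ball_path[p [p1 p2 p3]] /ball_path[q [q1 q2 q3]]].
exists (p ++ rev (belast z' q)); split.
- by rewrite cat_path p1 p2 -q2 rev_path.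
- rewrite last_cat; case: q q2 {q1 q3} => [|y q] /= q2; first by rewrite p2.
  by rewrite rev_cons last_rcons.
- rewrite size_cat size_rev size_belast; lia.
Qed.

End Expansion.

(** * Auxiliary facts on simple paths and sums *)

Section Aux.
Variable V : finType.
Implicit Types (w : V -> V -> nat) (X Y : {set V}).

Lemma cnt_ge w X Y u v : u \in X -> v \in Y -> w u v <= cnt w X Y.
Proof.
move=> uX vY; rewrite /cnt (bigD1 u) //= (bigD1 v) //=.
by rewrite -addnA leq_addr.
Qed.

Lemma uniq_arcw_out (x : V) p v Y : uniq (x :: p) -> cnt (arcw x p) [set v] Y <= 1.
Proof.
move=> up; apply: leq_trans (cntSr _ _ (subsetT _)) _; rewrite cnt_arcs.
rewrite (eq_count (a2 := preim fst (pred1 v))) => [|e]; last by rewrite !inE andbT.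
have -> : count (preim fst (pred1 v)) (arcs x p) = count_mem v (belast x p).
  by elim: p x {up} => //= y p IH x; rewrite IH.
rewrite count_uniq_mem ?leq_b1 //.
by move: up; rewrite lastI rcons_uniq => /andP[].
Qed.

Lemma uniq_arcw_in (x : V) p v X : uniq (x :: p) -> cnt (arcw x p) X [set v] <= 1.
Proof.
move=> up; apply: leq_trans (cntSl _ _ (subsetT _)) _; rewrite cnt_arcs.
rewrite (eq_count (a2 := preim snd (pred1 v))) => [|e]; last by rewrite !inE.
have -> : count (preim snd (pred1 v)) (arcs x p) = count_mem v p.
  by elim: p x {up} => //= y p IH x; rewrite IH.
by rewrite count_uniq_mem ?leq_b1 //; move: up => /andP[].
Qed.

Lemma path_arcs (x : V) p (s : seq (V * V)) :
  {subset arcs x p <= s} -> path (fun u v => (u, v) \in s) x p.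
Proof.
elim: p x => //= y p IH x sub; rewrite sub ?mem_head //=.
by apply: IH => e ep; apply: sub; rewrite inE ep orbT.
Qed.

Lemma sum_pred1 (X : {set V}) a : \sum_(x in X) (x == a : nat) = (a \in X).
Proof.
case: (boolP (a \in X)) => aX; last first.
  by rewrite big1 // => x xX; case: eqP xX aX => // -> ->.
by rewrite (bigD1 a) //= eqxx big1 ?addn0 // => x /andP[_ /negPf->].
Qed.
End Aux.

(** * Reserved walks *)

Section State.

Variables (V : finType) (adj : rel V) (dir : bool) (code : V -> V -> nat) (d Q : nat).
Hypothesis adj_undirected : ~~ dir -> symmetric adj.
Hypothesis code_neq0 : forall u v, code u v != 0.
Hypothesis code_inj : forall u v u' v', code u v = code u' v' -> u = u' /\ v = v'.
Local Notation und := (nat_of_bool (~~ dir)).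
Implicit Types (P : seq (seq V)) (X Y : {set V}).

Definition quota := d %/ 4.
(** The walk consists of two flow paths of length at most [radius V] and a middle part of at most
    twice that; a further factor 2 is for the reversal in an undirected graph. *)
Definition span := 8 * radius V.

(** A path is named by its first arc: paths in the family are edge-disjoint, so
    the names are distinct. The junk value 0 marks free arcs. *)
Definition lab (p : seq V) := if p is x :: y :: _ then code x y else 0.
Definition starts (p : seq V) x := if p is y :: _ then x == y else false.
Definition finishes (p : seq V) x := if p is y :: q then x == last y q else false.
Definition ends_at x p := starts p x || finishes p x.
(** In an undirected graph every path also counts reversed. *)
Definition sig p x : nat := starts p x + und * finishes p x.
Definition eps p x : nat := finishes p x + und * starts p x.
Definition nontrivial (P : seq (seq V)) := [seq p <- P | 1 < size p].

Definition unreserved (own : V -> V -> nat) : rel V :=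
  fun u v => adj u v && (own u v == 0).
Definition taken (own : V -> V -> nat) : rel V := fun u v => own u v != 0.
Definition labelled (own : V -> V -> nat) l : rel V := fun u v => own u v == l.

(** [U] is the set of arcs reserved for [p]. Only what the invariant needs to
    know of the walk from which [U] arises is recorded: [r_net] is the flow
    conservation, [r_tok] says that [U] leaves every set that contains the start
    but not the token [z], and [r_deg] that the token lies on the walk. *)
Record reserved (p : seq V) (U : rel V) (z : V) : Prop := Reserved {
  r_path : if p is x :: q then path U x q else false;
  r_uniq : uniq p;
  r_len : cnt (ind U) setT setT <= span;
  r_net : forall X : {set V}, cnt (ind U) X (~: X) + \sum_(x in X) eps p x
                  = cnt (ind U) (~: X) X + \sum_(x in X) sig p x;
  r_tok : forall X : {set V}, \sum_(x in X) sig p x <= cnt (ind U) X (~: X) + und.+1 * (z \in X);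
  r_deg : forall x, und.+1 * (z == x) <= cnt (ind U) [set x] setT + cnt (ind U) setT [set x];
  r_sym : ~~ dir -> symmetric U
}.

Definition nstarts P x := \sum_(p <- nontrivial P) sig p x.
Definition nends P x := \sum_(p <- nontrivial P) eps p x.
(** The weight is 2 in an undirected graph, where the walk and its reversal share the token. *)
Definition ntokens P (z : nat -> V) x := \sum_(p <- nontrivial P) und.+1 * (z (lab p) == x).

(** [own u v] is the label of the path for which the arc [(u, v)] is reserved. *)
Record booked P (own : V -> V -> nat) (z : nat -> V) : Prop := Booked {
  b_own : forall u v, own u v != 0 -> adj u v /\ own u v \in map lab (nontrivial P);
  b_uniq : uniq (map lab (nontrivial P));
  b_res : forall p, p \in nontrivial P -> reserved p (labelled own (lab p)) (z (lab p))
}.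

Definition escapable P own z := forall X : {set V}, Q * #|X| <= #|V| ->
  quota * #|X| + \sum_(x in X) ntokens P z x
    <= cnt (ind (unreserved own)) X (~: X) + \sum_(x in X) nstarts P x.

(** A request requires [200 * count < d], and adds at most 1 to the count. *)
Definition few_ends P := forall x : V, 200 * count (ends_at x) P < d + 200.

Lemma reserved_eq p U U' z : U =2 U' -> reserved p U z -> reserved p U' z.
Proof.
move=> E [H1 H2 H3 H4 H5 H6 H7].
have EC X Y : cnt (ind U') X Y = cnt (ind U) X Y by apply: eq_cnt => u v _ _; rewrite /ind E.
split=> //.
- by case: p H1 {H2 H4 H5} => // x q; rewrite (eq_path E).
- by rewrite EC.
- by move=> X; rewrite !EC.
- by move=> X; rewrite !EC.
- by move=> x; rewrite !EC.
- by move=> /H7 s u v; rewrite -!E.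
Qed.

Lemma reserved_size p U z : reserved p U z -> (size p).-1 <= span.
Proof.
case: p => // x q [/= H1 H2 H3 _ _ _ _]; apply: leq_trans H3.
rewrite /= -(cnt_arcs_all x); apply: leq_cnt => u v _ _.
have := @arcw_le1 _ x q u v H2; have := @arcw_path _ U x q u v H1; rewrite /ind.
by case: (arcw x q u v) => [|[|w]] // ->.
Qed.

Section Booked.
Variables (P : seq (seq V)) (own : V -> V -> nat) (z : nat -> V).
Hypothesis bk : booked P own z.

Lemma lab_neq0 p : p \in nontrivial P -> lab p != 0.
Proof. by rewrite mem_filter => /andP[]; case: p => [|x [|y q]] //= _ _; apply: code_neq0. Qed.

(** Labels are distinct, so the reserved sets partition the taken arcs. *)
Lemma sum_labels u v :
  \sum_(p <- nontrivial P) (labelled own (lab p) u v : nat) = taken own u v.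
Proof.
rewrite /labelled /taken.
case: (eqVneq (own u v) 0) => [->|nz].
  by rewrite big_seq big1 // => p /lab_neq0; rewrite eq_sym => /negPf->.
have [_ m] := b_own bk nz.
rewrite -(big_map lab predT (fun l => own u v == l : nat)) -big_mkcond sum1_count.
rewrite (eq_count (a2 := pred1 (own u v))) => [|l]; last by rewrite /= eq_sym.
by rewrite count_uniq_mem ?(b_uniq bk) // m.
Qed.

Lemma cnt_taken X Y :
  cnt (ind (taken own)) X Y = \sum_(p <- nontrivial P) cnt (ind (labelled own (lab p))) X Y.
Proof.
by rewrite -cnt_sum; apply: eq_cnt => u v _ _; rewrite /ind sum_labels.
Qed.

Lemma adj_split X Y :
  cnt (ind adj) X Y = cnt (ind (unreserved own)) X Y + cnt (ind (taken own)) X Y.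
Proof.
rewrite -cntD; apply: eq_cnt => u v _ _; rewrite /ind /unreserved /taken.
case: eqVneq => [|nz]; first by rewrite andbT addn0.
by have [-> _] := b_own bk nz.
Qed.

Lemma own_sym u v : ~~ dir -> own u v = own v u.
Proof.
move=> ud; have [E|nz] := eqVneq (own u v) 0; have [E'|nz'] := eqVneq (own v u) 0.
- by rewrite E.
- have [_ /mapP[p pP lp]] := b_own bk nz'.
  have := r_sym (b_res bk pP) ud v u; rewrite /labelled lp eqxx.
  by move=> /esym/eqP.
- have [_ /mapP[p pP lp]] := b_own bk nz.
  have := r_sym (b_res bk pP) ud u v; rewrite /labelled lp eqxx.
  by move=> /esym/eqP.
- have [_ /mapP[p pP lp]] := b_own bk nz.
  have := r_sym (b_res bk pP) ud u v; rewrite /labelled lp eqxx.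
  by move=> /esym/eqP.
Qed.

Lemma unreserved_sym : ~~ dir -> symmetric (unreserved own).
Proof. by move=> ud u v; rewrite /unreserved own_sym // (adj_undirected ud). Qed.

Lemma cnt_taken_le : cnt (ind (taken own)) setT setT <= size P * span.
Proof.
rewrite cnt_taken; apply: leq_trans (_ : size (nontrivial P) * span <= _).
  rewrite -sum1_size big_distrl /= !big_seq; apply: leq_sum => p /(b_res bk)[_ _ H _ _ _ _].
  by rewrite mul1n.
by rewrite leq_mul2r size_filter count_size orbT.
Qed.

(** By [r_deg] a token at [x] can be charged to arcs at [x] that are reserved for its own walk, and
    the reserved sets are disjoint. *)
Lemma ntokens_le x :
  ntokens P z x <= cnt (ind (taken own)) [set x] setT + cnt (ind (taken own)) setT [set x].
Proof.
rewrite !cnt_taken -big_split /ntokens !big_seq.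
by apply: leq_sum => p /(b_res bk)[_ _ _ _ _ H _]; apply: H.
Qed.

(** A simple path with at least two vertices has distinct ends, so the two terms of [sig] are not
    both 1. *)
Lemma sig_ends_at p x : p \in nontrivial P -> sig p x <= ends_at x p.
Proof.
move=> pP; have := r_uniq (b_res bk pP); move: pP; rewrite mem_filter => /andP[+ _].
case: p => [|y [|y' q]] //= _; rewrite /sig /ends_at /= => /andP[yN _].
have [->|_] := eqVneq x y; last by case: (~~ _); rewrite ?mul1n ?mul0n //; case: eqP.
have [e|_] := eqVneq y (last y' q); last by rewrite muln0.
by rewrite e mem_last in yN.
Qed.

Lemma nstarts_le x : nstarts P x <= count (ends_at x) P.
Proof.
rewrite -sum1_count big_mkcond /= /nstarts /nontrivial.
rewrite big_filter big_mkcond /= !big_seq; apply: leq_sum => p pP.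
case: ifP => // sp; have pN : p \in nontrivial P by rewrite mem_filter sp.
by apply: leq_trans (sig_ends_at x pN) _; case: ends_at.
Qed.

Lemma eps_sig p x : ~~ dir -> eps p x = sig p x.
Proof. by rewrite /eps /sig => ->; rewrite !mul1n addnC. Qed.

Lemma eps_ends_at p x : p \in nontrivial P -> eps p x <= ends_at x p.
Proof.
move=> pP; case: (boolP (dir)) => [dG|ud]; last by rewrite eps_sig // sig_ends_at.
by rewrite /eps dG /ends_at addn0; case: finishes; rewrite ?orbT.
Qed.

Lemma nends_le x : nends P x <= count (ends_at x) P.
Proof.
rewrite -sum1_count big_mkcond /= /nends /nontrivial.
rewrite big_filter big_mkcond /= !big_seq; apply: leq_sum => p pP.
case: ifP => // sp; have pN : p \in nontrivial P by rewrite mem_filter sp.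
by apply: leq_trans (eps_ends_at x pN) _; case: ends_at.
Qed.

Lemma nends_undirected x : ~~ dir -> nends P x = nstarts P x.
Proof. by move=> ud; apply: eq_bigr => p _; apply: eps_sig. Qed.

Hypothesis regular_out : forall x, cnt (ind adj) [set x] setT = d.
Hypothesis regular_in : forall x, cnt (ind adj) setT [set x] = d.

(** Regularity balances [adj] across every cut, and [r_net] gives the imbalance of each reserved
    set; the free arcs are the difference. This turns bounds on leaving arcs into bounds on entering
    ones. *)
Lemma balance X :
  cnt (ind (unreserved own)) X (~: X) + \sum_(x in X) nstarts P x
  = cnt (ind (unreserved own)) (~: X) X + \sum_(x in X) nends P x.
Proof.
have H : cnt (ind (taken own)) X (~: X) + \sum_(x in X) nends P x
       = cnt (ind (taken own)) (~: X) X + \sum_(x in X) nstarts P x.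
  have eE : \sum_(x in X) nends P x = \sum_(p <- nontrivial P) \sum_(x in X) eps p x.
    by rewrite exchange_big.
  have sE : \sum_(x in X) nstarts P x = \sum_(p <- nontrivial P) \sum_(x in X) sig p x.
    by rewrite exchange_big.
  rewrite !cnt_taken eE sE -!big_split /= big_seq [RHS]big_seq.
  by apply: eq_bigr => p /(b_res bk)[_ _ _ H _ _ _]; apply: H.
have R : cnt (ind adj) X (~: X) = cnt (ind adj) (~: X) X + \sum_(x in X) 0.
  by apply: cnt_net => x _; rewrite regular_out regular_in addn0.
rewrite big1 // addn0 !adj_split in R; lia.
Qed.

End Booked.

Lemma booked0 z : booked [::] (fun _ _ => 0) z.
Proof. by split. Qed.

(** * Removing a path *)

Section Removal.

Variables (P : seq (seq V)) (p : seq V) (own own' : V -> V -> nat) (z : nat -> V).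
Hypothesis bk : booked (p :: P) own z.
Hypothesis own'E : forall u v,
  own' u v = if (1 < size p) && (own u v == lab p) then 0 else own u v.

Lemma booked_remove : booked P own' z.
Proof.
(* A path of length 0 has no reserved arcs: neither the labels nor [nontrivial] change. *)
case: (ltnP 1 (size p)) => sp; last first.
  have nE : nontrivial (p :: P) = nontrivial P by rewrite /nontrivial /= ltnNge sp.
  have oE u v : own' u v = own u v by rewrite own'E ltnNge sp.
  case: bk; rewrite nE => H1 H2 H3; split=> // [u v|q /H3].
    by rewrite oE; apply: H1.
  by apply: reserved_eq => u v; rewrite /labelled oE.
have nE : nontrivial (p :: P) = p :: nontrivial P by rewrite /nontrivial /= sp.
case: bk; rewrite nE /= => H1 /andP[H2 H2'] H3; split=> // [u v|q qP].
  rewrite own'E sp /=; case: (eqVneq (own u v) (lab p)) => //= ne nz; have [-> ] := H1 _ _ nz.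
  by rewrite inE (negPf ne).
have qp : lab q != lab p.
  by apply: contra H2 => /eqP <-; apply: map_f.
apply: reserved_eq (H3 q _); last by rewrite inE qP orbT.
move=> u v; rewrite /labelled own'E sp /=; case: (eqVneq (own u v) (lab p)) => [->|//].
rewrite eq_sym (negPf qp) eq_sym; apply/esym/negbTE.
by move: qP; rewrite mem_filter => /andP[]; case: q {qp} => [|x' [|y' q]] //= _ _; apply: code_neq0.
Qed.

(** The left side loses the weight of the token, the right side loses [sig] and regains the freed
    arcs; by [r_tok] the inequality does not get worse. *)
Lemma escapable_remove : escapable (p :: P) own z -> escapable P own' z.
Proof.
move=> esc X small; have := esc X small.
case: (ltnP 1 (size p)) => sp; last first.
  rewrite /ntokens /nstarts /nontrivial /= ltnNge sp /= => H.
  apply: leq_trans H _; rewrite leq_add2r; apply: leq_cnt => u v _ _.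
  by rewrite /ind /unreserved own'E ltnNge sp.
have nE : nontrivial (p :: P) = p :: nontrivial P by rewrite /nontrivial /= sp.
have pN : p \in nontrivial (p :: P) by rewrite nE mem_head.
have [_ _ _ _ tok _ _] := b_res bk pN.
have := tok X.
have sE : \sum_(x in X) nstarts (p :: P) x = \sum_(x in X) sig p x + \sum_(x in X) nstarts P x.
  by rewrite -big_split; apply: eq_bigr => x _; rewrite /nstarts nE big_cons.
have tE : \sum_(x in X) ntokens (p :: P) z x = und.+1 * (z (lab p) \in X) + \sum_(x in X) ntokens P z x.
  rewrite -sum_pred1 big_distrr /= -big_split; apply: eq_bigr => x _.
  by rewrite /ntokens nE big_cons [x == _]eq_sym.
rewrite sE tE.
have E : cnt (ind (unreserved own')) X (~: X) =
    cnt (ind (unreserved own)) X (~: X) + cnt (ind (labelled own (lab p))) X (~: X).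
  rewrite -cntD; apply: eq_cnt => u v _ _; rewrite /ind /unreserved /labelled own'E sp /=.
  have := lab_neq0 pN; case: (eqVneq (own u v) (lab p)) => [E1 nz|_ _]; last by rewrite addn0.
  have nz' : own u v != 0 by rewrite E1.
  by have [-> _] := b_own bk nz'; rewrite E1 (negPf nz).
rewrite E; move: (_.+1 * _) => t; lia.
Qed.

End Removal.

(** * Reserving a new walk *)

Section Insertion.

Local Notation k := quota.
Local Notation n := #|V|.

Hypothesis regular_out : forall x, cnt (ind adj) [set x] setT = d.
Hypothesis regular_in : forall x, cnt (ind adj) setT [set x] = d.
Hypothesis d_gt : 200 < d.
(** The bound is twice that of [escapable], because [peel_step] applies it to a set of at most
    [n / Q] vertices plus one more. *)
Hypothesis small_sparse : forall X : {set V},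
  Q * #|X| <= 2 * n -> 500 * cnt (ind adj) X X <= d * #|X|.
Hypothesis half_sparse : forall X : {set V},
  2 * #|X| <= n -> 3 * cnt (ind adj) X X <= 2 * d * #|X|.
Hypothesis Qn : Q <= n.

(** A small set spans at most [d / 500] arcs per vertex, so nearly all of its [d * #|X|] arcs leave
    it. *)
Lemma escapable0 z : escapable [::] (fun _ _ => 0) z.
Proof.
move=> X small; rewrite /ntokens /nstarts /= !big1 ?addn0; try by move=> x _; rewrite big_nil.
have H : cnt (ind adj) X setT = #|X| * d.
  by rewrite cntE -sum_nat_const; apply: eq_bigr => x _; apply: regular_out.
have sp : 500 * cnt (ind adj) X X <= d * #|X| by apply: small_sparse; lia.
rewrite (cntCr _ _ X) in H.
have -> : cnt (ind (unreserved (fun _ _ => 0))) X (~: X) = cnt (ind adj) X (~: X).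
  by apply: eq_cnt => u v _ _; rewrite /ind /unreserved andbT.
have : 4 * (quota * #|X|) <= d * #|X| by rewrite mulnA leq_mul2r /quota; apply/orP; right; lia.
move: sp H; set A := cnt _ X X; set A2 := cnt _ X (~: X); rewrite [#|X| * d]mulnC; set m := d * #|X|; set l := _ * #|X|; lia.
Qed.

Variables (P : seq (seq V)) (own : V -> V -> nat) (z : nat -> V).
Hypothesis bk : booked P own z.
Hypothesis esc : escapable P own z.
Hypothesis few : few_ends P.
(** The constant is [10 * 2], from [peeled] and from the two ends of a taken arc in [load], rounded
    up to absorb the arcs inside [B]. *)
Hypothesis light : 21 * Q * cnt (ind (taken own)) setT setT <= n * d.

Local Notation free := (unreserved own).

Definition load x := cnt (ind (taken own)) [set x] setT + cnt (ind (taken own)) setT [set x].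

(** Every vertex that is put into [B] has at least [d / 10] arcs that are taken
    or join it to the earlier vertices of [B]. *)
Definition peeled (B : {set V}) :=
  d * #|B| <= 10 * (\sum_(x in B) load x + cnt (ind adj) B B) /\ Q * #|B| <= n.

Lemma peeled0 : peeled set0.
Proof. by rewrite /peeled cards0 !muln0. Qed.

Lemma free_out v B : d = cnt (ind free) [set v] (~: B) + cnt (ind adj) [set v] B
    + cnt (ind (taken own)) [set v] (~: B).
Proof.
rewrite -(regular_out v) (cntCr _ _ B) (adj_split bk _ (~: B)); lia.
Qed.

Lemma free_in v B : d = cnt (ind free) (~: B) [set v] + cnt (ind adj) B [set v]
    + cnt (ind (taken own)) (~: B) [set v].
Proof.
rewrite -(regular_in v) (cntCl _ _ B) (adj_split bk (~: B)); lia.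
Qed.

(** A vertex short of free arcs has at least [d / 10] arcs that are taken or join it to [B]. The
    size bound is recovered afterwards: as [v |: B] is still sparse, nearly all of the count comes
    from taken arcs, and [light] limits these. *)
Lemma peel_step B v : peeled B -> v \notin B ->
  10 * cnt (ind free) [set v] (~: B) < 9 * d \/ 10 * cnt (ind free) (~: B) [set v] < 9 * d ->
  peeled (v |: B).
Proof.
move=> [H1 H2] vB bad.
have cB : #|v |: B| = #|B|.+1 by rewrite cardsU1 vB.
have S : \sum_(x in v |: B) load x = load v + \sum_(x in B) load x by rewrite big_setU1.
have C : cnt (ind adj) [set v] B + cnt (ind adj) B [set v] + cnt (ind adj) B B
    <= cnt (ind adj) (v |: B) (v |: B).
  rewrite cntUl // !cntUr //; lia.
have w : d * #|v |: B| <= 10 * (\sum_(x in v |: B) load x + cnt (ind adj) (v |: B) (v |: B)).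
  have D : d <= 10 * (load v + cnt (ind adj) [set v] B + cnt (ind adj) B [set v]).
    have l1 : cnt (ind (taken own)) [set v] (~: B) <= cnt (ind (taken own)) [set v] setT.
      by apply: cntSr; apply: subsetT.
    have l2 : cnt (ind (taken own)) (~: B) [set v] <= cnt (ind (taken own)) setT [set v].
      by apply: cntSl; apply: subsetT.
    have := free_out v B; have := free_in v B; rewrite /load; case: bad => ?; lia.
  rewrite S cB; nia.
split=> //.
have sp := small_sparse (X := v |: B).
have U : \sum_(x in v |: B) load x <= 2 * cnt (ind (taken own)) setT setT.
  rewrite big_split /= -cntE -cntEr mul2n -addnn; apply: leq_add.
    by apply: cntSl; apply: subsetT.
  by apply: cntSr; apply: subsetT.
have sp' : 500 * cnt (ind adj) (v |: B) (v |: B) <= d * #|v |: B| by apply: sp; nia.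
have : d * #|v |: B| <= 21 * cnt (ind (taken own)) setT setT by nia.
move: light; set u := cnt (ind (taken own)) setT setT; set b := #|_|; nia.
Qed.

Variable B : {set V}.
Hypothesis peelB : peeled B.
Hypothesis out_ok : forall v, v \notin B -> 9 * d <= 10 * cnt (ind free) [set v] (~: B).
Hypothesis in_ok : forall v, v \notin B -> 9 * d <= 10 * cnt (ind free) (~: B) [set v].

Lemma small_subset (Y : {set V}) : Y \subset B -> Q * #|Y| <= n.
Proof. by move=> /subset_leq_card le; have [_] := peelB; apply: leq_trans; rewrite leq_mul2l le orbT. Qed.

Lemma few_starts x : 200 * nstarts P x < d + 200.
Proof. by have := few x; have := nstarts_le bk x; lia. Qed.

Lemma few_finishes x : 200 * nends P x < d + 200.
Proof. by have := few x; have := nends_le bk x; lia. Qed.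

(** The truncated subtraction is exact, since [few_starts] keeps the starts below the quota. *)
Definition dem_out x := k + ntokens P z x - nstarts P x.

Lemma dem_out_large x : d <= 5 * dem_out x.
Proof. have := few_starts x; move: d_gt; rewrite /dem_out /quota; clear; lia. Qed.

Lemma hall_out : hall free B dem_out.
Proof.
move=> Y YB; have := esc (small_subset YB).
have -> : k * #|Y| = \sum_(x in Y) k by rewrite sum_nat_const mulnC.
rewrite -big_split /=.
have -> : \sum_(x in Y) (k + ntokens P z x) = \sum_(x in Y) dem_out x + \sum_(x in Y) nstarts P x.
  rewrite -big_split /=; apply: eq_bigr => x _; have := few_starts x; move: d_gt; rewrite /dem_out /quota; clear; lia.
lia.
Qed.

Variables a b : V.
Hypothesis ab : a != b.

Definition hits (x : V) p : rel V :=
  fun u v => (0 < arcw x p u v) || (~~ dir && (0 < arcw x p v u)).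

Variables (f1 : rel V) (pa : seq V).
Local Notation za := (last a pa).
Hypothesis flow1 : preflow free B f1 dem_out.
Hypothesis path_a : path f1 a pa.
Hypothesis uniq_a : uniq (a :: pa).
Hypothesis za_out : za \notin B.

Definition free1 : rel V := fun u v => free u v && ~~ hits a pa u v.
(** In an undirected graph the reversal of the new walk ends at [a], and this end is counted as soon
    as the arcs of [pa] are taken. *)
Definition ends1 x := nends P x + und * (x == a).
Definition dem_in x := k + ntokens P z x - ends1 x.

Lemma dem_in_large x : d <= 5 * dem_in x.
Proof.
have := few_finishes x; rewrite /dem_in /ends1 /quota.
by move: d_gt; clear; case: (~~ _); case: (x == a); lia.
Qed.

Lemma arc_a u v : 0 < arcw a pa u v -> [/\ u \in B, free u v, f1 u v & arcw a pa v u = 0].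
Proof.
move=> H; have fuv := arcw_path path_a H; case: flow1 => F1 F2 F3 _.
by split; [apply: F2 fuv | apply: F1 | | apply: arcw_anti].
Qed.

Lemma after_a (Y : {set V}) : Y \subset B ->
  k * #|Y| + \sum_(x in Y) ntokens P z x
    <= cnt (ind free1) Y (~: Y) + \sum_(x in Y) nstarts P x + (a \in Y).
Proof.
move=> YB; have := flow_remove (free' := free1) flow1 path_a uniq_a za_out _ YB.
have -> : k * #|Y| = \sum_(x in Y) k by rewrite sum_nat_const mulnC.
rewrite -big_split /=.
have -> : \sum_(x in Y) (k + ntokens P z x) = \sum_(x in Y) dem_out x + \sum_(x in Y) nstarts P x.
  rewrite -big_split /=; apply: eq_bigr => x _; have := few_starts x; move: d_gt; rewrite /dem_out /quota; clear; lia.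
move=> H; suff : forall u v, f1 u v -> arcw a pa u v = 0 -> free1 u v by move=> /H; clear; lia.
(* An arc of [f1] is not the reversal of an arc of [pa] either, because [f1] carries no antiparallel
   flow. *)
move=> u v fuv A0; case: flow1 => F1 F2 F3 _; rewrite /free1 F1 //= /hits A0 /= negb_and.
case: posnP => [_|/arc_a[_ _ fvu]]; first by rewrite orbT.
by have := F3 _ _ fuv; rewrite fvu.
Qed.

Lemma hits_le x p X Y : uniq (x :: p) -> cnt (arcw x p) X Y <= cnt (ind (hits x p)) X Y.
Proof.
move=> up; apply: leq_cnt => u v _ _; have := arcw_le1 u v up; rewrite /ind /hits.
by case: (arcw x p u v) => [|[|m]].
Qed.

Lemma hits_sym x p : ~~ dir -> symmetric (hits x p).
Proof. by move=> ud u v; rewrite /hits ud orbC. Qed.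

Lemma hits_directed x p X Y : uniq (x :: p) -> dir ->
  cnt (ind (hits x p)) X Y = cnt (arcw x p) X Y.
Proof.
move=> up dG; apply: eq_cnt => u v _ _; have := arcw_le1 u v up; rewrite /ind /hits dG orbF.
by case: (arcw x p u v) => [|[|m]].
Qed.

Lemma hits_a_free u v : hits a pa u v -> free u v.
Proof.
by move=> /orP[/arc_a[]|/andP[ud /arc_a[_ +]]] //; rewrite (unreserved_sym bk ud).
Qed.

Lemma free1_split X Y : cnt (ind free) X Y = cnt (ind free1) X Y + cnt (ind (hits a pa)) X Y.
Proof.
rewrite -cntD; apply: eq_cnt => u v _ _; rewrite /ind /free1.
by case: (boolP (hits a pa u v)) => [/hits_a_free->|]; rewrite ?andbF ?andbT ?addn0.
Qed.

(** [after_a] bounds the arcs that leave [Y], but the second flow runs backwards. In a digraph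
    [balance], corrected by [pa], which starts at [a] and ends outside [Y], converts one into the
    other; in an undirected graph [free1] is symmetric. *)
Lemma hall_in : hall (fun u v => free1 v u) B dem_in.
Proof.
move=> Y YB; have H := after_a YB.
rewrite (cntT (ind free1)).
have E : k * #|Y| + \sum_(x in Y) ntokens P z x
    = \sum_(x in Y) dem_in x + (\sum_(x in Y) nends P x + und * (a \in Y)).
  have -> : k * #|Y| = \sum_(x in Y) k by rewrite sum_nat_const mulnC.
  rewrite -sum_pred1 big_distrr -!big_split /=; apply: eq_bigr => x _.
  have := dem_in_large x; move: d_gt; rewrite /dem_in /ends1; clear; lia.
have bal := balance bk regular_out regular_in Y; rewrite !free1_split in bal.
case: (boolP (dir)) E => [dG|ud] E.
  rewrite !(hits_directed _ _ uniq_a dG) in bal.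
  have := arcs_net a pa Y.
  have -> : (za \in Y) = false by apply: contraNF za_out; apply: (subsetP YB).
  move: E bal H; rewrite /= mul0n; clear; lia.
have s1 : cnt (ind free1) (~: Y) Y = cnt (ind free1) Y (~: Y).
  apply: cnt_sym => u v; rewrite /ind /free1 (unreserved_sym bk ud) hits_sym //.
rewrite s1; move: E; rewrite /= mul1n.
have -> : \sum_(x in Y) nends P x = \sum_(x in Y) nstarts P x.
  by apply: eq_bigr => x _; apply: nends_undirected.
move: H; clear; lia.
Qed.

Variables (f2 : rel V) (pb : seq V).
Local Notation zb := (last b pb).
Hypothesis flow2 : preflow (fun u v => free1 v u) B f2 dem_in.
Hypothesis path_b : path f2 b pb.
Hypothesis uniq_b : uniq (b :: pb).
Hypothesis zb_out : zb \notin B.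

Definition free2 : rel V := fun u v => free1 u v && ~~ hits b pb v u.

Lemma free1_sym : ~~ dir -> symmetric free1.
Proof. by move=> ud u v; rewrite /free1 (unreserved_sym bk ud) hits_sym. Qed.

Lemma arc_b u v : 0 < arcw b pb u v -> [/\ u \in B, free1 v u, f2 u v & arcw b pb v u = 0].
Proof.
move=> H; have fuv := arcw_path path_b H; case: flow2 => F1 F2 F3 _.
by split; [apply: F2 fuv | apply: F1 | | apply: arcw_anti].
Qed.

Lemma hits_b_free u v : hits b pb v u -> free1 u v.
Proof.
move=> /orP[/arc_b[]|/andP[ud /arc_b[_ +]]] //; by rewrite (free1_sym ud).
Qed.

Lemma after_b (Y : {set V}) : Y \subset B ->
  k * #|Y| + \sum_(x in Y) ntokens P z x
    <= cnt (ind free2) (~: Y) Y + \sum_(x in Y) ends1 x + (b \in Y).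
Proof.
move=> YB; have := flow_remove (free' := fun u v => free2 v u) flow2 path_b uniq_b zb_out _ YB.
rewrite (cntT (ind free2)).
have -> : k * #|Y| = \sum_(x in Y) k by rewrite sum_nat_const mulnC.
rewrite -big_split /=.
have -> : \sum_(x in Y) (k + ntokens P z x) = \sum_(x in Y) dem_in x + \sum_(x in Y) ends1 x.
  rewrite -big_split /=; apply: eq_bigr => x _; have := dem_in_large x; move: d_gt; rewrite /dem_in; clear; lia.
move=> H; suff : forall u v, f2 u v -> arcw b pb u v = 0 -> free2 v u by move=> /H; clear; lia.
move=> u v fuv A0; case: flow2 => F1 F2 F3 _; rewrite /free2 F1 //= /hits A0 /= negb_and.
case: posnP => [_|/arc_b[_ _ fvu]]; first by rewrite orbT.
by have := F3 _ _ fuv; rewrite fvu.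
Qed.

Definition outside : rel V := fun u v => [&& free2 u v, u \notin B & v \notin B].

Lemma hits_in_B x p u v (f : rel V) : path f x p -> (forall u v, f u v -> u \in B) ->
  hits x p u v -> (u \in B) || (v \in B).
Proof.
move=> pth fB /orP[/(arcw_path pth)/fB->//|/andP[_ /(arcw_path pth)/fB->]].
by rewrite orbT.
Qed.

Lemma hits_a_in_B u v : hits a pa u v -> (u \in B) || (v \in B).
Proof. by apply: hits_in_B path_a _; case: flow1. Qed.

Lemma hits_b_in_B u v : hits b pb u v -> (u \in B) || (v \in B).
Proof. by apply: hits_in_B path_b _; case: flow2. Qed.

(** Every arc of the two flow paths has an end in [B], so none joins two vertices outside. *)
Lemma free2_outside u v : u \notin B -> v \notin B -> free2 u v = free u v.
Proof.
move=> uB vB; rewrite /free2 /free1; case: (free u v) => //=.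
have -> : hits a pa u v = false by apply/negP => /hits_a_in_B; rewrite (negPf uB) (negPf vB).
by apply/negP => /hits_b_in_B; rewrite (negPf uB) (negPf vB).
Qed.

Lemma middle_path :
  exists p, [/\ path outside za p, last za p = zb & size p <= 2 * radius V].
Proof.
have [||||||p [H1 H2 H3]] := @path_outside _ adj d B _ half_sparse free za zb => //.
- by move: d_gt; clear; lia.
- by move=> u v /andP[].
exists p; split=> //; rewrite (eq_path (e' := fun u v => [&& free u v, u \notin B & v \notin B])) //.
move=> u v; rewrite /outside; case: (boolP (u \in B)) => uB; case: (boolP (v \in B)) => vB; rewrite ?andbF //.
by rewrite free2_outside.
Qed.

Variable pm : seq V.
Hypothesis path_m : path outside za pm.
Hypothesis last_m : last za pm = zb.
Hypothesis uniq_m : uniq (za :: pm).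

Definition hit : rel V := fun u v => [|| hits a pa u v, hits b pb v u | hits za pm u v].

Lemma arc_m u v : 0 < arcw za pm u v ->
  [/\ u \notin B, v \notin B, free2 u v & arcw za pm v u = 0].
Proof.
by move=> H; have /and3P[H1 H2 H3] := arcw_path path_m H; split=> //; apply: arcw_anti.
Qed.

Lemma free2_sym : ~~ dir -> symmetric free2.
Proof. by move=> ud u v; rewrite /free2 (free1_sym ud) hits_sym. Qed.

Lemma hits_m_free u v : hits za pm u v -> [/\ u \notin B, v \notin B & free2 u v].
Proof.
move=> /orP[/arc_m[]|/andP[ud /arc_m[? ? +]]] //; by rewrite (free2_sym ud).
Qed.

Lemma hit_free u v : hit u v -> free u v.
Proof.
move=> /or3P[/hits_a_free//|/hits_b_free/andP[]//|/hits_m_free[_ _ /andP[/andP[]]]//].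
Qed.

Lemma hit_walk : exists q, path hit a q /\ last a q = b.
Proof.
(* [pb] runs against the arcs and is traversed backwards; [belast] omits its last vertex, at which
   [pm] has just arrived. *)
exists (pa ++ pm ++ rev (belast b pb)); split; last first.
  rewrite !last_cat last_m; case: (pb) => //= y q.
  by rewrite rev_cons last_rcons.
have hp x (p : seq V) : path (fun u v => 0 < arcw x p u v) x p.
  have : path (fun u v => (u, v) \in arcs x p) x p by apply: path_arcs.
  by apply: sub_path => u v; rewrite /arcw -has_count has_pred1.
rewrite !cat_path last_m; apply/and3P; split.
- apply: sub_path (hp a pa) => u v H; by rewrite /hit /hits H.
- apply: sub_path (hp _ pm) => u v H; by rewrite /hit /hits H !orbT.
- rewrite rev_path; apply: sub_path (hp b pb) => u v H; by rewrite /hit /hits H !orbT.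
Qed.

(** [pb] was found in [free1], where the arcs of [pa] are missing, and [pm] stays outside [B]. *)
Lemma disjoint_hits u v :
  ind (hits a pa) u v + ind (hits b pb) v u + ind (hits za pm) u v = ind hit u v.
Proof.
rewrite /ind /hit.
have D1 : hits a pa u v -> hits b pb v u = false.
  by move=> H; apply/negP => /hits_b_free; rewrite /free1 H andbF.
have D2 : hits za pm u v -> hits a pa u v = false.
  by move=> /hits_m_free[uB vB _]; apply/negP => /hits_a_in_B; rewrite (negPf uB) (negPf vB).
have D3 : hits za pm u v -> hits b pb v u = false.
  by move=> /hits_m_free[uB vB _]; apply/negP => /hits_b_in_B; rewrite (negPf uB) (negPf vB).
case: (hits za pm u v) D2 D3 => [-> // ->//|_ _].
by case: (hits a pa u v) D1 => [->|_]; case: (hits b pb v u).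
Qed.

Lemma cnt_hit X Y : cnt (ind hit) X Y =
  cnt (ind (hits a pa)) X Y + cnt (ind (hits b pb)) Y X + cnt (ind (hits za pm)) X Y.
Proof.
rewrite -(cntT (ind (hits b pb))) -!cntD; apply: eq_cnt => u v _ _.
by rewrite disjoint_hits.
Qed.

Lemma hit_sym : ~~ dir -> symmetric hit.
Proof. by move=> ud u v; rewrite /hit !(hits_sym _ _ ud _ v). Qed.

Lemma hits_size (x : V) (p : seq V) : uniq (x :: p) -> cnt (ind (hits x p)) setT setT <= 2 * size p.
Proof.
move=> up; apply: leq_trans (_ : cnt (arcw x p) setT setT + cnt (arcw x p) setT setT <= _).
  rewrite -[X in _ + X]cntT -cntD; apply: leq_cnt => u v _ _; rewrite /ind /hits.
  by case: (arcw x p u v) => [|m]; case: (arcw x p v u) => [|m']; case: dir.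
by rewrite cnt_arcs_all addnn mul2n.
Qed.

Variable q : seq V.
Local Notation p := (a :: q).
Hypothesis path_q : path hit a q.
Hypothesis last_q : last a q = b.
Hypothesis uniq_q : uniq p.
Hypothesis size_a : size pa <= radius V.
Hypothesis size_b : size pb <= radius V.
Hypothesis size_m : size pm <= 2 * radius V.

Lemma starts_p x : starts p x = (x == a). Proof. by []. Qed.
Lemma finishes_p x : finishes p x = (x == b). Proof. by rewrite /= last_q. Qed.

Lemma sum_sig_p X : \sum_(x in X) sig p x = (a \in X) + und * (b \in X).
Proof.
rewrite -!sum_pred1 big_distrr -big_split /=; apply: eq_bigr => x _.
by rewrite /sig starts_p finishes_p.
Qed.

Lemma sum_eps_p X : \sum_(x in X) eps p x = (b \in X) + und * (a \in X).
Proof.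
rewrite -!sum_pred1 big_distrr -big_split /=; apply: eq_bigr => x _.
by rewrite /eps starts_p finishes_p.
Qed.

Lemma reserved_hit : reserved p hit za.
Proof.
have Na := arcs_net a pa; have Nb := arcs_net b pb; have Nm := arcs_net za pm.
rewrite last_m in Nm.
split=> //.
- rewrite cnt_hit /span; move: size_a size_b size_m.
  have := hits_size uniq_a; have := hits_size uniq_b; have := hits_size uniq_m.
  by clear; lia.
- move=> X; rewrite sum_sig_p sum_eps_p.
  case: (boolP dir) => [dG|ud] /=; last first.
    have s := cnt_sym X (~: X) (_ : forall u v, ind hit u v = ind hit v u).
    by rewrite s => [|u v]; [rewrite addnC [in RHS]addnC !mul1n [in RHS](addnC (a \in X)) | rewrite /ind hit_sym].
  rewrite !cnt_hit !hits_directed // !mul0n !addn0.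
  move: (Na X) (Nb X) (Nm X); clear; lia.
(* If the token [za] is outside [X], a walk from [a] in [X] leaves [X] on [pa]. In an undirected
   graph the reversal, which starts at [b], leaves [X] on [pb] or on the way from [zb] back to [za],
   hence on other arcs. *)
- move=> X; rewrite sum_sig_p cnt_hit.
  have la := hits_le X (~: X) uniq_a; have lb := hits_le X (~: X) uniq_b.
  have lm := hits_le (~: X) X uniq_m.
  have lb' := hits_le (~: X) X uniq_b.
  move: (Na X) (Nb X) (Nm X).
  case: (boolP dir) => [dG|ud] /=; first by rewrite mul0n mul1n; move: la; clear; lia.
  have s1 : cnt (ind (hits b pb)) (~: X) X = cnt (ind (hits b pb)) X (~: X).
    by apply: cnt_sym => u v; rewrite /ind hits_sym.
  have s2 : cnt (ind (hits za pm)) (~: X) X = cnt (ind (hits za pm)) X (~: X).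
    by apply: cnt_sym => u v; rewrite /ind hits_sym.
  rewrite s1 mul1n; rewrite s2 in lm; move: la lb lm; clear; lia.
(* [za] is incident with the last arc of [pa] or, if [pa] is empty, with the first arc of [q]. In an
   undirected graph [hit] is symmetric, which doubles the count. *)
- move=> x; have [<-|ne] := eqVneq za x; last by rewrite muln0.
  have : 0 < cnt (ind hit) [set za] setT + cnt (ind hit) setT [set za].
    have [az|az] := eqVneq a za.
      rewrite -az; case: (q) path_q last_q => [_ /= ab'|y q' /= /andP[H _] _].
        by move: ab; rewrite ab' eqxx.
      rewrite addn_gt0; apply/orP; left; apply: leq_trans (cnt_ge (ind hit) (set11 a) (in_setT y)).
      by rewrite /ind H.
    rewrite addn_gt0; apply/orP; right.
    apply: leq_trans (_ : cnt (arcw a pa) setT [set za] <= _).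
      have := arcs_net1 a pa za; rewrite eqxx (negPf az); clear; lia.
    apply: leq_trans (hits_le _ _ uniq_a) _; rewrite cnt_hit -addnA leq_addr //.
  case: (boolP dir) => [dG|ud] /=; first by rewrite mul1n.
  have s : cnt (ind hit) setT [set za] = cnt (ind hit) [set za] setT.
    by apply: cnt_sym => u v; rewrite /ind hit_sym.
  by rewrite s; clear; lia.
- by apply: hit_sym.
Qed.

Definition own_add u v := if hit u v then lab p else own u v.
Definition tok_add l := if l == lab p then za else z l.

(** The first arc of [q] was free, whereas the first arc of every earlier path is reserved for that
    path. *)
Lemma lab_p : lab p != 0 /\ lab p \notin map lab (nontrivial P).
Proof.
case: (q) path_q last_q => [_ /= ab'|y q' /= /andP[H _] _]; first by move: ab; rewrite ab' eqxx.
split; first exact: code_neq0.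
apply/negP => /mapP[[|x [|y' r]] rP]; try by move: rP; rewrite mem_filter.
move=> /= /code_inj[E1 E2]; move: (hit_free H); rewrite /unreserved => /andP[_].
have := r_path (b_res bk rP); rewrite /= -E1 -E2 /labelled => /andP[/eqP-> _].
by rewrite (negPf (code_neq0 _ _)).
Qed.

Lemma nontrivial_add : nontrivial (p :: P) = p :: nontrivial P.
Proof.
rewrite /nontrivial /=; case: (q) last_q => //= ab'.
by move: ab; rewrite ab' eqxx.
Qed.

Lemma booked_add : booked (p :: P) own_add tok_add.
Proof.
have [nz fresh] := lab_p.
have hitE u v : labelled own_add (lab p) u v = hit u v.
  rewrite /labelled /own_add; case: ifP => _; first by rewrite eqxx.
  apply/negP => /eqP E; have nz' : own u v != 0 by rewrite E.
  by have [_] := b_own bk nz'; rewrite E (negPf fresh).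
split; rewrite nontrivial_add.
- move=> u v; rewrite /own_add; case: ifP => [/hit_free/andP[-> _] _|_ nz'].
    by rewrite /= mem_head.
  by have [-> ] := b_own bk nz'; rewrite inE => ->; rewrite orbT.
- by rewrite /= fresh (b_uniq bk).
- move=> r; rewrite inE => /orP[/eqP->|rP].
    rewrite /tok_add eqxx; apply: reserved_eq reserved_hit => u v.
    by rewrite hitE.
  have rp : lab r != lab p by apply: contra fresh => /eqP <-; apply: map_f.
  rewrite /tok_add (negPf rp); apply: reserved_eq (b_res bk rP) => u v.
  rewrite /labelled /own_add; case: ifP => // /hit_free/andP[_ /eqP->].
  rewrite [lab p == _]eq_sym (negPf rp) eq_sym.
  by apply/negbTE; apply: lab_neq0 rP.
Qed.

Lemma free_add u v : unreserved own_add u v = free u v && ~~ hit u v.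
Proof.
have [nz _] := lab_p.
rewrite /unreserved /own_add; case: ifP => _; last by rewrite andbT.
by rewrite (negPf nz) !andbF.
Qed.

Lemma nends_add x : nends (p :: P) x = ends1 x + (x == b).
Proof.
rewrite /nends nontrivial_add big_cons /ends1 /eps finishes_p starts_p.
by rewrite addnC addnA addnAC.
Qed.

Lemma ntokens_add x : ntokens (p :: P) tok_add x = und.+1 * (za == x) + ntokens P z x.
Proof.
have [_ fresh] := lab_p.
rewrite /ntokens nontrivial_add big_cons {1}/tok_add eqxx; congr (_ + _).
rewrite big_seq [RHS]big_seq; apply: eq_bigr => r rP; rewrite /tok_add.
by have [rp|//] := eqVneq (lab r) (lab p); case/negP: fresh; rewrite -rp; apply: map_f.
Qed.

(** By [balance] this is a statement on entering arcs and ends, namely [after_b]: neither the token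
    nor the middle part meets [B]. *)
Lemma escapable_B (Y : {set V}) : Y \subset B ->
  k * #|Y| + \sum_(x in Y) ntokens (p :: P) tok_add x
    <= cnt (ind (unreserved own_add)) Y (~: Y) + \sum_(x in Y) nstarts (p :: P) x.
Proof.
move=> YB; rewrite (balance booked_add regular_out regular_in Y).
have -> : \sum_(x in Y) nends (p :: P) x = \sum_(x in Y) ends1 x + (b \in Y).
  by rewrite -sum_pred1 -big_split; apply: eq_bigr => x _; rewrite nends_add.
have -> : \sum_(x in Y) ntokens (p :: P) tok_add x = \sum_(x in Y) ntokens P z x.
  apply: eq_bigr => x /(subsetP YB) xB; rewrite ntokens_add.
  by case: eqP xB za_out => [->->|] //; rewrite muln0.
have -> : cnt (ind (unreserved own_add)) (~: Y) Y = cnt (ind free2) (~: Y) Y.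
  apply: eq_cnt => u v _ /(subsetP YB) vB; rewrite /ind free_add /hit /free2 /free1.
  have -> : hits za pm u v = false by apply/negP => /hits_m_free[_]; rewrite vB.
  by rewrite orbF negb_or andbA.
by rewrite addnA; apply: after_b.
Qed.

(** Only the middle part has arcs with both ends outside [B], and a simple path has at most one arc
    out of [v] and one into [v]. *)
Lemma hit_out_B v : v \notin B -> cnt (ind hit) [set v] (~: B) <= 2.
Proof.
move=> vB; apply: leq_trans (_ : cnt (arcw za pm) [set v] (~: B) + cnt (arcw za pm) (~: B) [set v] <= _).
  rewrite -[X in _ + X]cntT -cntD; apply: leq_cnt => u w; rewrite !inE => /eqP-> wB.
  rewrite /ind /hit.
  have -> : hits a pa v w = false by apply/negP => /hits_a_in_B; rewrite (negPf vB) (negPf wB).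
  have -> : hits b pb w v = false by apply/negP => /hits_b_in_B; rewrite (negPf vB) (negPf wB).
  by rewrite /hits /=; case: (arcw za pm v w) => [|m]; case: (arcw za pm w v) => [|m']; case: dir.
by rewrite -[2]/(1 + 1) leq_add ?uniq_arcw_out ?uniq_arcw_in.
Qed.

(** [escapable_B] settles [X :&: B], but it counts the arcs from there into [X :\: B], which do not
    leave [X]. The surplus of the vertices outside [B] makes up for them. *)
Lemma escapable_add : escapable (p :: P) own_add tok_add.
Proof.
move=> X small; set Y := X :&: B; set Z := X :\: B.
have HY := escapable_B (subsetIr X B : Y \subset B).
have cX : #|X| = #|Y| + #|Z| by rewrite -(cardsID B X).
have tX : \sum_(x in X) ntokens (p :: P) tok_add x
  = \sum_(x in Y) ntokens (p :: P) tok_add x + \sum_(x in Z) ntokens (p :: P) tok_add x.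
  by rewrite (big_setID B).
have sX : \sum_(x in X) nstarts (p :: P) x
  = \sum_(x in Y) nstarts (p :: P) x + \sum_(x in Z) nstarts (p :: P) x.
  by rewrite (big_setID B).
set fr := ind (unreserved own_add) in HY *.
have c1 : cnt fr X (~: X) = cnt fr Y (~: X) + cnt fr Z (~: X) by rewrite (cntIDl _ _ _ B).
have c2 : cnt fr Y (~: Y) = cnt fr Y Z + cnt fr Y (~: X).
  have -> : Z = ~: Y :&: X.
    by apply/setP => x; rewrite !inE; case: (x \in X); case: (x \in B).
  have -> : ~: X = ~: Y :\: X.
    by apply/setP => x; rewrite !inE; case: (x \in X); case: (x \in B).
  exact: cntIDr.
have ZB x : x \in Z -> x \notin B by rewrite inE => /andP[].
have small_Z : 500 * cnt (ind adj) Z Z <= d * #|Z|.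
  apply: small_sparse; apply: leq_trans (_ : Q * #|X| <= _).
    by rewrite leq_mul2l subset_leq_card ?orbT // subsetDl.
  by move: small; clear; lia.
(* At least [9 d / 10 - 2] free arcs to the complement of [B] remain. The quota takes [d / 4], the
   tokens at most [d / 5 + 2], the arcs from [Y] at most [d / 10]. The extra term [d], which is
   [d / 10] after division, pays for the arcs inside [Z]. *)
have main x : x \in Z -> 10 * (k + ntokens (p :: P) tok_add x + cnt fr Y [set x]) + d
    <= 10 * (cnt fr [set x] (~: X) + cnt (ind adj) [set x] Z).
  move=> xZ; have xB := ZB _ xZ.
  have i1 : cnt (ind free) [set x] (~: B) <= cnt fr [set x] (~: B) + cnt (ind hit) [set x] (~: B).
    rewrite -cntD; apply: leq_cnt => u v _ _; rewrite /fr /ind free_add.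
    by case: (free u v); case: (hit u v).
  have i2 : cnt fr [set x] (~: B) <= cnt fr [set x] (~: X) + cnt (ind adj) [set x] Z.
    rewrite (cntIDr _ _ _ X) addnC; apply: leq_add.
      by apply: cntSr; apply/subsetP => y; rewrite !inE => /andP[].
    apply: leq_trans (_ : cnt fr [set x] Z <= _).
      by apply: cntSr; apply/subsetP => y; rewrite !inE.
    by apply: leq_cnt => u v _ _; rewrite /fr /ind /unreserved; case: (adj u v) => //; case: eqP.
  have i3 : cnt fr Y [set x] <= cnt (ind adj) B [set x].
    apply: leq_trans (_ : cnt (ind adj) Y [set x] <= _); last by apply: cntSl; apply: subsetIr.
    by apply: leq_cnt => u v _ _; rewrite /fr /ind /unreserved; case: (adj u v) => //; case: eqP.
  have i4 : ntokens (p :: P) tok_add x <= 2 + load x.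
    rewrite ntokens_add leq_add //; last by apply: (ntokens_le bk).
    by case: (~~ _); case: (za == x).
  have o1 : d = cnt (ind free) [set x] setT + cnt (ind (taken own)) [set x] setT.
    by rewrite -(adj_split bk) regular_out.
  have o2 : d = cnt (ind free) setT [set x] + cnt (ind (taken own)) setT [set x].
    by rewrite -(adj_split bk) regular_in.
  have o3 := cntSr (ind free) [set x] (subsetT (~: B)).
  have o4 := cntSl (ind free) [set x] (subsetT (~: B)).
  move: (free_in x B) (hit_out_B xB) (out_ok xB) (in_ok xB) i1 i2 i3 i4 o1 o2 o3 o4 d_gt.
  rewrite /load /quota; clear; lia.
have total : 10 * (k * #|Z| + \sum_(x in Z) ntokens (p :: P) tok_add x + cnt fr Y Z) + d * #|Z|
    <= 10 * (cnt fr Z (~: X) + cnt (ind adj) Z Z).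
  have -> : k * #|Z| = \sum_(x in Z) k by rewrite sum_nat_const mulnC.
  have -> : d * #|Z| = \sum_(x in Z) d by rewrite sum_nat_const mulnC.
  rewrite (cntEr _ Y Z) (cntE _ Z (~: X)) (cntE _ Z Z) -!big_split /= !big_distrr -!big_split /=.
  by apply: leq_sum => x /main.
rewrite cX tX sX c1 mulnDr; move: HY total small_Z; rewrite c2; clear.
move: (d * #|Z|) (k * #|Z|) (k * #|Y|); lia.
Qed.

End Insertion.

End State.

(** * Programs *)

(** Array 0 holds the parameters, 1 the adjacency matrix, 2 the request, 3 the
    answer, 4 the labels [own] of the arcs (0 for free arcs, [n * n + 1] for
    the walk under construction), 5, 6 and 7 the numbers of starts, ends and
    tokens at every vertex, 8 the tokens of the labels, 9 the set [B], 10 the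
    flow, 11 and 12 the relation and the targets of the next search, 13 the
    parents in the search tree, increased by 1 (0 for unreached vertices), 14
    the queue, 15 the path found, backwards, 16 the free arcs in the current
    direction, 17 the arcs of the path found, 18 an auxiliary matrix. The
    scalars are 24 for the source of a search, 25 for the length of the queue,
    27 for the number of vertices of the path found, 30 for its last vertex, 35
    and 36 for the exits from [B] and 37 for a label; the others are counters
    and local variables. *)
Definition var x := Get x (Const 0).
Definition nE := Get 0 (Const 1).
Definition dE := Get 0 (Const 2).
Definition cell e1 e2 := Bin Add (Bin Mul e1 nE) e2.
Definition entry X e1 e2 := Get X (cell e1 e2).
Definition setv x e := Set_ x (Const 0) e.
Definition notE e := Bin Eq e (Const 0).
Definition andE e1 e2 := Bin Mul e1 e2.
Definition orE e1 e2 := Bin Lt (Const 0) (Bin Add e1 e2).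
Definition For x e c :=
  Seq (setv x (Const 0))
      (While (Bin Lt (var x) e) (Seq c (setv x (Bin Add (var x) (Const 1))))).

(** All loops come from [For], so the running time can be read off the program,
    given a bound [lim x] on the number of rounds of the loops with counter [x]. *)
Fixpoint bound (lim : nat -> nat) (c : cmd) : nat :=
  match c with
  | Skip => 1
  | Set_ x e1 e2 => (cost e1 + cost e2).+1
  | Seq c1 c2 => (bound lim c1 + bound lim c2).+1
  | If e c1 c2 => (cost e + bound lim c1 + bound lim c2).+1
  | While e c =>
      match e with
      | Bin Lt (Get x _) _ => lim x * (cost e + bound lim c).+1 + (cost e).+1
      | _ => 0
      end
  end.

Definition frame (xs : seq nat) (s s' : store) :=
  forall y, y \notin xs -> forall j, s' y j = s y j.

Lemma frame_trans xs s1 s2 s3 : frame xs s1 s2 -> frame xs s2 s3 -> frame xs s1 s3.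
Proof. by move=> H1 H2 y yx j; rewrite H2 // H1. Qed.

Lemma frame_sub xs ys s s' : frame xs s s' -> {subset xs <= ys} -> frame ys s s'.
Proof. by move=> H sub y yx j; apply: H; apply: contra yx; apply: sub. Qed.

Lemma updE s x i v y j : y != x -> update s x i v y j = s y j.
Proof. by rewrite /update => /negPf->. Qed.

Lemma updD s x i v j : update s x i v x j = if j == i then v else s x j.
Proof. by rewrite /update eqxx. Qed.

Lemma updI s x i v : update s x i v x i = v.
Proof. by rewrite /update !eqxx. Qed.

Lemma frame_upd xs s s' x i v : x \in xs -> frame xs s s' -> frame xs s (update s' x i v).
Proof.
move=> xx H y yx j; rewrite updE ?H //.
by apply: contra yx => /eqP->.
Qed.

Lemma cell_lt n (u v : 'I_n) : u * n + v < n * n.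
Proof. have := ltn_ord u; have := ltn_ord v; nia. Qed.

Lemma cell_inj n (u v u' v' : 'I_n) : u * n + v = u' * n + v' -> u = u' /\ v = v'.
Proof.
move=> H; have lv := ltn_ord v; have lv' := ltn_ord v'.
have e : (u * n + v) %/ n = (u' * n + v') %/ n by rewrite H.
have n0 : 0 < n by lia.
rewrite !divnMDl // !divn_small // !addn0 in e; split; apply: val_inj => //=.
by rewrite e in H; lia.
Qed.

(** * Hoare rules with running time *)

Section Machine.

Variables (W : nat) (lim : nat -> nat).
Hypothesis W_gt : 1000 < W.

(** Total correctness with the time bound built in. The bound depends on the program text and on
    [lim] only, so proofs about particular programs need not count steps. *)
Definition runs c s (Q : store -> Prop) :=
  exists k s', [/\ exec W c s k s', k <= bound lim c & Q s'].

Lemma r_conseq c s (Q Q' : store -> Prop) : runs c s Q -> (forall s', Q s' -> Q' s') -> runs c s Q'.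
Proof. by move=> [k [s' [H1 H2 H3]]] H; exists k, s'; split=> //; apply: H. Qed.

Lemma r_skip s (Q : store -> Prop) : Q s -> runs Skip s Q.
Proof. by move=> H; exists 1, s; split=> //; apply: ExecSkip. Qed.

Lemma r_set x e1 e2 i v s (Q : store -> Prop) :
  eval W s e1 = i -> eval W s e2 = v -> Q (update s x i v) -> runs (Set_ x e1 e2) s Q.
Proof. by move=> <- <- H; do 2 eexists; split; [apply: ExecSet| |apply: H]. Qed.

Lemma r_setv x e v s (Q : store -> Prop) :
  eval W s e = v -> Q (update s x 0 v) -> runs (setv x e) s Q.
Proof. by move=> H1 H2; apply: r_set H1 H2; rewrite /= mod0n. Qed.

Lemma r_seq c1 c2 s (Q Q' : store -> Prop) :
  runs c1 s Q' -> (forall s', Q' s' -> runs c2 s' Q) -> runs (Seq c1 c2) s Q.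
Proof.
move=> [k1 [s1 [H1 H2 H3]]] /(_ _ H3)[k2 [s2 [H4 H5 H6]]].
exists (k1 + k2).+1, s2; split=> //; first by apply: ExecSeq H1 H4.
by rewrite /= ltnS leq_add.
Qed.

Lemma r_then t c1 c2 s (Q : store -> Prop) :
  runs c1 s (fun s' => s' = t) -> runs c2 t Q -> runs (Seq c1 c2) s Q.
Proof. by move=> H1 H2; apply: r_seq H1 _ => _ ->. Qed.

Lemma r_if e c1 c2 s (Q : store -> Prop) :
  (eval W s e != 0 -> runs c1 s Q) -> (eval W s e = 0 -> runs c2 s Q) ->
  runs (If e c1 c2) s Q.
Proof.
move=> H1 H2; case: (eqVneq (eval W s e) 0) => E.
  have [k [s' [H3 H4 H5]]] := H2 E.
  exists (cost e + k).+1, s'; split=> //; first by apply: ExecIf; rewrite E.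
  by rewrite /= ltnS -addnA leq_add2l (leq_trans H4) ?leq_addl.
have [k [s' [H3 H4 H5]]] := H1 E.
exists (cost e + k).+1, s'; split=> //; first by apply: ExecIf; rewrite E.
by rewrite /= ltnS -addnA leq_add2l (leq_trans H4) ?leq_addr.
Qed.

Lemma eval_const s c : c <= 1000 -> eval W s (Const c) = c.
Proof. by move=> H; rewrite /= modn_small //; lia. Qed.

Lemma eval_var s x : eval W s (var x) = s x 0.
Proof. by rewrite /= mod0n. Qed.

Lemma eval_get s x e i : eval W s e = i -> eval W s (Get x e) = s x i.
Proof. by move=> <-. Qed.

Lemma eval_add s e1 e2 a b : eval W s e1 = a -> eval W s e2 = b -> a + b < W ->
  eval W s (Bin Add e1 e2) = a + b.
Proof. by move=> /= -> -> H; rewrite modn_small. Qed.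

Lemma eval_succ s e a : eval W s e = a -> a.+1 < W ->
  eval W s (Bin Add e (Const 1)) = a.+1.
Proof. by move=> H1 H2; rewrite (eval_add H1 (eval_const s (isT : 1 <= 1000))) ?addn1. Qed.

Lemma eval_sub s e1 e2 a b : eval W s e1 = a -> eval W s e2 = b -> a < W ->
  eval W s (Bin Sub e1 e2) = a - b.
Proof. by move=> /= -> -> H; rewrite modn_small // (leq_ltn_trans (leq_subr _ _) H). Qed.

Lemma eval_mul s e1 e2 a b : eval W s e1 = a -> eval W s e2 = b -> a * b < W ->
  eval W s (Bin Mul e1 e2) = a * b.
Proof. by move=> /= -> -> H; rewrite modn_small. Qed.

Lemma eval_div s e1 e2 a b : eval W s e1 = a -> eval W s e2 = b -> a < W ->
  eval W s (Bin Div e1 e2) = a %/ b.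
Proof.
move=> /= -> -> H; rewrite modn_small //; apply: leq_ltn_trans H.
exact: leq_div.
Qed.

Lemma eval_lt s e1 e2 a b : eval W s e1 = a -> eval W s e2 = b ->
  eval W s (Bin Lt e1 e2) = (a < b).
Proof. by move=> /= -> ->; apply/modn_small/(leq_ltn_trans (leq_b1 _)); apply: leq_trans W_gt. Qed.

Lemma eval_eq s e1 e2 a b : eval W s e1 = a -> eval W s e2 = b ->
  eval W s (Bin Eq e1 e2) = (a == b).
Proof. by move=> /= -> ->; apply/modn_small/(leq_ltn_trans (leq_b1 _)); apply: leq_trans W_gt. Qed.

Lemma eval_not s e a : eval W s e = a -> eval W s (notE e) = (a == 0).
Proof. by move=> H; apply: eval_eq H _; rewrite eval_const. Qed.

Lemma eval_and s e1 e2 (a b : bool) : eval W s e1 = a -> eval W s e2 = b ->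
  eval W s (andE e1 e2) = a && b.
Proof. by move=> H1 H2; rewrite (eval_mul H1 H2) ?mulnb //; case: a b {H1 H2} => [] []; lia. Qed.

Lemma eval_or s e1 e2 (a b : bool) : eval W s e1 = a -> eval W s e2 = b ->
  eval W s (orE e1 e2) = a || b.
Proof.
move=> H1 H2; rewrite (@eval_lt _ _ _ 0 (a + b)) ?eval_const //; first by case: a b {H1 H2} => [] [].
by apply: eval_add => //; case: a b {H1 H2} => [] []; lia.
Qed.

Lemma r_for x e c s N (I : nat -> store -> Prop) (Q : store -> Prop) :
  N <= lim x -> N < W -> I 0 (update s x 0 0) ->
  (forall i s', i <= N -> I i s' -> s' x 0 = i -> eval W s' e = N) ->
  (forall i s', i < N -> I i s' -> s' x 0 = i ->
     runs c s' (fun s'' => s'' x 0 = i /\ I i.+1 (update s'' x 0 i.+1))) ->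
  (forall s', I N s' -> s' x 0 = N -> Q s') ->
  runs (For x e c) s Q.
Proof.
move=> Nlim NW I0 He Hc HQ; apply: r_seq.
  apply: (r_setv (v := 0) (Q := fun s' => I 0 s' /\ s' x 0 = 0)); first by rewrite eval_const.
  by rewrite updI.
set body := Seq c _; set cond := Bin Lt _ _.
suff H m i s' : i + m = N -> I i s' -> s' x 0 = i ->
    exists k s'', [/\ exec W (While cond body) s' k s'',
      k <= m * (cost cond + bound lim body).+1 + (cost cond).+1 & Q s''].
  move=> s' [Is xs]; have [k [s'' [H1 H2 H3]]] := H N 0 s' (add0n _) Is xs.
  exists k, s''; split=> //; apply: leq_trans H2 _; rewrite /= leq_add2r.
  by rewrite leq_mul2r Nlim orbT.
elim: m i s' => [|m IH] i s' eN Is xs.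
  rewrite addn0 in eN; rewrite {i}eN in Is xs.
  exists (cost cond).+1, s'; split; [|by rewrite mul0n|exact: (HQ _ Is xs)].
  apply: ExecWhileStop; rewrite (eval_lt (eval_var _ _) (He _ _ (leqnn _) Is xs)) xs.
  by rewrite ltnn.
have iN : i < N by lia.
have [k1 [s1 [H1 H2 [H3 H4]]]] := Hc _ _ iN Is xs.
have [] := IH i.+1 (update s1 x 0 i.+1) _ H4 _; [lia|by rewrite updI|].
move=> k2 [s2 [H5 H6 H7]].
have E : exec W body s' (k1 + (cost (Const 0) + cost (Bin Add (var x) (Const 1))).+1).+1 (update s1 x 0 i.+1).
  apply: ExecSeq H1 _.
  have := ExecSet W x (Const 0) (Bin Add (var x) (Const 1)) s1.
  rewrite eval_const // (eval_add (eval_var _ _) (eval_const s1 (isT : 1 <= 1000))).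
    by rewrite H3 addn1.
  by rewrite H3; lia.
exists (cost cond + (k1 + (cost (Const 0) + cost (Bin Add (var x) (Const 1))).+1).+1 + k2).+1, s2.
split=> //.
  apply: ExecWhileStep E H5.
  by rewrite (eval_lt (eval_var _ _) (He _ _ (ltnW iN) Is xs)) xs iN.
set K := cost (Const 0) + _.
have eb : bound lim body = (bound lim c + K.+1).+1 by [].
rewrite mulSn; move: H2 H6; rewrite eb; move: (m * _) => A.
by clear; move: (bound lim c) K (cost cond) => C K D; lia.
Qed.

(** * Filling vectors and matrices *)

Section Tables.

Variable n : nat.
Hypothesis n_W : 1000 * n * n < W.
Hypothesis lim_n : forall x, x != 40 -> n <= lim x.

Lemma eval_n s : s 0 1 = n -> eval W s nE = n.
Proof. by move=> H; rewrite (eval_get _ (eval_const _ _)) //. Qed.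

Lemma n_lt_W : n < W. Proof. by move: n_W W_gt; clear; nia. Qed.

Lemma eval_cell s e1 e2 (u v : 'I_n) :
  s 0 1 = n -> eval W s e1 = u -> eval W s e2 = v -> eval W s (cell e1 e2) = u * n + v.
Proof.
move=> sn H1 H2; have lt : u * n + v < W.
  by apply: leq_trans (cell_lt u v) _; move: n_W; clear; nia.
apply: (eval_add _ H2 lt); apply: (eval_mul H1 (eval_n sn)).
by apply: leq_ltn_trans (leq_addr _ _) lt.
Qed.

Lemma eval_entry s X e1 e2 (u v : 'I_n) :
  s 0 1 = n -> eval W s e1 = u -> eval W s e2 = v -> eval W s (entry X e1 e2) = s X (u * n + v).
Proof. by move=> sn H1 H2; apply: eval_get; apply: eval_cell. Qed.

Definition Fill X e := For 20 nE (For 21 nE (Set_ X (cell (var 20) (var 21)) e)).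
Definition FillV X e := For 20 nE (Set_ X (var 20) e).

Lemma fill_vec X e s (g : 'I_n -> nat) :
  X \notin [:: 0; 20] -> s 0 1 = n ->
  (forall (u : 'I_n) s', frame [:: X; 20] s s' -> s' 20 0 = u -> eval W s' e = g u) ->
  runs (FillV X e) s (fun s' => frame [:: X; 20] s s' /\ forall u : 'I_n, s' X u = g u).
Proof.
move=> X20 sn He.
have X0 : 0 != X by apply: contraNneq X20 => <-; rewrite inE.
have XC : X != 20 by apply: contraNneq X20 => ->; rewrite !inE.
apply: (r_for (N := n) (I := fun i s' => frame [:: X; 20] s s' /\
    forall u : 'I_n, u < i -> s' X u = g u)).
- exact: lim_n.
- exact: n_lt_W.
- split=> //; apply: frame_upd; by [rewrite !inE eqxx orbT | ].
- move=> i s' _ [fr _] _; apply: eval_n; rewrite fr //.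
  by rewrite !inE negb_or X0.
- move=> i s' lt [fr H] s'i; pose u := Ordinal lt.
  apply: r_set (eval_var _ _) (He u _ fr s'i) _.
  rewrite s'i updE 1?eq_sym //; split=> //; split.
    by apply: frame_upd; [rewrite !inE eqxx orbT|apply: frame_upd; [rewrite !inE eqxx|]].
  move=> v; rewrite ltnS leq_eqVlt updE // updD.
  case: eqP => [vi _|_ /= /H//]; by congr g; apply: val_inj.
- by move=> s' [fr H] _; split=> // u; apply: H.
Qed.

(** The last premise on [s'] lets [e] read the old entry at the current cell, as in-place updates
    such as [Mark] and [Relabel] do. *)
Lemma fill_mat X e s (g : 'I_n -> 'I_n -> nat) :
  X \notin [:: 0; 20; 21] -> s 0 1 = n ->
  (forall (u v : 'I_n) s', frame [:: X; 20; 21] s s' -> s' 20 0 = u -> s' 21 0 = v ->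
     s' X (u * n + v) = s X (u * n + v) -> eval W s' e = g u v) ->
  runs (Fill X e) s (fun s' => frame [:: X; 20; 21] s s' /\
    forall u v : 'I_n, s' X (u * n + v) = g u v).
Proof.
move=> X20 sn He; set xs := [:: X; 20; 21] in He *.
have X0 : 0 != X by apply: contraNneq X20 => <-; rewrite inE.
have XC : X != 20 by apply: contraNneq X20 => ->; rewrite !inE.
have XC' : X != 21 by apply: contraNneq X20 => ->; rewrite !inE.
have f0 s' : frame xs s s' -> s' 0 1 = n by move=> fr; rewrite fr // !inE negb_or X0.
have inX : X \in xs by rewrite !inE eqxx.
have in20 : 20 \in xs by rewrite !inE eqxx !orbT.
have in21 : 21 \in xs by rewrite !inE eqxx !orbT.
pose J m s' := frame xs s s' /\ forall u v : 'I_n,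
  s' X (u * n + v) = if u * n + v < m then g u v else s X (u * n + v).
have Ju m s' y i w : y != X -> y \in xs -> J m s' -> J m (update s' y i w).
  move=> yX yin [fr H]; split; first by apply: frame_upd.
  by move=> u v; rewrite updE 1?eq_sym.
apply: (r_for (N := n) (I := fun i s' => J (i * n) s')).
- exact: lim_n.
- exact: n_lt_W.
- by apply: Ju => //; rewrite 1?eq_sym.
- by move=> i s' _ [fr _] _; apply: eval_n; apply: f0.
- move=> i s' lti Ji s'i.
  apply: (r_for (N := n) (I := fun j s' => s' 20 0 = i /\ J (i * n + j) s')).
  + exact: lim_n.
  + exact: n_lt_W.
  + by rewrite updE // addn0; split=> //; apply: Ju => //; rewrite 1?eq_sym.
  + by move=> j s1 _ [_ [fr _]] _; apply: eval_n; apply: f0.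
  + move=> j s1 ltj [s1i [fr H]] s1j; pose u := Ordinal lti; pose v := Ordinal ltj.
    apply: r_set (eval_cell (u := u) (v := v) (f0 _ fr) _ _) (He u v _ fr _ _ _) _; rewrite ?eval_var //.
      by rewrite H ltnn.
    rewrite updE 1?eq_sym //; split=> //; split; first by rewrite updE // updE 1?eq_sym.
    split; first by apply: frame_upd => //; apply: frame_upd.
    move=> u' v'; rewrite updE // updD.
    case: eqP => [/cell_inj[-> ->]|ne]; first by rewrite /= addnS ltnSn.
    rewrite H addnS ltnS [in RHS]leq_eqVlt; case: eqP => // e1; by case: ne.
  + move=> s1 [s1i Js] _; split=> //.
    by apply: Ju; rewrite 1?eq_sym // mulSn addnC.
- move=> s' [fr H] _; split=> // u v.
  by rewrite H cell_lt.
Qed.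

End Tables.

End Machine.

Arguments r_skip {W lim s Q}.
Arguments r_set {W lim x e1 e2 i v s Q}.
Arguments r_setv {W lim x e v s Q}.
Arguments r_seq {W lim c1 c2 s Q Q'}.
Arguments r_then {W lim} t {c1 c2 s Q}.
Arguments r_if {W lim e c1 c2 s Q}.
Arguments r_conseq {W lim c s Q Q'}.

(** * Breadth-first search *)

Section Bfs.

Variables (V : finType) (R : rel V) (src : V) (num : V -> nat).

(** The first [h] vertices of the queue [q] have been processed. *)
Record explored (q : seq V) (h : nat) (par lev : V -> nat) : Prop := Explored {
  e_uniq : uniq q;
  e_src : src \in q;
  e_par : forall v, (par v != 0) = (v \in q);
  e_par_src : par src = (num src).+1;
  e_lev_src : lev src = 0;
  e_tree : forall v, v \in q -> v != src ->
    exists u, [/\ u \in q, par v = (num u).+1, R u v & lev v = (lev u).+1];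
  e_sorted : forall i j, i <= j -> j < size q -> lev (nth src q i) <= lev (nth src q j);
  e_front : h < size q -> forall v, v \in q -> lev v <= (lev (nth src q h)).+1;
  e_done : forall i v, i < h -> i < size q -> R (nth src q i) v ->
    v \in q /\ lev v <= (lev (nth src q i)).+1
}.

Lemma explored_init : 
  explored [:: src] 0 (fun v => if v == src then (num src).+1 else 0) (fun => 0).
Proof.
split=> //=; first by rewrite mem_head.
- by move=> v; rewrite inE; case: (v == src).
- by rewrite eqxx.
- by move=> v; rewrite inE => /eqP->; rewrite eqxx.
Qed.

(** [lev] exists only in the proof. By [e_front] no earlier vertex has a larger level than the new
    one, so the queue stays sorted. *)
Lemma explored_add q h par lev v :
  explored q h par lev -> h < size q -> v \notin q -> R (nth src q h) v ->
  explored (rcons q v) h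
    (fun x => if x == v then (num (nth src q h)).+1 else par x)
    (fun x => if x == v then (lev (nth src q h)).+1 else lev x).
Proof.
move=> [H1 H2 H3 H4 H5 H6 H7 H8 H9] hq vq Ruv.
set u := nth src q h in Ruv *; have uq : u \in q by apply: mem_nth.
have neq x : x \in q -> (x == v) = false by move=> xq; apply: contraNF vq => /eqP <-.
have nthE i : i < size q -> nth src (rcons q v) i = nth src q i.
  by move=> lt; rewrite nth_rcons lt.
split=> //.
- by rewrite rcons_uniq vq.
- by rewrite mem_rcons inE H2 orbT.
- by move=> x; rewrite mem_rcons inE; case: (x == v) => /=.
- by rewrite neq.
- by rewrite neq.
- move=> x; rewrite mem_rcons inE; case: eqP => /= [-> _ _|_ xq xs].
    by exists u; rewrite mem_rcons inE uq orbT neq.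
  have [w [wq -> Rwx ->]] := H6 _ xq xs.
  by exists w; rewrite mem_rcons inE wq orbT neq.
- move=> i j ij; rewrite size_rcons ltnS leq_eqVlt => /orP[/eqP ej|jq].
    rewrite [in X in _ <= X]nth_rcons ej ltnn eqxx eqxx.
    move: ij; rewrite leq_eqVlt => /orP[/eqP->|ij]; first by rewrite ej nth_rcons ltnn eqxx eqxx.
    have iq : i < size q by rewrite -ej.
    by rewrite nthE // neq ?mem_nth // H8 // mem_nth.
  have iq := leq_ltn_trans ij jq.
  by rewrite !nthE // !neq ?mem_nth // H7.
- move=> _ x; rewrite mem_rcons inE nthE // -/u (neq _ uq).
  by case: eqP => //= _ xq; apply: H8.
- move=> i x ih; rewrite size_rcons => _; have iq := ltn_trans ih hq.
  rewrite nthE // (neq _ (mem_nth _ iq)) => /(H9 _ _ ih iq)[xq le].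
  by rewrite mem_rcons inE xq orbT neq.
Qed.

Lemma explored_next q h par lev :
  explored q h par lev ->
  (h < size q -> forall v, R (nth src q h) v -> v \in q /\ lev v <= (lev (nth src q h)).+1) ->
  explored q h.+1 par lev.
Proof.
move=> [H1 H2 H3 H4 H5 H6 H7 H8 H9] H; split=> //.
- move=> hq v vq; apply: leq_trans (H8 (ltnW hq) _ vq) _; rewrite ltnS.
  by apply: H7.
- move=> i v; rewrite ltnS leq_eqVlt => /orP[/eqP->|ih] iq; first by apply: H.
  exact: H9.
Qed.

Variables (q : seq V) (h : nat) (par lev : V -> nat).
Hypothesis ex : explored q h par lev.
Hypothesis all_done : size q <= h.

(** Once all vertices of the queue are processed, levels grow by at most 1 along an arc. Hence no
    path from the source is shorter than the level of its last vertex. *)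
Lemma explored_reach x p : x \in q -> path R x p ->
  last x p \in q /\ lev (last x p) <= lev x + size p.
Proof.
elim: p x => [|y p IH] x xq /=; first by rewrite addn0.
move=> /andP[Rxy pth]; have iq : index x q < size q by rewrite index_mem.
have := e_done ex (leq_trans iq all_done) iq; rewrite nth_index // => /(_ _ Rxy)[yq le].
have [H1 H2] := IH _ yq pth; split=> //; apply: leq_trans H2 _.
by rewrite addnS -addSn leq_add2r.
Qed.

(** Parents lead back to the source with levels decreasing by 1, so the path is simple and its
    length is the level. *)
Lemma explored_path v : v \in q ->
  exists p, [/\ path (fun u w => [&& R u w, par w == (num u).+1 & w != src]) src p,
    last src p = v, uniq (src :: p) & size p = lev v].
Proof.
move=> vq.
have [p [H1 H2 H3]] : exists p, [/\
    path (fun u w => [&& R u w, par w == (num u).+1, w != src & lev w == (lev u).+1]) src p,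
    last src p = v & size p = lev v].
  have [m] := ubnP (lev v); elim: m v vq => // m IH v vq lt.
  have [->|vs] := eqVneq v src; first by exists [::]; rewrite (e_lev_src ex).
  have [u [uq pv Ruv lv]] := e_tree ex vq vs.
  have [|p [H1 H2 H3]] := IH u uq; first by rewrite -ltnS -lv.
  exists (rcons p v); rewrite rcons_path last_rcons size_rcons H1 H2 H3 lv Ruv pv !eqxx vs.
  by split.
exists p; split=> //.
  by apply: sub_path H1 => u w /and4P[-> -> ->].
have : sorted ltn (map lev (src :: p)).
  rewrite /= path_map; apply: sub_path H1 => u w /and4P[_ _ _ /eqP] /= ->.
  exact: ltnSn.
by move=> /(sorted_uniq ltn_trans ltnn)/map_uniq.
Qed.

End Bfs.

(** * The search as a program *)

Section Search.

Variables (W : nat) (lim : nat -> nat) (n : nat).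
Hypothesis W_gt : 1000 < W.
Hypothesis n_W : 1000 * n * n < W.
Hypothesis lim_n : forall x, x != 40 -> n <= lim x.

Local Notation runs := (runs W lim).

(** The usual loop until the queue is exhausted, with a fixed number of rounds: at most [n] vertices
    ever enter the queue, and the rounds left over do nothing. *)
Definition Expand :=
  For 22 nE (If (Bin Lt (var 22) (var 25))
   (Seq (setv 26 (Get 14 (var 22)))
   (For 23 nE (If (andE (entry 11 (var 26) (var 23)) (notE (Get 13 (var 23))))
     (Seq (Set_ 13 (var 23) (Bin Add (var 26) (Const 1)))
     (Seq (Set_ 14 (var 25) (var 23))
          (setv 25 (Bin Add (var 25) (Const 1))))) Skip))) Skip).

Variables (R : rel 'I_n) (src : 'I_n).
Local Notation num := (@nat_of_ord n).

Definition shows (s : store) q (par : 'I_n -> nat) :=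
  [/\ s 25 0 = size q, forall i, i < size q -> s 14 i = nth src q i
    & forall v : 'I_n, s 13 v = par v].

Lemma size_queue (q : seq 'I_n) : uniq q -> size q <= n.
Proof. by move=> /card_uniqP <-; rewrite -[X in _ <= X]card_ord max_card. Qed.

Lemma r_expand s :
  s 0 1 = n -> (forall u v : 'I_n, s 11 (u * n + v) = R u v) ->
  shows s [:: src] (fun v => if v == src then (num src).+1 else 0) ->
  runs Expand s (fun s' => frame [:: 13; 14; 22; 23; 25; 26] s s' /\
    exists q par lev, explored R src num q n par lev /\ shows s' q par).
Proof.
move=> sn sR sh0; set xs := [:: 13; 14; 22; 23; 25; 26].
have fn s' : frame xs s s' -> eval W s' nE = n by move=> fr; apply: eval_n => //; rewrite fr.
have fR s' (u v : 'I_n) : frame xs s s' -> s' 11 (u * n + v) = R u v by move=> fr; rewrite fr.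
have nW := n_lt_W W_gt n_W.
apply: (r_for W_gt (N := n) (I := fun h s' => frame xs s s' /\
   exists q par lev, explored R src num q h par lev /\ shows s' q par)) => //.
- exact: lim_n.
- split; first by apply: frame_upd.
  do 3 eexists; split; first exact: (explored_init R src num).
  by case: sh0.
- by move=> h s' _ [fr _] _; apply: fn.
- move=> h s1 lth [fr1 [q [par [lev [ex [sh1 sh2 sh3]]]]]] s1h.
  apply: r_if => [|].
    rewrite (eval_lt W_gt (eval_var _ _ _) (eval_var _ _ _)) s1h sh1 eqb0 negbK => hq.
    set u := nth src q h.
    apply: (r_seq (Q' := fun s2 => [/\ frame xs s s2, s2 22 0 = h, s2 26 0 = u & shows s2 q par])).
      apply: (r_setv (v := u)); first by rewrite (eval_get _ (eval_var _ _ _)) s1h sh2.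
      by split=> //; apply: frame_upd.
    move=> s2 [fr2 s2h s2u sh].
    apply: (r_for W_gt (N := n) (I := fun j s' => [/\ frame xs s s', s' 22 0 = h, s' 26 0 = u &
      exists q par lev, [/\ explored R src num q h par lev, shows s' q par, h < size q,
        nth src q h = u & forall v : 'I_n, v < j -> R u v -> v \in q /\ lev v <= (lev u).+1]])) => //.
    + exact: lim_n.
    + split=> //; first by apply: frame_upd.
      by exists q, par, lev.
    + by move=> j s' _ [fr _ _ _] _; apply: fn.
    + move=> j s3 ltj [fr3 s3h s3u [q_ [par_ [lev_ [ex_ [sh1_ sh2_ sh3_] hq' qu dn]]]]] s3j.
      pose v := Ordinal ltj.
      have eC : eval W s3 (andE (entry 11 (var 26) (var 23)) (notE (Get 13 (var 23))))
          = R u v && (par_ v == 0).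
        apply: eval_and => //; last by apply: eval_not => //; rewrite (eval_get _ (eval_var _ _ _)) s3j -[j]/(nat_of_ord v) sh3_.
        by rewrite (eval_entry W_gt n_W _ (u := u) (v := v)) ?eval_var ?fR // fr3.
      apply: r_if; rewrite eC.
        rewrite eqb0 negbK => /andP[Ruv pv].
        have vq : v \notin q_ by rewrite -(e_par ex_) pv.
        have sq : size q_ < n by have := size_queue (e_uniq (explored_add ex_ hq' vq _)); rewrite qu size_rcons; apply.
        apply: (r_then (update s3 13 v u.+1)).
          apply: (r_set (i := v) (v := u.+1)) => //; first by rewrite eval_var.
          rewrite (eval_succ W_gt (eval_var _ _ _)) s3u //.
          by apply: leq_ltn_trans nW; apply: ltn_ord.
        apply: (r_then (update (update s3 13 v u.+1) 14 (size q_) v)).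
          by apply: (r_set (i := size q_) (v := v)) => //; rewrite eval_var /update /=.
        apply: (r_setv (v := (size q_).+1)).
          rewrite (eval_succ W_gt (eval_var _ _ _)) /update /= sh1_ //.
          exact: leq_ltn_trans sq nW.
        have neqv x : x \in q_ -> (x == v) = false by move=> xq; apply: contraNF vq => /eqP <-.
        have uq : u \in q_ by rewrite -qu mem_nth.
        split; first by rewrite /update.
        split=> //; first by do 4 (apply: frame_upd => //).
        exists (rcons q_ v), (fun x => if x == v then u.+1 else par_ x),
           (fun x => if x == v then (lev_ u).+1 else lev_ x).
        split.
        * by have := explored_add ex_ hq' vq; rewrite qu; apply.
        * split; first by rewrite size_rcons.
            move=> i; rewrite size_rcons ltnS leq_eqVlt nth_rcons /update /=.
            case: eqVneq => [->|ne /= lt]; first by rewrite ltnn.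
            by rewrite lt sh2_.
          by move=> x; rewrite /update /= -val_eqE sh3_.
        * by rewrite size_rcons ltnW.
        * by rewrite nth_rcons hq'.
        * move=> x; rewrite mem_rcons inE ltnS leq_eqVlt (neqv _ uq) => /orP[/eqP xj|xj] Rux.
            have -> : x = v by apply: val_inj.
            by rewrite eqxx.
          have [xq le] := dn _ xj Rux.
          by rewrite xq orbT neqv.
      move=> /eqP; rewrite eqb0 => nv; apply: r_skip; split=> //; split=> //; first by apply: frame_upd.
      exists q_, par_, lev_; split=> // x; rewrite ltnS leq_eqVlt => /orP[/eqP xj|xj] Rux; last exact: dn.
      have xv : x = v by apply: val_inj.
      move: nv; rewrite -xv Rux /= => px; have xq : x \in q_ by rewrite -(e_par ex_).
      by split=> //; have := e_front ex_ hq' xq; rewrite qu.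
    + move=> s3 [fr3 s3h _ [q' [par' [lev' [ex' sh' hq' qu dn]]]]] _.
      split=> //; split; first by apply: frame_upd.
      exists q', par', lev'; split; last by case: sh'.
      by apply: explored_next => // _ v; rewrite qu; apply: dn.
  rewrite (eval_lt W_gt (eval_var _ _ _) (eval_var _ _ _)) s1h sh1 => /eqP; rewrite eqb0 => hq.
  apply: r_skip; split=> //; split; first by apply: frame_upd.
  by exists q, par, lev; split=> //; apply: explored_next => // hq'; rewrite hq' in hq.
Qed.


Definition FindEnd :=
  Seq (setv 28 (Const 0))
  (Seq (setv 26 (var 24))
  (For 22 nE (If (Bin Lt (var 22) (var 25))
    (If (andE (notE (var 28)) (Get 12 (Get 14 (var 22))))
      (Seq (setv 26 (Get 14 (var 22))) (setv 28 (Const 1))) Skip) Skip))).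

(** Levels do not decrease along the queue, so the first target in it is a nearest one. *)
Lemma r_find_end s (T : pred 'I_n) q par lev :
  s 0 1 = n -> explored R src num q n par lev -> shows s q par ->
  (forall v : 'I_n, s 12 v = T v) -> has T q ->
  runs FindEnd s (fun s' => frame [:: 22; 26; 28] s s' /\
    exists e, [/\ e \in q, T e, s' 26 0 = nat_of_ord e & forall x, x \in q -> T x -> lev e <= lev x]).
Proof.
move=> sn ex [sh1 sh2 sh3] sT hasT; set xs := [:: 22; 26; 28].
have fn s' : frame xs s s' -> eval W s' nE = n by move=> fr; apply: eval_n => //; rewrite fr.
have nW := n_lt_W W_gt n_W; have qn := size_queue (e_uniq ex).
apply: (r_seq (Q' := fun s' => frame xs s s' /\ s' 28 0 = 0)).
  by apply: (r_setv (v := 0)); [apply: eval_const|split=> //; apply: frame_upd].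
move=> s1 [fr1 s1f].
apply: (r_seq (Q' := fun s' => frame xs s s' /\ s' 28 0 = 0)).
  by apply: (r_setv (v := s1 24 0)); [rewrite eval_var|split=> //; apply: frame_upd].
move=> {s1 fr1 s1f} s1 [fr1 s1f].
apply: (r_for W_gt (N := n) (I := fun h s' => frame xs s s' /\
  ((s' 28 0 = 0 /\ forall j, j < h -> j < size q -> ~~ T (nth src q j)) \/
   (s' 28 0 = 1 /\ exists i, [/\ i < size q, T (nth src q i), s' 26 0 = nat_of_ord (nth src q i) &
      forall j, j < i -> ~~ T (nth src q j)])))) => //.
- exact: lim_n.
- by split; [apply: frame_upd|left].
- by move=> h s' _ [fr _] _; apply: fn.
- move=> h s2 lth [fr2 inv] s2h; apply: r_if.
    rewrite (eval_lt W_gt (eval_var _ _ _) (eval_var _ _ _)) s2h fr2 // sh1 eqb0 negbK => hq.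
    have eG : eval W s2 (Get 14 (var 22)) = nth src q h.
      by rewrite (eval_get _ (eval_var _ _ _)) s2h fr2 // sh2.
    have eC : eval W s2 (andE (notE (var 28)) (Get 12 (Get 14 (var 22)))) =
       (s2 28 0 == 0) && T (nth src q h).
      apply: eval_and => //; first by apply: eval_not => //; rewrite eval_var.
      by rewrite (eval_get _ eG) fr2 // sT.
    apply: r_if; rewrite eC.
      rewrite eqb0 negbK => /andP[/eqP f0 Th].
      apply: (r_then (update s2 26 0 (nth src q h))).
        by apply: (r_setv (v := nth src q h)).
      apply: (r_setv (v := 1)); first exact: eval_const.
      split=> //; split; first by do 3 (apply: frame_upd => //).
      right; split=> //; exists h; split=> // j jh.
      by case: inv => [[_ H]|[H _]]; [apply: H => //; apply: ltn_trans hq | rewrite H in f0].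
    move=> /eqP; rewrite eqb0 negb_and => nT; apply: r_skip; split=> //; split; first by apply: frame_upd.
    case: inv => [[f0 H]|[f1 H]]; [left|right]; split=> // j.
    rewrite ltnS leq_eqVlt => /orP[/eqP->|/H//] _.
    by move: nT; rewrite f0.
  rewrite (eval_lt W_gt (eval_var _ _ _) (eval_var _ _ _)) s2h fr2 // sh1 => /eqP; rewrite eqb0 -leqNgt => hq.
  apply: r_skip; split=> //; split; first by apply: frame_upd.
  case: inv => [[f0 H]|[f1 H]]; [left|right]; split=> // j.
  rewrite ltnS leq_eqVlt => /orP[/eqP->|/H//].
  by rewrite ltnNge hq.
move=> s2 [fr2 inv] _; split=> //.
case: inv => [[_ H]|[_ [i [iq Ti s2e H]]]].
  have := nth_find src hasT; rewrite has_find in hasT.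
  by rewrite (negPf (H _ (leq_trans hasT qn) hasT)).
exists (nth src q i); split=> //; first exact: mem_nth.
move=> x xq Tx; rewrite -(nth_index src xq); apply: (e_sorted ex); last by rewrite index_mem.
by rewrite leqNgt; apply/negP => /H; rewrite nth_index // Tx.
Qed.

(** The source is its own parent; once it is reached, the remaining rounds do nothing. *)
Definition Back :=
  Seq (setv 30 (var 26))
  (Seq (Fill 17 (Const 0))
  (Seq (setv 27 (Const 1))
  (Seq (Set_ 15 (Const 0) (var 26))
  (For 22 nE (If (Bin Eq (Get 13 (var 26)) (Bin Add (var 26) (Const 1))) Skip
     (Seq (setv 29 (Bin Sub (Get 13 (var 26)) (Const 1)))
     (Seq (Set_ 17 (cell (var 29) (var 26)) (Const 1))
     (Seq (setv 26 (var 29))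
     (Seq (Set_ 15 (var 27) (var 26))
          (setv 27 (Bin Add (var 27) (Const 1)))))))))))).

Definition found (s : store) p :=
  [/\ s 30 0 = num (last src p), forall u v : 'I_n, s 17 (u * n + v) = arcw src p u v,
      s 27 0 = (size p).+1
    & forall t, t <= size p -> s 15 t = nth src (rev (src :: p)) t].

Lemma r_back s (par : 'I_n -> nat) p :
  s 0 1 = n -> (forall v : 'I_n, s 13 v = par v) -> s 26 0 = last src p ->
  par src = src.+1 -> uniq (src :: p) ->
  path (fun u w => [&& R u w, par w == (num u).+1 & w != src]) src p ->
  runs Back s (fun s' => frame [:: 15; 17; 20; 21; 22; 26; 27; 29; 30] s s' /\ found s' p).
Proof.
move=> sn sp sc psrc up pth; set xs := [:: 15; 17; 20; 21; 22; 26; 27; 29; 30].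
have nW := n_lt_W W_gt n_W.
have pn : size p < n by have := size_queue up.
apply: (r_seq (Q' := fun s' => [/\ frame xs s s', s' 30 0 = num (last src p) & s' 26 0 = last src p])).
  by apply: (r_setv (v := last src p)); [rewrite eval_var|split=> //; apply: frame_upd].
move=> s1 [fr1 s1e s1c].
apply: (r_seq (Q' := fun s' => [/\ frame xs s s', s' 30 0 = num (last src p), s' 26 0 = last src p
   & forall u v : 'I_n, s' 17 (u * n + v) = 0])).
  apply: (r_conseq (fill_mat W_gt n_W lim_n (g := fun _ _ => 0) _ _ _)) => //.
    by rewrite fr1.
    by move=> *; apply: eval_const.
  move=> s2 [fr2 s2A]; split=> //; try by rewrite fr2.
  by apply: frame_trans fr1 (frame_sub fr2 _); apply/allP.
move=> {s1 fr1 s1e s1c} s1 [fr1 s1e s1c s1A].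
apply: (r_then (update s1 27 0 1)); first by apply: (r_setv (v := 1)) => //; apply: eval_const.
apply: (r_then (update (update s1 27 0 1) 15 0 (last src p))).
  by apply: (r_set (i := 0) (v := last src p)) => //; [apply: eval_const|rewrite eval_var].
(* [p1] is still to be traced, [p2] has been. A round either moves one vertex or finds [p1] empty,
   and [p] has fewer than [n] arcs, so [n] rounds suffice. *)
apply: (r_for W_gt (N := n) (I := fun i s' => [/\ frame xs s s', s' 30 0 = num (last src p) &
   exists p1 p2, [/\ p = p1 ++ p2, p1 = [::] \/ size p2 = i, s' 26 0 = num (last src p1),
    forall u v : 'I_n, s' 17 (u * n + v) = ((u, v) \in arcs (last src p1) p2) &
    s' 27 0 = (size p2).+1 /\
    forall t, t <= size p2 -> s' 15 t = nth src (rev (last src p1 :: p2)) t]])) => //.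
- exact: lim_n.
- split=> //; first by do 3 (apply: frame_upd => //).
  exists p, [::]; rewrite cats0; split=> //=; first by right.
  by split=> // t; rewrite leqn0 => /eqP->.
- by move=> i s' _ [fr _ _] _; apply: eval_n => //; rewrite fr.
- move=> i s2 lti [fr2 s2e [p1 [p2 [pE alt s2c s2A [s2l s2p]]]]] s2i.
  have eC : eval W s2 (Bin Eq (Get 13 (var 26)) (Bin Add (var 26) (Const 1)))
      = (par (last src p1) == (last src p1).+1).
    apply: eval_eq => //; first by rewrite (eval_get _ (eval_var _ _ _)) s2c fr2.
    rewrite (eval_succ W_gt (eval_var _ _ _)) s2c //.
    by apply: leq_ltn_trans nW; apply: ltn_ord.
  apply: r_if; rewrite eC.
    rewrite eqb0 negbK => pe; apply: r_skip; split=> //; split=> //; first by apply: frame_upd.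
    exists p1, p2; split=> //; left.
    (* Only the source is its own parent: elsewhere on [p] the parent is the preceding vertex, and
       [p] is simple. *)
    case/lastP: p1 pE pe {alt s2c s2A s2p eC} => // p1 w pE.
    move: pth up; rewrite pE cat_path rcons_path last_rcons => /andP[/andP[_ /and3P[_ /eqP-> _]] _].
    rewrite -cat_cons -rcons_cons cat_uniq rcons_uniq => /andP[/andP[nw _] _] /eqP[/val_inj e].
    by move: nw; rewrite -e mem_last.
  move=> /eqP; rewrite eqb0 => pe.
  case/lastP: p1 pE pe alt s2c s2A s2p eC => [_|p1 w]; first by rewrite /= psrc eqxx.
  rewrite last_rcons => pE pe alt s2c s2A s2p eC.
  have {alt} sp2 : size p2 = i by case: alt => // /(congr1 size); rewrite size_rcons.
  set u := last src p1.
  have [Ruw pw] : R u w /\ par w = u.+1.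
    by move: pth; rewrite pE cat_path rcons_path => /andP[/andP[_ /and3P[-> /eqP-> _]] _].
  have un : u < n by apply: ltn_ord.
  apply: (r_then (update s2 29 0 u)).
    apply: (r_setv (v := u)) => //.
    have -> : nat_of_ord u = u.+1 - 1 by rewrite subn1.
    apply: eval_sub; [|exact: eval_const|exact: leq_ltn_trans un nW].
    by rewrite (eval_get _ (eval_var _ _ _)) s2c fr2 // sp.
  apply: (r_then (update (update s2 29 0 u) 17 (u * n + w) 1)).
    apply: (r_set (i := u * n + w) (v := 1)) => //; last exact: eval_const.
    by apply: (eval_cell W_gt n_W (u := u) (v := w)); rewrite ?eval_var //= /update /= fr2.
  set s3 := update _ 17 _ _.
  apply: (r_then (update s3 26 0 u)).
    by apply: (r_setv (v := u)) => //; rewrite eval_var.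
  apply: (r_then (update (update s3 26 0 u) 15 i.+1 u)).
    by apply: (r_set (i := i.+1) (v := u)) => //; rewrite eval_var // /s3 /update /= s2l sp2.
  apply: (r_setv (v := i.+2)).
    have e27 : update (update s3 26 0 u) 15 i.+1 u 27 0 = i.+1 by rewrite /s3 /update /= s2l sp2.
    rewrite (eval_succ W_gt (eval_var _ _ _)) e27 //.
    by apply: leq_ltn_trans n_W; move: lti; clear; nia.
  split; first by rewrite /s3 /update.
  split.
  + by do 6 (apply: frame_upd => //).
  + by rewrite /s3 /update.
  exists p1, (w :: p2); split.
  + by rewrite pE cat_rcons.
  + by right; rewrite /= sp2.
  + by rewrite /s3 /update.
  + move=> u' v'; rewrite /s3 /update /= inE xpair_eqE.
    case: (eqVneq (u' * n + v') (u * n + w)) => [/cell_inj[-> ->]|ne]; first by rewrite !eqxx.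
    rewrite s2A; case: (eqVneq u' u) => //= eu; case: (eqVneq v' w) => //= ev.
    by case/eqP: ne; rewrite eu ev.
  + split; first by rewrite /s3 /update /= sp2.
    move=> t le; rewrite rev_cons nth_rcons size_rev /s3 /update /= sp2.
    move: le; rewrite leq_eqVlt ltnS; case: eqVneq => [-> _|ne /= le].
      by rewrite /= sp2 ltnn eqxx.
    by move: ne le; rewrite /= ltnS sp2 => /negPf-> le; rewrite le s2p // sp2.
move=> s2 [fr2 s2e [p1 [p2 [pE alt s2c s2A [s2l s2p]]]]] _; split=> //.
have {}alt : p1 = [::].
  by case: alt => // sp2; move: pn; rewrite pE size_cat sp2 ltnNge leq_addl.
subst p1; rewrite /= in pE; subst p2; split=> // u v.
rewrite s2A; have := arcw_le1 u v up; rewrite /arcw -has_pred1 has_count.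
by case: count => [|[|c]].
Qed.

Definition Search :=
  Seq (FillV 13 (Const 0))
  (Seq (Set_ 13 (var 24) (Bin Add (var 24) (Const 1)))
  (Seq (Set_ 14 (Const 0) (var 24))
  (Seq (setv 25 (Const 1))
  (Seq Expand (Seq FindEnd Back))))).

Definition scratch := [:: 13; 14; 15; 17; 20; 21; 22; 23; 25; 26; 27; 28; 29; 30].

(** Minimality turns a short path, known to exist by expansion, into a bound on the path found. *)
Lemma r_search s (T : pred 'I_n) :
  s 0 1 = n -> s 24 0 = src -> (forall u v : 'I_n, s 11 (u * n + v) = R u v) ->
  (forall v : 'I_n, s 12 v = T v) -> (exists p, path R src p /\ T (last src p)) ->
  runs Search s (fun s' => frame scratch s s' /\ exists p,
    [/\ path R src p, uniq (src :: p), T (last src p),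
      forall p', path R src p' -> T (last src p') -> size p <= size p' & found s' p]).
Proof.
move=> sn s24 sR sT [p0 [pth0 T0]].
have nW := n_lt_W W_gt n_W.
apply: (r_seq (Q' := fun s' => frame scratch s s' /\ forall v : 'I_n, s' 13 v = 0)).
  apply: (r_conseq (fill_vec W_gt n_W lim_n (g := fun _ => 0) _ _ _)) => //.
    by move=> *; apply: eval_const.
  move=> s2 [fr2 s2A]; split=> //.
  by apply: (frame_sub fr2 _); apply/allP.
move=> s1 [fr1 s1p].
apply: (r_then (update s1 13 src src.+1)).
  apply: (r_set (i := src) (v := src.+1)) => //; first by rewrite eval_var fr1.
  rewrite (eval_succ W_gt (eval_var _ _ _)) fr1 // s24 //.
  by apply: leq_ltn_trans nW; apply: ltn_ord.
apply: (r_then (update (update s1 13 src src.+1) 14 0 src)).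
  apply: (r_set (i := 0) (v := src)) => //; first exact: eval_const.
  by rewrite eval_var /update /= fr1.
apply: (r_then (update (update (update s1 13 src src.+1) 14 0 src) 25 0 1)).
  by apply: (r_setv (v := 1)) => //; exact: eval_const.
set s2 := update _ 25 _ _.
have fr2 : frame scratch s s2 by do 3 (apply: frame_upd => //).
apply: (r_seq (Q' := fun s' => frame scratch s s' /\
    exists q par lev, explored R src num q n par lev /\ shows s' q par)).
  apply: (r_conseq (r_expand (s := s2) _ _ _)).
  - by rewrite fr2.
  - by move=> u v; rewrite fr2.
  - split=> //; first by case.
    by move=> v; rewrite /s2 /update /= val_eqE s1p.
  move=> s3 [fr3 H]; split=> //.
  by apply: frame_trans fr2 (frame_sub fr3 _); apply/allP.
move=> {s1 fr1 s1p fr2} {}s2 [fr2 [q [par [lev [ex sh]]]]].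
have [reach0 _] := explored_reach ex (size_queue (e_uniq ex)) (e_src ex) pth0.
apply: (r_seq (Q' := fun s' => [/\ frame scratch s s', shows s' q par &
   exists e, [/\ e \in q, T e, s' 26 0 = nat_of_ord e & forall x, x \in q -> T x -> lev e <= lev x]])).
  apply: (r_conseq (r_find_end (T := T) _ ex sh _ _)).
  - by rewrite fr2.
  - by move=> v; rewrite fr2.
  - by apply/hasP; exists (last src p0).
  move=> s3 [fr3 H]; split=> //.
    by apply: frame_trans fr2 (frame_sub fr3 _); apply/allP.
  case: sh => sh1 sh2 sh3; split; first by rewrite fr3.
    by move=> i /sh2; rewrite fr3.
  by move=> v; rewrite fr3.
move=> s3 [fr3 [sh1 sh2 sh3] [e [eq Te s3e min]]].
have [p [pth le up sp]] := explored_path ex eq.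
apply: (r_conseq (r_back (s := s3) (par := par) (p := p) _ _ _ _ _ _)) => //.
- by rewrite fr3.
- by rewrite s3e le.
- exact: e_par_src ex.
move=> s4 [fr4 fnd]; split.
  by apply: frame_trans fr3 (frame_sub fr4 _); apply/allP.
exists p; split=> //.
- by apply: sub_path pth => u v /and3P[].
- by rewrite le.
move=> p' pth' T'; have [r' l'] := explored_reach ex (size_queue (e_uniq ex)) (e_src ex) pth'.
by rewrite sp; apply: leq_trans (min _ r' T') _; rewrite (e_lev_src ex) in l'.
Qed.

End Search.

(** * Computing the flow and the set B *)

Section Procedures.

Variables (W : nat) (lim : nat -> nat) (n : nat).
Hypothesis W_gt : 1000 < W.
Hypothesis n_W : 1000 * n * n < W.
Hypothesis lim_n : forall x, x != 40 -> n <= lim x.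

Local Notation runs := (runs W lim).
Local Notation V := (vertices n).

Lemma eval_entry_v s X x y (u v : 'I_n) : s 0 1 = n -> s x 0 = u -> s y 0 = v ->
  eval W s (entry X (var x) (var y)) = s X (u * n + v).
Proof. by move=> sn sx sy; apply: eval_entry => //; rewrite eval_var. Qed.

Lemma eval_get_v s X x i : s x 0 = i -> eval W s (Get X (var x)) = s X i.
Proof. by move=> <-; rewrite (eval_get _ (eval_var _ _ _)). Qed.

Definition demE SE x := Bin Sub (Bin Add (Bin Div dE (Const 4)) (Get 7 x)) (Get SE x).
Definition Residual :=
  Fill 11 (andE (Get 9 (var 20)) (orE (entry 10 (var 21) (var 20))
    (andE (entry 16 (var 20) (var 21)) (notE (entry 10 (var 20) (var 21)))))).
Definition Augment :=
  Fill 18 (orE (andE (entry 17 (var 20) (var 21)) (notE (entry 10 (var 21) (var 20))))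
               (andE (entry 10 (var 20) (var 21)) (notE (entry 17 (var 21) (var 20))))).
Definition Flow SE :=
  Seq (Fill 10 (Const 0))
  (Seq (FillV 12 (notE (Get 9 (var 20))))
  (For 31 nE (If (Get 9 (var 31))
    (For 40 (demE SE (var 31))
      (Seq Residual (Seq (setv 24 (var 31)) (Seq Search
        (Seq Augment (Fill 10 (entry 18 (var 20) (var 21)))))))) Skip))).

Definition flow_scratch := scratch ++ [:: 10; 11; 12; 18; 24; 31; 40].

(** Ford-Fulkerson with one unit per search. An augmentation from [x] leaves the amounts sent by the
    other vertices of [B] unchanged, so the vertices can be served one after the other. *)
Lemma r_flow s (base : rel 'I_n) (B : {set V}) (dem : 'I_n -> nat) SE :
  SE \notin flow_scratch ->
  s 0 1 = n -> (forall u v : 'I_n, s 16 (u * n + v) = base u v) ->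
  (forall v : 'I_n, s 9 v = (v \in B)) ->
  (forall v : 'I_n, s 0 2 %/ 4 + s 7 v - s SE v = dem v) ->
  (forall v : 'I_n, s 0 2 %/ 4 + s 7 v <= lim 40) -> lim 40 < W -> s 0 2 < W ->
  @hall V base B dem ->
  runs (Flow SE) s (fun s' => [/\ frame flow_scratch s s',
    forall v : 'I_n, s' 12 v = (v \notin B) &
    exists2 f : rel V, @preflow V base B f dem & forall u v : 'I_n, s' 10 (u * n + v) = f u v]).
Proof.
move=> SEn sn s16 s9 sdem demlim limW dW hl; set fs := flow_scratch.
have nW := n_lt_W W_gt n_W.
have fn s' : frame fs s s' -> s' 0 1 = n by move=> fr; rewrite fr.
apply: (r_seq (Q' := fun s' => frame fs s s' /\ forall u v : 'I_n, s' 10 (u * n + v) = 0)).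
  apply: (r_conseq (fill_mat W_gt n_W lim_n (g := fun _ _ => 0) _ _ _)) => //.
    by move=> *; apply: eval_const.
  by move=> s2 [fr2 s2A]; split=> //; apply: (frame_sub fr2 _); apply/allP.
move=> s1 [fr1 s1F].
apply: (r_seq (Q' := fun s' => [/\ frame fs s s', forall u v : 'I_n, s' 10 (u * n + v) = 0 &
   forall v : 'I_n, s' 12 v = (v \notin B)])).
  apply: (r_conseq (fill_vec W_gt n_W lim_n (s := s1) (g := fun v => v \notin B) _ _ _)) => //.
  - exact: fn.
  - move=> u s' fr' s'u; rewrite (eval_not W_gt (eval_get_v _ s'u)) fr' // fr1 // s9.
    by case: (_ \in _).
  move=> s2 [fr2 s2A]; split=> //; last by move=> u v; rewrite fr2.
  by apply: frame_trans fr1 (frame_sub fr2 _); apply/allP.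
move=> {s1 fr1 s1F} s1 [fr1 s1F s1T].
apply: (r_for W_gt (N := n) (I := fun i s' => [/\ frame fs s s',
   forall v : 'I_n, s' 12 v = (v \notin B) &
   exists (f : rel V) sent, [/\ @preflow V base B f sent,
     forall u v : 'I_n, s' 10 (u * n + v) = f u v &
     forall x : 'I_n, x \in B -> sent x = if x < i then dem x else 0]])) => //.
- exact: lim_n.
- split=> //; first by apply: frame_upd.
  exists (fun _ _ => false), (fun=> 0); split=> //.
  exact: preflow0.
- by move=> i s' _ [fr _ _] _; apply: eval_n => //; apply: fn.
- move=> i s2 lti [fr2 s2T [f [sent [pf s2F snt]]]] s2i; pose x := Ordinal lti.
  have e9 : eval W s2 (Get 9 (var 31)) = (x \in B) by rewrite (eval_get_v _ s2i) fr2 // -[i]/(nat_of_ord x) s9.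
  apply: r_if; rewrite e9; last first.
    move=> xB; apply: r_skip; split=> //; split=> //; first by apply: frame_upd.
    exists f, sent; split=> // y yB; rewrite snt // ltnS [in RHS]leq_eqVlt.
    case: eqP => //= yx; have {}yx : y = x by apply: val_inj.
    by move: yB; rewrite yx; case: (x \in B) xB.
  rewrite eqb0 negbK => xB.
  have dle : dem x <= lim 40 by rewrite -sdem (leq_trans (leq_subr _ _)).
  apply: (r_for W_gt (N := dem x) (I := fun t s' => [/\ frame fs s s', s' 31 0 = i,
     forall v : 'I_n, s' 12 v = (v \notin B) &
     exists (f : rel V) sent, [/\ @preflow V base B f sent,
       forall u v : 'I_n, s' 10 (u * n + v) = f u v &
       forall y : 'I_n, y \in B -> sent y = if y == x then t else if y < i then dem y else 0]])) => //.
  + exact: leq_ltn_trans dle limW.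
  + split=> //; first by apply: frame_upd.
    exists f, sent; split=> // y yB; rewrite snt //; case: eqVneq => // ->.
    by rewrite /= ltnn.
  + move=> t s3 _ [fr3 s3i _ _] _.
    have d4 : s 0 2 %/ 4 + s 7 x < W by apply: leq_ltn_trans limW; apply: demlim.
    have -> : dem x = s 0 2 %/ 4 + s 7 x - s SE x by rewrite sdem.
    apply: eval_sub => //; last by rewrite (eval_get_v _ s3i) fr3.
    apply: eval_add => //; last by rewrite (eval_get_v _ s3i) fr3.
    apply: eval_div => //; last exact: eval_const.
    by rewrite (eval_get _ (eval_const _ _ _)) // fr3.
  + move=> {f sent pf s2F snt} t s3 ltt [fr3 s3i s3T [f [sent [pf s3F snt]]]] s3t.
    have sentx : sent x = t by rewrite snt // eqxx.
    apply: (r_seq (Q' := fun s' => [/\ frame [:: 11; 20; 21] s3 s' &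
        forall u v : 'I_n, s' 11 (u * n + v) = @residual V base B f u v])).
      apply: (r_conseq (fill_mat W_gt n_W lim_n (s := s3) (g := fun u v => @residual V base B f u v) _ _ _)) => //.
        exact: fn.
      move=> u v s' fr' s'u s'v _.
      have s'n : s' 0 1 = n by rewrite fr' // fn.
      apply: eval_and => //; first by rewrite (eval_get_v _ s'u) fr' // fr3 // s9.
      apply: eval_or => //; first by rewrite (eval_entry_v _ s'n s'v s'u) fr' // s3F.
      apply: eval_and => //; first by rewrite (eval_entry_v _ s'n s'u s'v) fr' // fr3 // s16.
      rewrite (eval_not W_gt (eval_entry_v _ s'n s'u s'v)) fr' // s3F.
      by case: (f u v).
    move=> s4 [fr4 s4R].
    apply: (r_seq (Q' := fun s' => [/\ frame [:: 11; 20; 21; 24] s3 s', s' 24 0 = x &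
        forall u v : 'I_n, s' 11 (u * n + v) = @residual V base B f u v])).
      apply: (r_setv (v := x)); first by rewrite eval_var fr4.
      split=> //; apply: frame_upd => //; apply: (frame_sub fr4); exact/allP.
    move=> {s4 fr4 s4R} s4 [fr4 s4x s4R].
    have s4n : s4 0 1 = n by rewrite fr4 // fn.
    have s4T v : s4 12 (nat_of_ord v) = [pred v | v \notin B] v by rewrite fr4 // s3T.
    have aug : exists p, path (@residual V base B f) x p /\ [pred v | v \notin B] (last x p).
      apply: augmenting_path hl pf _ xB _; last by rewrite sentx.
      move=> y yB; rewrite snt //; case: eqP => [->|_]; first exact: ltnW.
      by case: (y < i).
    apply: (r_seq (r_search W_gt n_W lim_n (T := [pred v | v \notin B]) s4n s4x s4R s4T aug)).
    move=> s5 [fr5 [p [pth up lB _ [_ s5A _ _]]]].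
    have s5n : s5 0 1 = n by rewrite fr5 // fr4 // fn.
    have s5F (u v : 'I_n) : s5 10 (u * n + v) = f u v by rewrite fr5 // fr4 // s3F.
    have s5A' (u v : 'I_n) : s5 17 (u * n + v) = (0 < @arcw V x p u v).
      by rewrite s5A; have := @arcw_le1 V x p u v up; case: (arcw x p u v) => [|[|m]].
    apply: (r_seq (Q' := fun s' => [/\ frame [:: 18; 20; 21] s5 s' &
        forall u v : 'I_n, s' 18 (u * n + v) = @augmented V f x p u v])).
      apply: (r_conseq (fill_mat W_gt n_W lim_n (s := s5) (g := fun u v => @augmented V f x p u v) _ _ _)) => //.
      move=> u v s' fr' s'u s'v _.
      have s'n : s' 0 1 = n by rewrite fr'.
      apply: eval_or => //; apply: eval_and => //.
      * by rewrite (eval_entry_v _ s'n s'u s'v) fr' // s5A'.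
      * by rewrite (eval_not W_gt (eval_entry_v _ s'n s'v s'u)) fr' // s5F; case: (f v u).
      * by rewrite (eval_entry_v _ s'n s'u s'v) fr' // s5F.
      * rewrite (eval_not W_gt (eval_entry_v _ s'n s'v s'u)) fr' // s5A'.
        by case: (arcw x p v u).
    move=> s6 [fr6 s6A].
    have fr36 : frame fs s s6.
      apply: frame_trans fr3 _; apply: frame_trans (frame_sub fr4 _) _; first exact/allP.
      apply: frame_trans (frame_sub fr5 _) (frame_sub fr6 _); exact/allP.
    have s6n : s6 0 1 = n by rewrite fn.
    apply: (r_conseq (fill_mat W_gt n_W lim_n (s := s6) (g := fun u v => @augmented V f x p u v) _ _ _)) => //.
      move=> u v s' fr' s'u s'v _; have s'n : s' 0 1 = n by rewrite fr'.
      by rewrite (eval_entry_v _ s'n s'u s'v) fr' // s6A.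
    move=> s7 [fr7 s7F]; split; first by rewrite fr7 // fr6 // fr5 // fr4.
    split.
    * apply: frame_upd => //; apply: frame_trans fr36 (frame_sub fr7 _); exact/allP.
    * by rewrite updE // fr7 // fr6 // fr5 // fr4.
    * by move=> v; rewrite updE // fr7 // fr6 // fr5 // fr4.
    * exists (@augmented V f x p), (fun y => sent y + (y == x)); split.
      - exact: preflow_augmented.
      - by move=> u v; rewrite updE // s7F.
      - by move=> y yB; rewrite snt //; case: (y == x); rewrite ?addn1 ?addn0.
  + move=> s3 [fr3 s3i s3T [f' [sent' [pf' s3F snt']]]] _; split=> //; split=> //.
      by apply: frame_upd.
    exists f', sent'; split=> // y yB; rewrite snt' // ltnS [in RHS]leq_eqVlt -val_eqE /=.
    by case: eqVneq => // e; congr dem; apply: val_inj.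
- move=> s2 [fr2 s2T [f [sent [[p1 p2 p3 p4] s2F snt]]]] _; split=> //; exists f => //.
  split=> // x xB; rewrite p4 // snt // ltn_ord //.
Qed.

Definition freeE e1 e2 := andE (entry 1 e1 e2) (notE (entry 4 e1 e2)).

Definition Peel :=
  Seq (FillV 9 (Const 0))
  (For 31 nE (For 32 nE (If (notE (Get 9 (var 32)))
    (Seq (setv 33 (Const 0))
    (Seq (setv 34 (Const 0))
    (Seq (For 20 nE
           (Seq (setv 33 (Bin Add (var 33) (andE (notE (Get 9 (var 20))) (freeE (var 32) (var 20)))))
                (setv 34 (Bin Add (var 34) (andE (notE (Get 9 (var 20))) (freeE (var 20) (var 32)))))))
    (If (orE (Bin Lt (Bin Mul (Const 10) (var 33)) (Bin Mul (Const 9) dE))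
             (Bin Lt (Bin Mul (Const 10) (var 34)) (Bin Mul (Const 9) dE)))
        (Set_ 9 (var 32) (Const 1)) Skip)))) Skip))).

Lemma sum_ltS (F : 'I_n -> nat) j (lt : j < n) :
  \sum_(w < n | w < j.+1) F w = \sum_(w < n | w < j) F w + F (Ordinal lt).
Proof.
rewrite (bigD1 (Ordinal lt)) //= addnC; congr (_ + _); apply: eq_bigl => w.
by rewrite ltnS -val_eqE /= ltn_neqAle andbC.
Qed.

Lemma sum_lt_bound (F : 'I_n -> bool) j : \sum_(w < n | w < j) F w <= n.
Proof.
rewrite -[X in _ <= X]card_ord -sum1_card big_mkcond.
by apply: leq_sum => w _; case: (w < j); case: (F w).
Qed.

Definition exposed (free : rel V) d (B : {set V}) v :=
  10 * cnt (ind free) [set v] (~: B) < 9 * d \/ 10 * cnt (ind free) (~: B) [set v] < 9 * d.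

(** A pass over all vertices that adds none shows that no vertex outside [B] is exposed. Otherwise
    [B] grows, so after [n] passes this holds or [B] contains every vertex. *)
Lemma r_peel s (free adj : rel V) d (Inv : {set V} -> Prop) :
  s 0 1 = n -> s 0 2 = d -> d < n ->
  (forall u v : 'I_n, s 1 (u * n + v) = adj u v) ->
  (forall u v : 'I_n, free u v = adj u v && (s 4 (u * n + v) == 0)) ->
  Inv set0 ->
  (forall B v, Inv B -> v \notin B -> exposed free d B v -> Inv (v |: B)) ->
  runs Peel s (fun s' => frame [:: 9; 20; 31; 32; 33; 34] s s' /\ exists B : {set V},
    [/\ Inv B, forall v : 'I_n, s' 9 v = (v \in B) & forall v, v \notin B -> ~ exposed free d B v]).
Proof.
move=> sn sd dn s1 sfree Inv0 Istep; set fs := [:: 9; 20; 31; 32; 33; 34].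
have nW := n_lt_W W_gt n_W.
have fn s' : frame fs s s' -> s' 0 1 = n by move=> fr; rewrite fr.
have efree s' x y (u v : 'I_n) : frame fs s s' -> s' x 0 = u -> s' y 0 = v ->
    eval W s' (freeE (var x) (var y)) = free u v.
  move=> fr s'x s'y; rewrite sfree; apply: eval_and => //.
    by rewrite (eval_entry_v _ (fn _ fr) s'x s'y) fr.
  by rewrite (eval_not W_gt (eval_entry_v _ (fn _ fr) s'x s'y)) fr.
apply: (r_seq (Q' := fun s' => frame fs s s' /\ forall v : 'I_n, s' 9 v = 0)).
  apply: (r_conseq (fill_vec W_gt n_W lim_n (g := fun _ => 0) _ _ _)) => //.
    by move=> *; apply: eval_const.
  by move=> s2 [fr2 s2A]; split=> //; apply: (frame_sub fr2 _); apply/allP.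
move=> s2 [fr2 s2B].
pose closed (B : {set V}) := forall v, v \notin B -> ~ exposed free d B v.
apply: (r_for W_gt (N := n) (I := fun i s' => frame fs s s' /\ exists B : {set V},
   [/\ Inv B, forall v : 'I_n, s' 9 v = (v \in B) & closed B \/ i <= #|B|])) => //.
- exact: lim_n.
- split; first by apply: frame_upd.
  exists set0; split=> //; last by right.
  by move=> v; rewrite inE updE.
- by move=> i s' _ [fr _] _; apply: eval_n => //; apply: fn.
- move=> i s3 lti [fr3 [B0 [IB0 s3B alt]]] s3i.
  apply: (r_for W_gt (N := n) (I := fun j s' => [/\ frame fs s s', s' 31 0 = i & exists B : {set V},
     [/\ Inv B, forall v : 'I_n, s' 9 v = (v \in B), B0 \subset B, closed B0 -> B = B0 &
      B = B0 -> forall v : 'I_n, v < j -> v \notin B -> ~ exposed free d B v]])) => //.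
  + exact: lim_n.
  + split=> //; first by apply: frame_upd.
    by exists B0; split.
  + by move=> j s' _ [fr _ _] _; apply: eval_n => //; apply: fn.
  + move=> j s4 ltj [fr4 s4i [B [IB s4B B0B clB eqB]]] s4j; pose v := Ordinal ltj.
    have e9 : eval W s4 (notE (Get 9 (var 32))) = (v \notin B).
      by rewrite (eval_not W_gt (eval_get_v _ s4j)) -[j]/(nat_of_ord v) s4B; case: (v \in B).
    apply: r_if; rewrite e9; last first.
      move=> /eqP; rewrite eqb0 negbK => vB; apply: r_skip; split=> //; split=> //; first by apply: frame_upd.
      exists B; split=> // eB w; rewrite ltnS leq_eqVlt => /orP[/eqP wj|wj]; last exact: eqB.
      by have -> : w = v by [apply: val_inj]; rewrite vB.
    rewrite eqb0 negbK => vB.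
    pose c1 j' := \sum_(w < n | w < j') ((w \notin B) && free v w).
    pose c2 j' := \sum_(w < n | w < j') ((w \notin B) && free w v).
    pose K s' c c' := [/\ frame fs s s', s' 31 0 = i, s' 32 0 = j,
       forall v : 'I_n, s' 9 v = (v \in B) & s' 33 0 = c /\ s' 34 0 = c'].
    apply: (r_then (update s4 33 0 0)).
      by apply: (r_setv (v := 0)) => //; apply: eval_const.
    apply: (r_seq (Q' := fun s' => K s' 0 0)).
      apply: (r_setv (v := 0)); first exact: eval_const.
      by split=> //; do 2 (apply: frame_upd => //).
    move=> s5 K5.
    apply: (r_seq (Q' := fun s' => K s' (c1 n) (c2 n))).
      apply: (r_for W_gt (N := n) (I := fun j' s' => K s' (c1 j') (c2 j'))) => //.
      * exact: lim_n.
      * case: K5 => H1 H2 H3 H4 [H5 H6]; split=> //; first by apply: frame_upd.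
        by rewrite /c1 /c2 !big_pred0.
      * by move=> j' s' _ [fr _ _ _ _] _; apply: eval_n => //; apply: fn.
      * move=> j' s6 ltj' [fr6 s6i s6j s6B [s6c s6c']] s6j'; pose w := Ordinal ltj'.
        have b1 : c1 j'.+1 < W by apply: leq_ltn_trans (sum_lt_bound _ _) nW.
        have b2 : c2 j'.+1 < W by apply: leq_ltn_trans (sum_lt_bound _ _) nW.
        have ew s' : s' 20 0 = j' -> (forall v : 'I_n, s' 9 v = (v \in B)) ->
            eval W s' (notE (Get 9 (var 20))) = (w \notin B).
          move=> s'j' s'B; rewrite (eval_not W_gt (eval_get_v _ s'j')) -[j']/(nat_of_ord w) s'B.
          by case: (w \in B).
        apply: (r_then (update s6 33 0 (c1 j'.+1))).
          apply: (r_setv (v := c1 j'.+1)) => //.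
          rewrite /c1 sum_ltS in b1 *; apply: eval_add => //; first by rewrite eval_var s6c.
          apply: eval_and => //; first exact: ew.
          exact: efree.
        apply: (r_setv (v := c2 j'.+1)).
          rewrite /c2 sum_ltS in b2 *; apply: eval_add => //; first by rewrite eval_var updE // s6c'.
          apply: eval_and => //; first exact: ew.
          by apply: efree => //; apply: frame_upd.
        split=> //; split=> //; by do 3 (apply: frame_upd => //).
    move=> s6 [fr6 s6i s6j s6B [s6c s6c']].
    have E1 : c1 n = cnt (ind free) [set v] (~: B).
      rewrite cnt1 /c1 big_mkcond [RHS]big_mkcond; apply: eq_bigr => w _.
      by rewrite ltn_ord inE /ind; case: (w \in B).
    have E2 : c2 n = cnt (ind free) (~: B) [set v].
      rewrite -cntT cnt1 /c2 big_mkcond [RHS]big_mkcond; apply: eq_bigr => w _.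
      by rewrite ltn_ord inE /ind; case: (w \in B).
    have smallW m : m <= n -> 10 * m < W by move: W_gt n_W; clear; nia.
    have ltE x c : s6 x 0 = c -> c <= n ->
       eval W s6 (Bin Lt (Bin Mul (Const 10) (var x)) (Bin Mul (Const 9) dE)) = (10 * c < 9 * d).
      move=> s6x cn; apply: eval_lt => //.
        by apply: eval_mul; rewrite ?eval_const ?eval_var ?s6x ?smallW.
      apply: eval_mul; rewrite ?eval_const ?(eval_get _ (eval_const _ _ _)) ?fr6 //.
      by apply: leq_ltn_trans (smallW _ (ltnW dn)); rewrite leq_mul2r orbT.
    have eC := eval_or W_gt (ltE 33 _ s6c (sum_lt_bound _ _)) (ltE 34 _ s6c' (sum_lt_bound _ _)).
    have frj s' : frame fs s s' -> frame fs s (update s' 32 0 j.+1) by move=> H; apply: frame_upd.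
    apply: r_if; rewrite eC; last first.
      move=> /eqP; rewrite eqb0 negb_or => /andP[h1 h2]; apply: r_skip; split=> //; split=> //; first exact: frj.
      exists B; split=> // eB w; rewrite ltnS leq_eqVlt => /orP[/eqP wj|wj]; last exact: eqB.
      have -> : w = v by apply: val_inj.
      by move=> _ []; rewrite -?E1 -?E2; [rewrite (negPf h1)|rewrite (negPf h2)].
    rewrite eqb0 negbK => bad.
    have ex : exposed free d B v by rewrite /exposed -E1 -E2; apply/orP.
    apply: (r_set (i := v) (v := 1)); [by rewrite eval_var|exact: eval_const|].
    split=> //; split=> //; first by apply: frj; apply: frame_upd.
    have BvB : B != v |: B.
      by apply: contra vB => /eqP ->; rewrite !inE eqxx.
    exists (v |: B); split.
    * exact: Istep.
    * by move=> w; rewrite updE // updD !inE s6B -val_eqE; case: eqP.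
    * by apply: subset_trans B0B (subsetU1 _ _).
    * move=> cl0; have eB := clB cl0; exfalso.
      by move: vB ex; rewrite eB => vB; apply: cl0.
    * move=> eB; have : B \proper B0 by rewrite -eB properEneq BvB subsetU1.
      by rewrite properE B0B andbF.
  + move=> s4 [fr4 s4i [B [IB s4B B0B clB eqB]]] _; split=> //; split; first by apply: frame_upd.
    exists B; split=> //.
    case: (eqVneq B B0) => [eB|ne].
      left=> w wB; have lw : w < n := ltn_ord w.
      exact: eqB eB w lw wB.
    right; case: alt => [/clB eB|le]; first by rewrite eB eqxx in ne.
    by apply: leq_ltn_trans le (proper_card _); rewrite properEneq eq_sym ne.
- move=> s3 [fr3 [B [IB s3B alt]]] _; split=> //; exists B; split=> //.
  case: alt => // le; suff -> : B = setT by move=> v; rewrite inE.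
  by apply/eqP; rewrite eqEcard subsetT cardsT card_ord.
Qed.

End Procedures.

(** * Answering a request *)

Definition aE := Get 2 (Const 1).
Definition bE := Get 2 (Const 2).
Definition undE := notE (Get 0 (Const 0)).
Definition TLE := Bin Add (Bin Mul nE nE) (Const 1).
Definition Mark x y :=
  Fill 4 (Bin Add (entry 4 (var 20) (var 21))
     (Bin Mul TLE (orE (entry 17 (var x) (var y)) (andE undE (entry 17 (var y) (var x)))))).
Definition bump X i e := Set_ X i (Bin Add (Get X i) e).
Definition lower X i e := Set_ X i (Bin Sub (Get X i) e).
(** The counters [x] and [y] are 20 and 21 for forward arcs and exchanged for reversed ones, so the
    same code serves both ends. *)
Definition Route SE x y e :=
  Seq (Fill 16 (freeE (var x) (var y)))
  (Seq (Flow SE)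
  (Seq (Fill 11 (entry 10 (var 20) (var 21)))
  (Seq (setv 24 e)
  (Seq Search (Mark x y))))).

Definition Middle :=
  Seq (Fill 11 (andE (freeE (var 20) (var 21))
    (andE (notE (Get 9 (var 20))) (notE (Get 9 (var 21))))))
  (Seq (FillV 12 (Bin Eq (var 20) (var 36)))
  (Seq (setv 24 (var 35))
  (Seq Search (Mark 20 21)))).
Definition Output :=
  Seq (Set_ 3 (Const 0) (var 27))
  (For 20 nE (If (Bin Lt (var 20) (var 27))
    (Set_ 3 (Bin Add (var 20) (Const 1))
      (Get 15 (Bin Sub (Bin Sub (var 27) (Const 1)) (var 20)))) Skip)).
Definition isTL := Bin Eq (entry 4 (var 20) (var 21)) TLE.
(** The label of a path is the code of its first arc, which is known only when the answer has been
    written. Until then the reserved arcs carry [n * n + 1], which is the label of no path. *)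
Definition Relabel :=
  Seq (setv 37 (Bin Add (cell (Get 3 (Const 1)) (Get 3 (Const 2))) (Const 1)))
  (Seq (Fill 4 (Bin Sub (Bin Add (entry 4 (var 20) (var 21)) (Bin Mul isTL (var 37)))
                        (Bin Mul isTL TLE)))
       (Set_ 8 (var 37) (var 35))).
Definition Final :=
  Seq (Fill 11 isTL)
  (Seq (FillV 12 (Bin Eq (var 20) bE))
  (Seq (setv 24 aE)
  (Seq Search (Seq Output Relabel)))).
(** The counters at [a] are updated before the second [Route], whose demand is [dem_in]; the token
    is entered after it. *)
Definition Find :=
  If (Bin Eq aE bE) (Seq (Set_ 3 (Const 0) (Const 1)) (Set_ 3 (Const 1) aE))
  (Seq Peel
  (Seq (Route 5 20 21 aE)
  (Seq (setv 35 (var 30))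
  (Seq (bump 5 aE (Const 1))
  (Seq (bump 6 aE undE)
  (Seq (Route 6 21 20 bE)
  (Seq (setv 36 (var 30))
  (Seq (bump 6 bE (Const 1))
  (Seq (bump 5 bE undE)
  (Seq (bump 7 (var 35) (Bin Add (Const 1) undE))
  (Seq Middle Final))))))))))).

(** * Correctness of the stages of an answer *)

Section Router.

Variables (W : nat) (n d : nat) (G : graph n).
Hypothesis W_gt : 1000 < W.
Hypothesis n_W : 1000 * n * n < W.
Hypothesis d_n : d < n.

(** The loop with counter 40 runs over the units of flow demanded at a vertex. *)
Definition lim x := if x == 40 then 3 * d else n.

Lemma lim_n x : x != 40 -> n <= lim x.
Proof. by rewrite /lim => /negPf->. Qed.

Local Notation runs := (runs W lim).
Local Notation V := (vertices n).
Local Notation dir := (directed G).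
Local Notation und := (nat_of_bool (~~ dir)).
Local Notation TL := (n * n).+1.

Definition stable (s : store) :=
  [/\ s 0 0 = dir, s 0 1 = n, s 0 2 = d & forall u v : 'I_n, s 1 (u * n + v) = adj G u v].

Lemma stable_frame xs s s' : frame xs s s' -> 0 \notin xs -> 1 \notin xs -> stable s -> stable s'.
Proof. by move=> fr h0 h1 [s00 s01 s02 s1]; split=> [|||u v]; rewrite fr. Qed.

Lemma TL_W : 10 * TL < W.
Proof. by move: n_W W_gt; rewrite -mulnA; move: (n * n); clear; lia. Qed.

Lemma eval_TL s : s 0 1 = n -> eval W s TLE = TL.
Proof.
move=> sn; have lt : TL < W by apply: leq_ltn_trans TL_W; apply: leq_pmull.
apply: (eval_succ W_gt) lt; apply: eval_mul (eval_n W_gt sn) (eval_n W_gt sn) _.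
by move: TL_W; clear; lia.
Qed.

Lemma eval_und (s : store) : s 0 0 = dir -> eval W s undE = ~~ dir.
Proof. by move=> h; rewrite (eval_not W_gt (eval_get _ (eval_const W_gt _ _))) // h; case: dir. Qed.

Definition oriented (flip : bool) (r : rel V) : rel V := fun u v => if flip then r v u else r u v.

Lemma r_mark s (flip : bool) (own : V -> V -> nat) src p :
  stable s -> uniq (src :: p) -> (forall u v : 'I_n, s 4 (u * n + v) = own u v) ->
  (forall u v, own u v <= TL) ->
  (forall u v : 'I_n, s 17 (u * n + v) = @arcw V src p u v) ->
  runs (Mark (20 + flip) (21 - flip)) s (fun s' => frame [:: 4; 20; 21] s s' /\
    forall u v : 'I_n, s' 4 (u * n + v) = own u v + TL * oriented flip (@hits V dir src p) u v).
Proof.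
move=> [s00 s01 _ _] up s4 ownle s17; have lt := TL_W.
have s17' (u v : 'I_n) : s 17 (u * n + v) = (0 < @arcw V src p u v).
  by rewrite s17; have := @arcw_le1 V src p u v up; case: arcw => [|[|m]].
apply: (fill_mat W_gt n_W lim_n (s := s)) => //.
move=> u v s' fr s'u s'v s'4; have s'n : s' 0 1 = n by rewrite fr.
have e17 x y (u' v' : 'I_n) : s' x 0 = u' -> s' y 0 = v' ->
    eval W s' (entry 17 (var x) (var y)) = (0 < @arcw V src p u' v').
  by move=> s'x s'y; rewrite (eval_entry_v W_gt n_W _ s'n s'x s'y) fr // s17'.
have e : eval W s' (orE (entry 17 (var (20 + flip)) (var (21 - flip)))
    (andE undE (entry 17 (var (21 - flip)) (var (20 + flip))))) = oriented flip (@hits V dir src p) u v.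
  have eO x y (u' v' : 'I_n) : s' x 0 = u' -> s' y 0 = v' ->
      eval W s' (orE (entry 17 (var x) (var y)) (andE undE (entry 17 (var y) (var x)))) = @hits V dir src p u' v'.
    move=> s'x s'y; apply: (eval_or W_gt (e17 _ _ _ _ s'x s'y)).
    by apply: (eval_and W_gt _ (e17 _ _ _ _ s'y s'x)); apply: eval_und; rewrite fr.
  by case: flip; apply: eO.
apply: eval_add; first by rewrite (eval_entry_v W_gt n_W _ s'n s'u s'v) s'4 s4.
  apply: eval_mul; [exact: eval_TL|exact: e|].
  by case: oriented; move: lt; clear; lia.
by have := ownle u v; case: oriented; move: lt; clear; lia.
Qed.

Definition route_scratch := flow_scratch ++ [:: 4; 16].

(** Which flow the program finds is left open, so a short path is required in every flow that meets
    the demand. *)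
Lemma r_route s (flip : bool) (own : V -> V -> nat) (B : {set V}) (dem : V -> nat) SE e (src : 'I_n) L :
  stable s -> SE \notin route_scratch -> (forall u v : 'I_n, s 4 (u * n + v) = own u v) ->
  (forall u v, own u v <= TL) ->
  (forall v : 'I_n, s 9 v = (v \in B)) ->
  (forall v : 'I_n, d %/ 4 + s 7 v - s SE v = dem v) ->
  (forall v : 'I_n, d %/ 4 + s 7 v <= 3 * d) ->
  (forall s', (forall j, s' 2 j = s 2 j) -> eval W s' e = src) ->
  let base := oriented flip (unreserved (adj G) own) in
  @hall V base B dem ->
  (forall f, @preflow V base B f dem -> exists p, [/\ path f src p, last src p \notin B & size p <= L]) ->
  runs (Route SE (20 + flip) (21 - flip) e) s (fun s' => frame route_scratch s s' /\
    exists f p, [/\ @preflow V base B f dem, path f src p, uniq (src :: p),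
      last src p \notin B /\ size p <= L & s' 30 0 = nat_of_ord (last src p) /\
    forall u v : 'I_n, s' 4 (u * n + v) = own u v + TL * oriented flip (@hits V dir src p) u v]).
Proof.
move=> st SEn s4 ownle s9 sdem dem3 esrc base hl short.
have [s00 s01 s02 s1] := st; have nW := n_lt_W W_gt n_W.
apply: (r_seq (Q' := fun s' => frame [:: 16; 20; 21] s s' /\ forall u v : 'I_n, s' 16 (u * n + v) = base u v)).
  apply: (fill_mat W_gt n_W lim_n (s := s)) => // u v s' fr s'u s'v _.
  have s'n : s' 0 1 = n by rewrite fr.
  have ef x y (u' v' : 'I_n) : s' x 0 = u' -> s' y 0 = v' ->
      eval W s' (freeE (var x) (var y)) = unreserved (adj G) own u' v'.
    move=> s'x s'y; apply: eval_and => //; first by rewrite (eval_entry_v W_gt n_W _ s'n s'x s'y) fr // s1.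
    by rewrite (eval_not W_gt (eval_entry_v W_gt n_W _ s'n s'x s'y)) fr // s4.
  by rewrite /base /oriented; case: (flip); apply: ef.
move=> s2 [fr2 s2b].
have st2 : stable s2 by apply: stable_frame fr2 _ _ st.
apply: (r_seq (r_flow (s := s2) (base := base) (B := B) (dem := dem) W_gt n_W lim_n _ _ s2b _ _ _ _ _ hl)).
- by apply: contra SEn; move=> h; rewrite mem_cat h.
- by rewrite fr2.
- by move=> v; rewrite fr2.
- by move=> v; rewrite !fr2 // ?s02 //; apply: contra SEn; rewrite !inE => /or3P[] /eqP->.
- by move=> v; rewrite !fr2 // s02 /lim eqxx.
- by rewrite /lim eqxx; move: n_W W_gt d_n; clear; nia.
- by rewrite fr2 // s02; apply: ltn_trans d_n nW.
move=> s3 [fr3 s3T [f pf s3f]].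
have fr3' : frame route_scratch s s3.
  by apply: frame_trans (frame_sub fr2 _) (frame_sub fr3 _); apply/allP.
apply: (r_seq (Q' := fun s' => frame [:: 11; 20; 21] s3 s' /\ forall u v : 'I_n, s' 11 (u * n + v) = f u v)).
  have s3n : s3 0 1 = n by rewrite fr3'.
  apply: (fill_mat W_gt n_W lim_n (s := s3)) => // u v s' fr s'u s'v _.
  have s'n : s' 0 1 = n by rewrite fr.
  by rewrite (eval_entry_v W_gt n_W _ s'n s'u s'v) fr.
move=> s4' [fr4 s4R].
apply: (r_seq (Q' := fun s' => [/\ frame [:: 11; 20; 21; 24] s3 s', s' 24 0 = src &
   forall u v : 'I_n, s' 11 (u * n + v) = f u v])).
  apply: (r_setv (v := src)); first by apply: esrc => j; rewrite fr4 // fr3'.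
  split=> //; apply: frame_upd => //; apply: (frame_sub fr4); exact/allP.
move=> {s4' fr4 s4R} s5 [fr5 s5s s5R].
have [p0 [pth0 lB0 le0]] := short _ pf.
have s5n : s5 0 1 = n by rewrite fr5 // fr3'.
have s5T v : s5 12 (nat_of_ord v) = [pred v | v \notin B] v by rewrite fr5 // s3T.
apply: (r_seq (r_search W_gt n_W lim_n (T := [pred v | v \notin B]) s5n s5s s5R s5T _)).
  by exists p0.
move=> s6 [fr6 [p [pth up lB min [s6e s6A _ _]]]].
have fr6' : frame route_scratch s s6.
  apply: frame_trans fr3' _; apply: frame_trans (frame_sub fr5 _) (frame_sub fr6 _); exact/allP.
apply: (r_conseq (r_mark (s := s6) flip (own := own) (src := src) (p := p) _ up _ ownle s6A)).
- by apply: stable_frame fr6' _ _ st.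
- move=> u v; rewrite fr6 // fr5 // fr3 // fr2 //.
move=> s7 [fr7 s74]; split.
  by apply: frame_trans fr6' (frame_sub fr7 _); exact/allP.
exists f, p; split=> //.
- by split=> //; apply: leq_trans (min _ pth0 lB0) le0.
- by rewrite fr7.
Qed.

Lemma r_bump s X i e iv v (Q : store -> Prop) :
  eval W s i = iv -> eval W s e = v -> s X iv + v < W ->
  Q (update s X iv (s X iv + v)) -> runs (bump X i e) s Q.
Proof.
move=> Hi He lt HQ; apply: (r_set Hi _ HQ).
by apply: eval_add He lt; apply: eval_get.
Qed.

Lemma r_middle s (own : V -> V -> nat) (B : {set V}) (za zb : 'I_n) p0 :
  let r : rel V := fun u v => [&& unreserved (adj G) own u v, u \notin B & v \notin B] in
  stable s -> (forall u v : 'I_n, s 4 (u * n + v) = own u v) ->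
  (forall u v, own u v <= TL) ->
  (forall v : 'I_n, s 9 v = (v \in B)) ->
  s 35 0 = za -> s 36 0 = zb -> path r za p0 -> last za p0 = zb ->
  runs Middle s (fun s' => frame (scratch ++ [:: 4; 11; 12; 24]) s s' /\
    exists p, [/\ path r za p, last za p = zb, uniq (za :: p), size p <= size p0 &
    forall u v : 'I_n, s' 4 (u * n + v) = own u v + TL * @hits V dir za p u v]).
Proof.
move=> r st s4 ownle s9 s35 s36 pth0 last0; set fs := _ ++ _.
have [s00 s01 s02 s1] := st; have nW := n_lt_W W_gt n_W.
apply: (r_seq (Q' := fun s' => frame [:: 11; 20; 21] s s' /\ forall u v : 'I_n, s' 11 (u * n + v) = r u v)).
  apply: (fill_mat W_gt n_W lim_n (s := s)) => // u v s' fr s'u s'v _.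
  have s'n : s' 0 1 = n by rewrite fr.
  have e9 x (w : 'I_n) : s' x 0 = w -> eval W s' (notE (Get 9 (var x))) = (w \notin B).
    by move=> s'x; rewrite (eval_not W_gt (eval_get_v _ _ s'x)) fr // s9; case: (w \in B).
  apply: (eval_and W_gt); last by apply: (eval_and W_gt); exact: e9.
  apply: (eval_and W_gt); first by rewrite (eval_entry_v W_gt n_W _ s'n s'u s'v) fr // s1.
  by rewrite (eval_not W_gt (eval_entry_v W_gt n_W _ s'n s'u s'v)) fr // s4.
move=> s2 [fr2 s2R].
apply: (r_seq (Q' := fun s' => frame [:: 12; 20] s2 s' /\ forall v : 'I_n, s' 12 v = (v == zb))).
  apply: (fill_vec W_gt n_W lim_n (s := s2)) => //; first by rewrite fr2.
  move=> v s' fr s'v; rewrite -val_eqE; apply: (eval_eq W_gt); rewrite eval_var //.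
  by rewrite fr // fr2.
move=> s3 [fr3 s3T].
apply: (r_then (update s3 24 0 za)).
  by apply: (r_setv (v := za)) => //; rewrite eval_var fr3 // fr2.
have fr3' : frame fs s (update s3 24 0 za).
  apply: frame_upd => //.
  by apply: frame_trans (frame_sub fr2 _) (frame_sub fr3 _); apply/allP.
apply: (r_seq (r_search (s := update s3 24 0 za) (R := r) (src := za) (T := pred1 zb) W_gt n_W lim_n _ _ _ _ _)).
- by rewrite fr3'.
- by [].
- by move=> u v; rewrite updE // fr3 // s2R.
- by move=> v; rewrite updE // s3T.
- by exists p0; split=> //; apply/eqP.
move=> s6 [fr6 [p [pth up lB min [s6e s6A _ _]]]].
have fr6' : frame fs s s6 by apply: frame_trans fr3' (frame_sub fr6 _); exact/allP.
apply: (r_conseq (r_mark (s := s6) false (own := own) (src := za) (p := p) _ up _ ownle s6A)).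
- by apply: stable_frame fr6' _ _ st.
- by move=> u v; rewrite fr6 // updE // fr3 // fr2.
move=> s7 [fr7 s74]; split.
  by apply: frame_trans fr6' (frame_sub fr7 _); exact/allP.
exists p; split=> //; first by apply/eqP.
by apply: min pth0 _; apply/eqP.
Qed.

(** Shifted by 1, because 0 marks free arcs. *)
Definition code (u v : V) := (u * n + v).+1.

Lemma r_output s (src : 'I_n) p :
  s 0 1 = n -> uniq (src :: p) -> found src s p ->
  runs Output s (fun s' => frame [:: 3; 20] s s' /\
    s' 3 0 = (size p).+1 /\ forall i, i <= size p -> s' 3 i.+1 = nth src (src :: p) i).
Proof.
move=> sn up [_ _ s27 s15]; have nW := n_lt_W W_gt n_W; set fs := [:: 3; 20].
have pn : size p < n by have := size_queue up.
apply: (r_then (update s 3 0 (size p).+1)).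
  by apply: (r_set (i := 0) (v := (size p).+1)) => //; [apply: eval_const | rewrite eval_var].
apply: (r_for W_gt (N := n) (I := fun i s' => [/\ frame fs s s', s' 3 0 = (size p).+1 &
   forall j, j < i -> j <= size p -> s' 3 j.+1 = nth src (src :: p) j])) => //.
- by split=> //; do 2 (apply: frame_upd => //).
- by move=> i s' _ [fr _ _] _; apply: eval_n => //; rewrite fr.
- move=> i s' lti [fr s'0 s'3] s'i.
  have eC : eval W s' (Bin Lt (var 20) (var 27)) = (i <= size p).
    by rewrite (eval_lt W_gt (eval_var _ _ _) (eval_var _ _ _)) s'i fr // s27.
  apply: r_if; rewrite eC; last first.
    move=> /eqP; rewrite eqb0 => le; apply: r_skip; split=> //; split=> //; first by apply: frame_upd.
    move=> j; rewrite updE // ltnS leq_eqVlt => /orP[/eqP->|ji]; last exact: s'3.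
    by rewrite (negPf le).
  rewrite eqb0 negbK => le.
  apply: (r_set (i := i.+1) (v := nth src (src :: p) i)).
    rewrite (eval_succ W_gt (eval_var _ _ _)) s'i //; apply: leq_ltn_trans _ nW; exact: lti.
    have lt : (size p).+1 < W by apply: leq_ltn_trans pn nW.
    have e : eval W s' (Bin Sub (Bin Sub (var 27) (Const 1)) (var 20)) = size p - i.
      apply: eval_sub; [|by rewrite eval_var|by apply: ltn_trans lt].
      have -> : size p = (size p).+1 - 1 by rewrite subn1.
      by apply: eval_sub; [rewrite eval_var fr // | exact: eval_const|].
    rewrite (eval_get _ e) fr // s15 ?leq_subr // nth_rev /= ?ltnS ?leq_subr //.
    by rewrite subSS subKn.
  split; first by rewrite updE.
  split=> //; first by do 2 (apply: frame_upd => //).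
  move=> j; rewrite updE // updD eqSS ltnS leq_eqVlt.
  by case: eqP => [->|_ /= ji]; last exact: s'3.
- by move=> s' [fr s'0 s'3] _; split=> //; split=> // i ip; apply: s'3 => //; apply: leq_ltn_trans pn.
Qed.

(** [hit] contains a walk from [a] to [b], so the search in it returns a simple path. The reserved
    arcs are recognised by the label [n * n + 1], which exceeds all others. *)
Lemma r_final s (own own3 : V -> V -> nat) (hit : rel V) (a b za : 'I_n) :
  a != b -> stable s -> s 2 1 = a -> s 2 2 = b -> s 35 0 = za ->
  (forall u v : 'I_n, s 4 (u * n + v) = own3 u v) ->
  (forall u v, own3 u v = if hit u v then TL else own u v) -> (forall u v, own u v < TL) ->
  (exists q, path hit a q /\ last a q = b) ->
  runs Final s (fun s' => frame (scratch ++ [:: 3; 4; 8; 11; 12; 24; 37]) s s' /\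
    exists q, [/\ path hit a q, last a q = b, uniq (a :: q), answer s' = map val (a :: q) &
      (forall u v : 'I_n, s' 4 (u * n + v) = if hit u v then lab code (a :: q) else own u v) /\
      forall l, s' 8 l = if l == lab code (a :: q) then nat_of_ord za else s 8 l]).
Proof.
move=> ab st s21 s22 s35 s4 own3E ownlt [q0 [pth0 last0]]; set fs := _ ++ _.
have [s00 s01 s02 s1] := st; have nW := n_lt_W W_gt n_W.
have TLlt : TL < W by apply: leq_ltn_trans TL_W; apply: leq_pmull.
have is_hit u v : (own3 u v == TL) = hit u v.
  by rewrite own3E; case: ifP => _; rewrite ?eqxx //; apply/negbTE; rewrite neq_ltn ownlt.
apply: (r_seq (Q' := fun s' => frame [:: 11; 20; 21] s s' /\ forall u v : 'I_n, s' 11 (u * n + v) = hit u v)).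
  apply: (fill_mat W_gt n_W lim_n (s := s)) => // u v s' fr s'u s'v _.
  have s'n : s' 0 1 = n by rewrite fr.
  rewrite -is_hit; apply: (eval_eq W_gt); last exact: eval_TL.
  by rewrite (eval_entry_v W_gt n_W _ s'n s'u s'v) fr // s4.
move=> s2 [fr2 s2R].
apply: (r_seq (Q' := fun s' => frame [:: 12; 20] s2 s' /\ forall v : 'I_n, s' 12 v = (v == b))).
  apply: (fill_vec W_gt n_W lim_n (s := s2)) => //; first by rewrite fr2.
  move=> v s' fr s'v; rewrite -val_eqE; apply: (eval_eq W_gt); first by rewrite eval_var.
  by rewrite (eval_get _ (eval_const W_gt _ _)) // fr // fr2.
move=> s3 [fr3 s3T].
apply: (r_then (update s3 24 0 a)).
  by apply: (r_setv (v := a)) => //; rewrite (eval_get _ (eval_const W_gt _ _)) // fr3 // fr2.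
have fr3' : frame fs s (update s3 24 0 a).
  apply: frame_upd => //.
  by apply: frame_trans (frame_sub fr2 _) (frame_sub fr3 _); apply/allP.
apply: (r_seq (r_search (s := update s3 24 0 a) (R := hit) (src := a) (T := pred1 b) W_gt n_W lim_n _ _ _ _ _)).
- by rewrite fr3'.
- by [].
- by move=> u v; rewrite updE // fr3 // s2R.
- by move=> v; rewrite updE // s3T.
- by exists q0; split=> //; apply/eqP.
move=> s6 [fr6 [p [pth up /eqP lB _ fnd]]].
have fr6' : frame fs s s6 by apply: frame_trans fr3' (frame_sub fr6 _); exact/allP.
have s6n : s6 0 1 = n by rewrite fr6'.
apply: (r_seq (r_output s6n up fnd)).
move=> s7 [fr7 [s70 s7a]].
have fr7' : frame fs s s7 by apply: frame_trans fr6' (frame_sub fr7 _); exact/allP.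
have s7n : s7 0 1 = n by rewrite fr7'.
(* As [a != b], the path has a first arc, from which the label is computed. *)
case: p pth up lB fnd s70 s7a => [|y p] pth up lB fnd s70 s7a; first by move: ab; rewrite -lB eqxx.
set id := lab code (a :: y :: p).
have idle : id <= n * n by apply: cell_lt.
have eid : eval W s7 (Bin Add (cell (Get 3 (Const 1)) (Get 3 (Const 2))) (Const 1)) = id.
  rewrite (eval_succ W_gt (a := a * n + y)) //; last by apply: leq_ltn_trans TLlt; apply: ltnW.
  apply: (eval_cell W_gt n_W) => //; rewrite (eval_get _ (eval_const W_gt _ _)) //.
    by rewrite (s7a 0).
  by rewrite (s7a 1).
apply: (r_then (update s7 37 0 id)); first by apply: (r_setv (v := id)).
set s8 := update s7 37 0 id.
have fr8 : frame fs s s8 by apply: frame_upd.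
apply: (r_seq (Q' := fun s' => frame [:: 4; 20; 21] s8 s' /\ forall u v : 'I_n,
    s' 4 (u * n + v) = if hit u v then id else own u v)).
  apply: (fill_mat W_gt n_W lim_n (s := s8)); rewrite ?fr8 //.
  move=> u v s' fr s'u s'v s'4; have s'n : s' 0 1 = n by rewrite fr // fr8.
  have e4 : eval W s' (entry 4 (var 20) (var 21)) = own3 u v.
    by rewrite (eval_entry_v W_gt n_W _ s'n s'u s'v) s'4 /s8 updE // fr7 // fr6 // updE // fr3 // fr2 // s4.
  have eh : eval W s' isTL = hit u v by rewrite -is_hit; apply: (eval_eq W_gt e4); exact: eval_TL.
  have := TL_W; have := ownlt u v => lt1 lt2.
  have b1 : own3 u v + hit u v * id < W.
    rewrite own3E; case: ifP => _; rewrite ?mul1n ?mul0n; move: idle lt1 lt2; clear; lia.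
  have -> : (if hit u v then id else own u v) = own3 u v + hit u v * id - hit u v * TL.
    by rewrite own3E; case: ifP => _; rewrite ?mul1n ?mul0n ?addn0 ?subn0 // addKn.
  apply: (eval_sub _ _ b1).
    apply: (eval_add e4 _ b1); apply: eval_mul; [exact: eh|by rewrite eval_var fr|].
    by apply: leq_ltn_trans b1; apply: leq_addl.
  apply: eval_mul; [exact: eh|exact: eval_TL|].
  by case: (hit u v); rewrite ?mul1n // mul0n; move: W_gt; clear; lia.
move=> s9 [fr9 s94].
apply: (r_set (i := id) (v := za)); try by rewrite eval_var fr9 // fr8.
split.
  apply: frame_upd => //; apply: frame_trans fr8 (frame_sub fr9 _); exact/allP.
exists (y :: p); split=> //.
- rewrite /answer updE // fr9 // /s8 updE // s70.
  apply: (@eq_from_nth _ 0); first by rewrite size_map size_iota /= size_map.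
  move=> i; rewrite size_map size_iota => lt.
  rewrite (nth_map 0) ?size_iota // nth_iota // add0n updE // fr9 // /s8 updE // s7a //.
  by rewrite (nth_map a).
- split=> [u v|l]; first by rewrite updE.
  rewrite updD; case: eqP => // _.
  by rewrite fr9 // /s8 updE // fr7 // fr6 // updE // fr3 // fr2.
Qed.

End Router.
Arguments r_bump {W n d s X i e iv v Q}.

(** * Independence of the order of the family *)

Section Perm.

Variables (V : finType) (adj : rel V) (dir : bool) (code : V -> V -> nat) (d Q : nat).
Variables (P P' : seq (seq V)) (own : V -> V -> nat) (z : nat -> V).
Hypothesis PP' : perm_eq (nontrivial P) (nontrivial P').

Lemma nstarts_perm x : nstarts dir P x = nstarts dir P' x.
Proof. exact: perm_big. Qed.

Lemma nends_perm x : nends dir P x = nends dir P' x.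
Proof. exact: perm_big. Qed.

Lemma ntokens_perm x : ntokens dir code P z x = ntokens dir code P' z x.
Proof. exact: perm_big. Qed.

Lemma booked_perm : booked adj dir code P own z -> booked adj dir code P' own z.
Proof.
have labs := perm_map (lab code) PP'.
move=> [H1 H2 H3]; split.
- by move=> u v /H1[? ?]; rewrite -(perm_mem labs).
- by rewrite -(perm_uniq labs).
- by move=> p; rewrite -(perm_mem PP') => /H3.
Qed.

Lemma escapable_perm : escapable adj dir code d Q P own z -> escapable adj dir code d Q P' own z.
Proof.
move=> esc X /esc.
by rewrite (eq_bigr _ (fun x _ => nstarts_perm x)) (eq_bigr _ (fun x _ => ntokens_perm x)).
Qed.

End Perm.

Lemma preflow_eq (V : finType) (free free' : rel V) B f dem dem' :
  free =2 free' -> dem =1 dem' -> preflow free B f dem -> preflow free' B f dem'.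
Proof. by move=> E E' [H1 H2 H3 H4]; split=> // [u v /H1|x xB]; rewrite -?E // -E' H4. Qed.

Lemma hall_eq (V : finType) (free free' : rel V) B dem :
  free =2 free' -> hall free B dem -> hall free' B dem.
Proof.
move=> E H Y /H; congr (_ <= _); apply: eq_cnt => u v _ _; by rewrite /ind E.
Qed.

(** In array 2 the vertices start at cell 2, after the kind of request and the size, so the last one
    is in the cell with index size plus 1. A path of length 0 reserves nothing, hence [Skip]. *)
Definition Remove :=
  If (Bin Lt (Const 1) (Get 2 (Const 1)))
  (Seq (setv 37 (Bin Add (cell (Get 2 (Const 2)) (Get 2 (Const 3))) (Const 1)))
  (Seq (setv 38 (Get 2 (Bin Add (Get 2 (Const 1)) (Const 1))))
  (Seq (setv 35 (Get 8 (var 37)))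
  (Seq (Fill 4 (Bin Mul (entry 4 (var 20) (var 21))
                        (notE (Bin Eq (entry 4 (var 20) (var 21)) (var 37)))))
  (Seq (lower 5 (Get 2 (Const 2)) (Const 1))
  (Seq (lower 6 (var 38) (Const 1))
  (Seq (lower 5 (var 38) undE)
  (Seq (lower 6 (Get 2 (Const 2)) undE)
       (lower 7 (var 35) (Bin Add (Const 1) undE))))))))))
  Skip.

Definition Router := If (Get 2 (Const 0)) Remove Find.

(** * The state kept between turns, and Find-Path requests *)

Section Invariant.

Variables (W : nat) (n d Q : nat) (G : graph n).
Hypothesis W_gt : 1000 < W.
Hypothesis n_W : 1000 * n * n < W.
Hypothesis d_n : d < n.
Local Notation V := (vertices n).
Local Notation dir := (directed G).
Local Notation und := (nat_of_bool (~~ dir)).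
Local Notation TL := (n * n).+1.
Local Notation runs := (runs W (lim n d)).
Local Notation code := (@code n).

Hypothesis regular_out : forall x : V, cnt (ind (adj G)) [set x] setT = d.
Hypothesis regular_in : forall x : V, cnt (ind (adj G)) setT [set x] = d.
Hypothesis d_gt : 200 < d.
Hypothesis small_sparse : forall X : {set V},
  Q * #|X| <= 2 * #|V| -> 500 * cnt (ind (adj G)) X X <= d * #|X|.
Hypothesis half_sparse : forall X : {set V},
  2 * #|X| <= #|V| -> 3 * cnt (ind (adj G)) X X <= 2 * d * #|X|.
Hypothesis Qn : Q <= #|V|.

Let adj_und := @adj_sym n G.

Lemma code_neq0 (u v : V) : code u v != 0. Proof. by []. Qed.
Lemma code_inj (u v u' v' : V) : code u v = code u' v' -> u = u' /\ v = v'.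
Proof. by move=> [/cell_inj]. Qed.

(** Only arrays 0, 1 and 4 to 8 carry information from one turn to the next. *)
Definition keeps s P own z :=
  [/\ stable d G s, forall u v : 'I_n, s 4 (u * n + v) = own u v,
     [/\ forall x : 'I_n, s 5 x = nstarts dir P x, forall x : 'I_n, s 6 x = nends dir P x &
         forall x : 'I_n, s 7 x = @ntokens V dir code P z x]
   & forall p, p \in nontrivial P -> s 8 (lab code p) = nat_of_ord (z (lab code p))].

Definition Inv s (P : family_of_paths n) := exists own (z : nat -> V),
  [/\ @booked V (adj G) dir code P own z, @escapable V (adj G) dir code d Q P own z,
      @few_ends V d P & keeps s P own z].

Lemma endpointE (x : V) p : ends_at x p = endpoint x p.
Proof. by case: p. Qed.

Lemma few_ends_add (P : family_of_paths n) p a b : is_path G a b p -> @few_ends V d P ->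
  200 * count (endpoint a) P < d -> 200 * count (endpoint b) P < d -> @few_ends V d (p :: P).
Proof.
case: p => // y q /and4P[/eqP-> _ /eqP lq _] few ca cb x; rewrite /=.
have E c : count (ends_at c) P = count (endpoint c) P by apply: eq_count => p; apply: endpointE.
have := few x; rewrite E.
rewrite /ends_at /= lq.
case: (eqVneq x a) => [->|_ /=]; first by move: ca; clear; lia.
case: (eqVneq x b) => [->|_ /=]; first by move: cb; clear; lia.
by [].
Qed.

Section Booked.

Variables (P : family_of_paths n) (own : V -> V -> nat) (z : nat -> V).
Hypothesis bk : @booked V (adj G) dir code P own z.

Lemma own_le u v : own u v <= n * n.
Proof.
have [->|/(b_own bk)[_ /mapP[p pN ->]]] := eqVneq (own u v) 0; first by [].
by case: p pN => [|x [|y q]] //= _; apply: cell_lt.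
Qed.

Lemma tokens_le x : @ntokens V dir code P z x <= 2 * d.
Proof.
apply: leq_trans (ntokens_le code_neq0 bk x) _.
have := adj_split bk [set x] setT; have := adj_split bk setT [set x].
rewrite regular_out regular_in; clear; lia.
Qed.

(** An earlier path lies in arcs with nonzero labels. A common edge of an undirected graph may be
    traversed in opposite directions; then the symmetry of the labels applies. *)
Lemma path_disjoint a q : path (unreserved (adj G) own) a q -> all (edge_disjoint G (a :: q)) P.
Proof.
move=> pth; apply/allP => p pP; apply/negP => /hasP[e]; rewrite /path_edges.
case: p pP => // x r pP; case: r pP => // x' r pP.
set r' := x' :: r => er eq.
have pN : (x :: r') \in nontrivial P by rewrite mem_filter pP.
have tk : path (fun u v => own u v != 0) x r'.
  have := r_path (b_res bk pN); apply: sub_path => u v /eqP ->.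
  exact: (lab_neq0 code_neq0 pN).
have mem (r0 : rel V) y s : path r0 y s -> e \in pairmap (edge G) y s ->
    exists u v, r0 u v /\ e = edge G u v.
  elim: s y => //= w s IH y /andP[H pth']; rewrite inE => /orP[/eqP->|]; first by exists y, w.
  exact: IH.
have [u [v [/andP[_ /eqP uv] e1]]] := mem _ _ _ pth eq.
have [u' [v' [uv' e2]]] := mem _ _ _ tk er.
move: e2; rewrite e1 /edge; case: (boolP dir) => [dG|ud]; first by case=> eu ev; rewrite -eu -ev uv in uv'.
case=> /setP E; have sym := own_sym bk u v ud.
have := E u'; have := E v'; have := E u; have := E v; rewrite !inE !eqxx !orbT /=.
move=> /esym Hv /esym Hu /orP[] /eqP ev /orP[] /eqP eu; move: uv' Hu Hv; rewrite ev eu.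
- by rewrite !orbb => H _ /eqP vu; rewrite -{2}vu uv in H.
- by rewrite -sym uv.
- by rewrite uv.
- by rewrite !orbb => H /eqP vu _; rewrite -{1}vu uv in H.
Qed.

End Booked.

(** A path of length 0 is not in [nontrivial], so of the invariant only [few_ends] is affected. *)
Lemma r_find_trivial s (P : family_of_paths n) (a : 'I_n) :
  Inv s P -> s 2 1 = a -> 200 * count (endpoint a) P < d ->
  runs (Seq (Set_ 3 (Const 0) (Const 1)) (Set_ 3 (Const 1) aE)) s
    (fun s' => exists p, [/\ is_path G a a p, all (edge_disjoint G p) P,
      answer s' = map val p & Inv s' (p :: P)]).
Proof.
move=> [own [z [bk esc few [st k4 [k5 k6 k7] k8]]]] s21 ca.
apply: (r_then (update s 3 0 1)).
  by apply: (r_set (i := 0) (v := 1)) => //; apply: eval_const.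
apply: (r_set (i := 1) (v := a)); first exact: eval_const.
  by rewrite (eval_get _ (eval_const W_gt _ _)).
have pa : is_path G a a [:: a] by rewrite /= !eqxx.
exists [:: a]; split=> //.
  by apply/allP => p _; apply/negP => /hasP[e].
have nE : perm_eq (nontrivial P) (nontrivial ([:: a] :: P)) by [].
exists own, z; split.
- exact: booked_perm nE bk.
- exact: escapable_perm nE esc.
- exact: (few_ends_add pa few ca ca).
- by split.
Qed.

(** Follows the insertion argument: [own1], [own2] and [own3] are the labels after each marking, and
    the arcs free under the first two are [free1] and [free2]. *)
Lemma r_find_path s (P : family_of_paths n) (a b : 'I_n) :
  Inv s P -> s 2 1 = a -> s 2 2 = b -> 200 * count (endpoint a) P < d ->
  200 * count (endpoint b) P < d -> 21 * Q * (size P * span V) <= n * d ->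
  runs Find s (fun s' => exists p, [/\ is_path G a b p, all (edge_disjoint G p) P,
      answer s' = map val p & Inv s' (p :: P)]).
Proof.
move=> iv s21 s22 ca cb light0.
have ea s' : (forall j, s' 2 j = s 2 j) -> eval W s' aE = a.
  by move=> H; rewrite (eval_get _ (eval_const W_gt _ _)) // H.
have eb s' : (forall j, s' 2 j = s 2 j) -> eval W s' bE = b.
  by move=> H; rewrite (eval_get _ (eval_const W_gt _ _)) // H.
have e_ab := eval_eq W_gt (ea s (fun _ => erefl)) (eb s (fun _ => erefl)).
apply: r_if; rewrite e_ab.
  by rewrite eqb0 negbK => /eqP/val_inj e; rewrite -e; apply: r_find_trivial.
move=> /eqP; rewrite eqb0 => ab; rewrite val_eqE in ab.
have [own [z [bk esc few [st k4 [k5 k6 k7] k8]]]] := iv.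
have [s00 s01 s02 s1] := st; have nW := n_lt_W W_gt n_W; have limn := @lim_n n d.
have dW : 10 * d < W by move: n_W W_gt d_n; clear; nia.
have ownle := own_le bk; have ownleTL u v : own u v <= TL by apply: leqW.
have TL0 : 0 < TL by [].
have light : 21 * Q * cnt (ind (taken own)) setT setT <= #|V| * d.
  rewrite card_ord; apply: leq_trans light0; rewrite leq_mul2l; apply/orP; right.
  exact: (cnt_taken_le code_neq0 bk).
apply: (r_seq (r_peel (s := s) (free := unreserved (adj G) own) (adj := adj G) (d := d)
   (Inv := @peeled V (adj G) d Q own) W_gt n_W limn _ _ _ _ _ _ _)) => //.
- by move=> u v; rewrite k4.
- exact: peeled0.
- by move=> B v; apply: (peel_step adj_und regular_out regular_in d_gt small_sparse Qn bk light).
move=> s2 [fr2 [B [pB s2B okB]]].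
have out_ok v : v \notin B -> 9 * d <= 10 * cnt (ind (unreserved (adj G) own)) [set v] (~: B).
  by move=> vB; rewrite leqNgt; apply/negP => H; apply: (okB v vB); left.
have in_ok v : v \notin B -> 9 * d <= 10 * cnt (ind (unreserved (adj G) own)) (~: B) [set v].
  by move=> vB; rewrite leqNgt; apply/negP => H; apply: (okB v vB); right.
have sparseB (X : {set V}) : X \subset B -> 500 * cnt (ind (adj G)) X X <= d * #|X|.
  move=> XB; apply: small_sparse; apply: leq_trans (_ : #|V| <= _); last by rewrite leq_pmull.
  have [_ QB] := pB; apply: leq_trans QB; rewrite leq_mul2l subset_leq_card ?orbT //.
have d0 : 0 < d by apply: ltn_trans d_gt.
have tok2 := tokens_le bk.
have dem3 (x : V) : d %/ 4 + @ntokens V dir code P z x <= 3 * d.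
  by have := tok2 x; clear; lia.
have st2 : stable d G s2 by apply: stable_frame fr2 _ _ st.
have hl1 := hall_out adj_und d_gt Qn bk esc few light pB.
have short1 f : @preflow V (unreserved (adj G) own) B f (@dem_out V dir code d P z) ->
    exists p, [/\ path f a p, last a p \notin B & size p <= radius V].
  move=> pf; apply: (flow_short a pf _ d0 _ sparseB); first by move=> u v /andP[].
  move=> x xB; exact: (dem_out_large adj_und d_gt Qn bk few light).
apply: (r_seq (r_route (s := s2) (flip := false) (own := own) (B := B)
    (dem := @dem_out V dir code d P z) (SE := 5) (e := aE) (src := a) (L := radius V)
    W_gt n_W d_n st2 _ _ ownleTL s2B _ _ _ hl1 short1)) => //.
- by move=> u v; rewrite fr2 // k4.
- by move=> v; rewrite !fr2 // k5 k7.
- by move=> v; rewrite !fr2 // k7; apply: dem3.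
- by move=> s' H; apply: ea => j; rewrite H fr2.
move=> s3 [fr3 [f1 [pa [pf1 pth_a up_a [za_out size_a] [s3e s34]]]]].
set za := last a pa in za_out s3e.
(* Marked arcs were free, so adding [n * n + 1] to the label 0 yields exactly the provisional
   label. *)
have hits1 u v : @hits V dir a pa u v -> own u v = 0.
  by move=> /(hits_a_free adj_und bk pf1 pth_a up_a)/andP[_ /eqP].
pose own1 u v := own u v + TL * oriented false (@hits V dir a pa) u v.
have un1 u v : unreserved (adj G) own1 u v = @free1 V (adj G) dir own a pa u v.
  rewrite /unreserved /own1 /oriented /free1 /unreserved.
  by case: hits; rewrite ?muln1 ?muln0 ?addn0 ?andbT // addnS !andbF.
have own1le u v : own1 u v <= TL.
  rewrite /own1 /oriented; case: (boolP (hits _ _ _ _ _)) => [/hits1->|_]; first by rewrite muln1.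
  by rewrite muln0 addn0.
have few_W c : count (endpoint c) P < d.
  have := few c; rewrite (eq_count (a2 := endpoint c)) => [|p]; last exact: endpointE.
  by move: d_gt; clear; lia.
have ks (x : V) : nstarts dir P x < d.
  apply: leq_ltn_trans (few_W x); apply: leq_trans (nstarts_le bk x) _.
  by rewrite (eq_count (a2 := endpoint x)) => [//|p]; exact: endpointE.
have ke (x : V) : nends dir P x < d.
  apply: leq_ltn_trans (few_W x); apply: leq_trans (nends_le bk x) _.
  by rewrite (eq_count (a2 := endpoint x)) => [//|p]; exact: endpointE.
have st3 : stable d G s3 by apply: stable_frame fr3 _ _ st2.
apply: (r_then (update s3 35 0 za)).
  by apply: (r_setv (v := za)) => //; rewrite eval_var.
apply: (r_then (update (update s3 35 0 za) 5 a (nstarts dir P a + 1))).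
  apply: (r_bump (iv := a) (v := 1)); first by apply: ea => j; rewrite updE // fr3 // fr2.
  - exact: eval_const.
  - by rewrite updE // fr3 // fr2 // k5; have := ks a; move: dW d_gt; clear; lia.
  - by rewrite updE // fr3 // fr2 // k5.
pose s4' := update (update (update s3 35 0 za) 5 a (nstarts dir P a + 1)) 6 a (nends dir P a + und).
apply: (r_then s4').
  apply: (r_bump (iv := a) (v := und)); first by apply: ea => j; rewrite !updE // fr3 // fr2.
  - by apply: (eval_und (G := G)) => //; rewrite !updE // fr3 // fr2.
  - by rewrite !updE // fr3 // fr2 // k6; have := ke a; move: dW d_gt; case: (~~ dir); clear; lia.
  - by rewrite /s4' !updE // fr3 // fr2 // k6.
have fr4 : frame [:: 5; 6; 35] s3 s4' by do 3 (apply: frame_upd => //).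
have st4 : stable d G s4' by apply: stable_frame fr4 _ _ st3.
have hl2 : @hall V (oriented true (unreserved (adj G) own1)) B (@dem_in V dir code d P z a).
  have := hall_in adj_und code_neq0 regular_out regular_in d_gt Qn bk few light pf1 pth_a up_a za_out.
  by apply: hall_eq => u v; rewrite /oriented un1.
have short2 f : @preflow V (oriented true (unreserved (adj G) own1)) B f (@dem_in V dir code d P z a) ->
    exists p, [/\ path f b p, last b p \notin B & size p <= radius V].
  move=> pf; apply: (@flow_short V _ B (fun u v => adj G v u) d f _ b pf _ d0 _ _).
  - by move=> u v /andP[].
  - move=> x xB; exact: (dem_in_large adj_und d_gt Qn bk few light).
  - by move=> X XB; rewrite (cntT (ind (adj G))); apply: sparseB.
apply: (r_seq (r_route (s := s4') (flip := true) (own := own1) (B := B)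
    (dem := @dem_in V dir code d P z a) (SE := 6) (e := bE) (src := b) (L := radius V)
    W_gt n_W d_n st4 _ _ own1le _ _ _ _ hl2 short2)) => //.
- by move=> v; rewrite fr4 // fr3 // s2B.
- move=> v; rewrite fr4 // fr3 // fr2 // k7 /dem_in /ends1 /quota /s4' updD val_eqE.
  congr (_ - _); case: eqP => [->|_]; first by rewrite muln1.
  by rewrite muln0 addn0 !updE // fr3 // fr2 // k6.
- by move=> v; rewrite fr4 // fr3 // fr2 // k7; apply: dem3.
- by move=> s' H; apply: eb => j; rewrite H fr4 // fr3 // fr2.
move=> s5 [fr5 [f2 [pb [pf2 pth_b up_b [zb_out size_b] [s5e s54]]]]].
set zb := last b pb in zb_out s5e.
have {}pf2 : @preflow V (fun u v => @free1 V (adj G) dir own a pa v u) B f2 (@dem_in V dir code d P z a).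
  by apply: preflow_eq pf2 => // u v; rewrite /oriented un1.
pose own2 u v := own1 u v + TL * oriented true (@hits V dir b pb) u v.
have hits2 u v : @hits V dir b pb v u -> own1 u v = 0.
  move=> /(hits_b_free adj_und bk pf2 pth_b up_b); rewrite -un1.
  by move=> /andP[_ /eqP].
have un2 u v : unreserved (adj G) own2 u v = @free2 V (adj G) dir own a b pa pb u v.
  rewrite /free2 -un1 /own2 /oriented /unreserved.
  by case: (hits _ _ _ _ _); rewrite ?muln1 ?muln0 ?addn0 ?andbT // addnS !andbF.
have own2le u v : own2 u v <= TL.
  rewrite /own2 /oriented; case: (boolP (hits _ _ _ _ _)) => [/hits2->|_]; first by rewrite muln1.
  by rewrite muln0 addn0.
have [p0 [pth0 last0 size0]] := middle_path d_gt half_sparse out_ok in_ok pf1 pth_a za_out pf2 pth_b zb_out.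
pose S1 x := nstarts dir P x + (x == a); pose E1 x := nends dir P x + und * (x == a).
have s5S (x : 'I_n) : s5 5 x = S1 x.
  rewrite fr5 // /s4' /S1 updE // updD val_eqE; case: eqP => [->|_] //.
  by rewrite updE // fr3 // fr2 // k5 addn0.
have s5E (x : 'I_n) : s5 6 x = E1 x.
  rewrite fr5 // /s4' /E1 updD val_eqE; case: eqP => [->|_]; first by rewrite muln1.
  by rewrite !updE // fr3 // fr2 // k6 muln0 addn0.
have s5Z (x : 'I_n) : s5 7 x = @ntokens V dir code P z x by rewrite fr5 // fr4 // fr3 // fr2.
have st5 : stable d G s5 by apply: stable_frame fr5 _ _ st4.
have s52 j : s5 2 j = s 2 j by rewrite fr5 // fr4 // fr3 // fr2.
have s58 j : s5 8 j = s 8 j by rewrite fr5 // fr4 // fr3 // fr2.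
have s5B (v : 'I_n) : s5 9 v = (v \in B) by rewrite fr5 // fr4 // fr3 // s2B.
have s535 : s5 35 0 = za by rewrite fr5.
apply: (r_then (update s5 36 0 zb)).
  by apply: (r_setv (v := zb)) => //; rewrite eval_var.
apply: (r_then (update (update s5 36 0 zb) 6 b (E1 b + 1))).
  apply: (r_bump (iv := b) (v := 1)); first by apply: eb => j; rewrite updE.
  - exact: eval_const.
  - by rewrite updE // s5E /E1; have := ke b; move: dW d_gt; case: (~~ dir); case: eqP => _; clear; lia.
  - by rewrite updE // s5E.
apply: (r_then (update (update (update s5 36 0 zb) 6 b (E1 b + 1)) 5 b (S1 b + und))).
  apply: (r_bump (iv := b) (v := und)); first by apply: eb => j; rewrite !updE.
  - by apply: (eval_und (G := G)) => //; rewrite !updE //; case: st5.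
  - by rewrite !updE // s5S /S1; have := ks b; move: dW d_gt; case: (~~ dir); case: eqP => _; clear; lia.
  - by rewrite !updE // s5S.
pose s6 := update (update (update (update s5 36 0 zb) 6 b (E1 b + 1)) 5 b (S1 b + und))
   7 za (@ntokens V dir code P z za + und.+1).
apply: (r_then s6).
  apply: (r_bump (iv := za) (v := und.+1)); first by rewrite eval_var !updE.
  - have -> : und.+1 = 1 + und by rewrite add1n.
    apply: eval_add; first exact: eval_const.
      by apply: (eval_und (G := G)) => //; rewrite !updE //; case: st5.
    by move: W_gt; case: (~~ dir); clear; lia.
  - by rewrite !updE // s5Z; have := tok2 za; move: dW d_gt; case: (~~ dir); clear; lia.
  - by rewrite !updE // s5Z.
have fr6 : frame [:: 5; 6; 7; 36] s5 s6 by do 4 (apply: frame_upd => //).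
have st6 : stable d G s6 by apply: stable_frame fr6 _ _ st5.
have outE u v : [&& unreserved (adj G) own2 u v, u \notin B & v \notin B] = @outside V (adj G) dir own B a b pa pb u v.
  by rewrite un2.
rewrite -(eq_path outE) in pth0.
apply: (r_seq (r_middle (s := s6) (own := own2) (B := B) (za := za) (zb := zb) (p0 := p0)
   W_gt n_W st6 _ own2le _ _ _ pth0 last0)) => //.
move=> s7 [fr7 [pm [pth_m last_m up_m size_m s74]]].
rewrite (eq_path outE) in pth_m.
have {}size_m : size pm <= 2 * radius V by apply: leq_trans size_m size0.
pose own3 u v := own2 u v + TL * @hits V dir za pm u v.
pose hit := @hit V dir a b pa pb pm.
have hfree u v : hit u v -> unreserved (adj G) own u v.
  exact: (hit_free adj_und bk pf1 pth_a up_a pf2 pth_b up_b pth_m up_m).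
(* By [disjoint_hits] no arc is marked twice. *)
have own3E u v : own3 u v = if hit u v then TL else own u v.
  have := disjoint_hits adj_und bk pf1 pth_a pf2 pth_b up_b pth_m up_m u v.
  rewrite /ind -/hit /own3 /own2 /own1 /oriented => H.
  rewrite -2!addnA -!mulnDr addnA H; case: ifP => [/hfree/andP[_ /eqP->]|_]; first by rewrite muln1.
  by rewrite muln0 addn0.
have ownlt u v : own u v < TL by rewrite ltnS.
have st7 : stable d G s7 by apply: stable_frame fr7 _ _ st6.
apply: (r_conseq (r_final (s := s7) (own := own) (own3 := own3) (hit := hit) (a := a) (b := b) (za := za)
   W_gt n_W ab st7 _ _ _ _ own3E ownlt _)) => //.
- by rewrite fr7 // fr6 // s52.
- by rewrite fr7 // fr6 // s52.
- by rewrite fr7 // fr6.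
- exact: hit_walk last_m.
move=> s8 [fr8 [q [pth_q last_q up_q ans [s84 s88]]]].
have pathq : is_path G a b (a :: q).
  by rewrite /= eqxx last_q eqxx; apply/and3P; split=> //; apply: sub_path pth_q => u v /hfree/andP[].
exists (a :: q); split=> //.
  by apply: (path_disjoint bk); apply: sub_path pth_q => u v /hfree.
exists (@own_add V dir code own a b pa pb pm q), (@tok_add V code z a pa q); split.
- exact: (booked_add adj_und code_neq0 code_inj bk ab pf1 pth_a up_a pf2 pth_b up_b pth_m last_m up_m
    pth_q last_q up_q size_a size_b size_m).
- exact: (escapable_add adj_und code_neq0 code_inj regular_out regular_in d_gt small_sparse Qn bk few light
    out_ok in_ok ab pf1 pth_a up_a za_out pf2 pth_b up_b zb_out pth_m last_m up_m
    pth_q last_q up_q size_a size_b size_m).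
- exact: (few_ends_add pathq few ca cb).
have ntE : nontrivial ((a :: q) :: P) = (a :: q) :: nontrivial P.
  by rewrite /nontrivial /=; case: (q) last_q => //= e; rewrite e eqxx in ab.
have fresh := lab_p adj_und code_neq0 code_inj bk ab pf1 pth_a up_a pf2 pth_b up_b pth_m up_m pth_q last_q.
have sigE (x : V) : sig dir (a :: q) x = (x == a) + und * (x == b) by rewrite /sig /= last_q.
have epsE (x : V) : eps dir (a :: q) x = (x == b) + und * (x == a) by rewrite /eps /= last_q.
have s85 x j : x \in [:: 5; 6; 7] -> s8 x j = s6 x j.
  by rewrite !inE => /or3P[] /eqP->; rewrite fr8 // fr7.
split.
- by apply: stable_frame fr8 _ _ st7.
- by [].
- split=> x; rewrite s85 //.
  + rewrite /nstarts ntE big_cons sigE -/(nstarts dir P x) /s6 updE // updD val_eqE.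
    case: eqP => [->|_]; first by rewrite /S1 muln1; clear; lia.
    by rewrite !updE // s5S /S1 muln0 addn0 addnC.
  + rewrite /nends ntE big_cons epsE -/(nends dir P x) /s6 !(updE _ _ _ _ (x := 7)) // !(updE _ _ _ _ (x := 5)) // updD val_eqE.
    case: eqP => [->|_]; first by rewrite /E1; clear; lia.
    by rewrite !updE // s5E /E1 add0n addnC.
  + rewrite (ntokens_add adj_und code_neq0 code_inj bk ab pf1 pth_a up_a pf2 pth_b up_b pth_m up_m pth_q last_q).
    rewrite /s6 updD val_eqE eq_sym; case: eqP => [->|_]; first by rewrite muln1 addnC.
    by rewrite !updE // s5Z muln0.
- move=> r; rewrite ntE inE s88 => /orP[/eqP->|rP]; first by rewrite eqxx /tok_add eqxx.
  case: fresh => _ fr; rewrite /tok_add; have [e|_] := eqVneq (lab code r) (lab code (a :: q)).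
    by case/negP: fr; rewrite -e; apply: map_f.
  by rewrite fr7 // fr6 // s58 k8.
Qed.

End Invariant.

(** * Remove-Path requests and the initial store *)

Section Requests.

Variables (W : nat) (n d Q : nat) (G : graph n).
Hypothesis W_gt : 1000 < W.
Hypothesis n_W : 1000 * n * n < W.
Hypothesis d_n : d < n.
Local Notation V := (vertices n).
Local Notation dir := (directed G).
Local Notation und := (nat_of_bool (~~ dir)).
Local Notation TL := (n * n).+1.
Local Notation runs := (runs W (lim n d)).
Local Notation code := (@code n).
Local Notation Inv := (@Inv n d Q G).

Hypothesis regular_out : forall x : V, cnt (ind (adj G)) [set x] setT = d.
Hypothesis regular_in : forall x : V, cnt (ind (adj G)) setT [set x] = d.
Hypothesis d_gt : 200 < d.
Hypothesis small_sparse : forall X : {set V},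
  Q * #|X| <= 2 * #|V| -> 500 * cnt (ind (adj G)) X X <= d * #|X|.
Hypothesis half_sparse : forall X : {set V},
  2 * #|X| <= #|V| -> 3 * cnt (ind (adj G)) X X <= 2 * d * #|X|.
Hypothesis Qn : Q <= #|V|.

Let adj_und := @adj_sym n G.
Let neq0 := @code_neq0 n.

Lemma r_lower s X i e iv v (R : store -> Prop) :
  eval W s i = iv -> eval W s e = v -> s X iv < W ->
  R (update s X iv (s X iv - v)) -> runs (lower X i e) s R.
Proof.
move=> Hi He lt HQ; apply: (r_set Hi _ HQ).
by apply: eval_sub lt => //; apply: eval_get.
Qed.

Lemma few_ends_rem (P : family_of_paths n) p : p \in P -> @few_ends V d P -> @few_ends V d (rem p P).
Proof.
move=> pP few x; have := few x; rewrite (permP (perm_to_rem pP)) /=.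
by case: (ends_at x p); clear; lia.
Qed.

Lemma r_remove s (P : family_of_paths n) p :
  Inv s P -> p \in P -> (forall i, s 2 i = nth 0 [:: 1, size p & map val p] i) ->
  runs Remove s (fun s' => Inv s' (rem p P)).
Proof.
move=> [own [z [bk esc few [st k4 [k5 k6 k7] k8]]]] pP s2.
have [s00 s01 s02 s1] := st; have nW := n_lt_W W_gt n_W; have limn := @lim_n n d.
have pm : perm_eq (nontrivial P) (nontrivial (p :: rem p P)) by apply: perm_filter (perm_to_rem pP).
have bk' := booked_perm pm bk; have esc' := escapable_perm pm esc.
have few' := few_ends_rem pP few.
have e2 c : c <= 1000 -> forall s', (forall j, s' 2 j = s 2 j) ->
    eval W s' (Get 2 (Const c)) = nth 0 [:: 1, size p & map val p] c.
  by move=> lc s' H; rewrite (eval_get _ (eval_const W_gt _ lc)) H s2.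
apply: r_if; rewrite (eval_lt W_gt (eval_const W_gt _ _) (e2 1 isT s (fun=> erefl))) //=; last first.
  move=> /eqP; rewrite eqb0 => sp; apply: r_skip.
  have nE : perm_eq (nontrivial P) (nontrivial (rem p P)).
    by move: pm; rewrite /nontrivial /= (negPf sp).
  exists own, z; split=> //.
  - exact: booked_perm nE bk.
  - exact: escapable_perm nE esc.
  - split=> //; first by split=> x; rewrite ?k5 ?k6 ?k7; [apply: nstarts_perm|apply: nends_perm|apply: ntokens_perm].
    by move=> q; rewrite -(perm_mem nE); apply: k8.
rewrite eqb0 negbK => sp.
have pN : p \in nontrivial P by rewrite mem_filter sp.
have up := r_uniq (b_res bk pN).
have szp : size p <= n by apply: size_queue up.
have ntE : nontrivial (p :: rem p P) = p :: nontrivial (rem p P) by rewrite /nontrivial /= sp.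
have fewc (x : V) : count (@ends_at V x) P < d by have := few x; move: d_gt; clear; lia.
have S_d (x : V) : nstarts dir P x < d by apply: leq_ltn_trans (nstarts_le bk x) (fewc x).
have E_d (x : V) : nends dir P x < d by apply: leq_ltn_trans (nends_le bk x) (fewc x).
have Z_d := tokens_le regular_out regular_in bk.
have dW : 10 * d < W by move: n_W W_gt d_n; clear; nia.
have SE (x : V) : nstarts dir P x = sig dir p x + nstarts dir (rem p P) x.
  by rewrite (nstarts_perm dir pm) /nstarts ntE big_cons.
have EE (x : V) : nends dir P x = eps dir p x + nends dir (rem p P) x.
  by rewrite (nends_perm dir pm) /nends ntE big_cons.
have ZE (x : V) : @ntokens V dir code P z x = und.+1 * (z (lab code p) == x) + @ntokens V dir code (rem p P) z x.
  by rewrite (ntokens_perm dir code z pm) /ntokens ntE big_cons.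
have rl : {subset nontrivial (rem p P) <= nontrivial P}.
  by move=> q; rewrite !mem_filter => /andP[-> /mem_rem].
case: p pP s2 pm bk' esc' few' e2 sp pN up szp ntE SE EE ZE rl => [|x [|y r]] // pP s2 pm bk' esc' few' e2 _ pN up szp ntE SE EE ZE rl.
set p := [:: x, y & r] in pP s2 pm bk' esc' few' e2 pN up szp ntE SE EE ZE rl *.
set l := last y r.
have sigE (v : V) : sig dir p v = (v == x) + und * (v == l) by [].
have epsE (v : V) : eps dir p v = (v == l) + und * (v == x) by [].
(* The ends are distinct, so the two updates of array 5 concern different cells, and so do those of
   array 6. *)
have xl : x != l by move: up; rewrite /= => /andP[+ _]; apply: contra => /eqP ->; apply: mem_last.
set id := lab code p; set zp := z id.
have idW : id < W by apply: leq_ltn_trans (cell_lt x y) _; move: n_W; clear; nia.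
apply: (r_then (update s 37 0 id)).
  apply: (r_setv (v := id)) => //; rewrite (eval_succ W_gt (a := x * n + y)) //.
  by apply: (eval_cell W_gt n_W) => //; rewrite e2.
apply: (r_then (update (update s 37 0 id) 38 0 l)).
  apply: (r_setv (v := l)) => //.
  have e1 : eval W (update s 37 0 id) (Bin Add (Get 2 (Const 1)) (Const 1)) = (size p).+1.
    apply: (eval_succ W_gt); first by rewrite e2.
    by apply: leq_ltn_trans (_ : n.+1 < W); [|move: W_gt n_W; clear; nia].
  rewrite (eval_get _ e1) updE // s2 /l.
  by have -> : nat_of_ord (last y r) = last (val y) (map val r) by [rewrite last_map]; rewrite (last_nth 0) size_map.
pose s3 := update (update (update s 37 0 id) 38 0 l) 35 0 zp.
apply: (r_then s3).
  apply: (r_setv (v := zp)) => //; rewrite (eval_get _ (eval_var _ _ _)) !(updE _ _ _ _ (x := 38)) //.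
  by rewrite updI updE //; apply: k8.
have fr3 : frame [:: 35; 37; 38] s s3 by do 3 (apply: frame_upd => //).
pose own' u v := if own u v == id then 0 else own u v.
apply: (r_seq (Q' := fun s' => frame [:: 4; 20; 21] s3 s' /\ forall u v : 'I_n, s' 4 (u * n + v) = own' u v)).
  apply: (fill_mat W_gt n_W limn (s := s3)) => // u v s' fr s'u s'v s'4.
  have s'n : s' 0 1 = n by rewrite fr // fr3.
  have e4 : eval W s' (entry 4 (var 20) (var 21)) = own u v.
    by rewrite (eval_entry_v W_gt n_W _ s'n s'u s'v) s'4 fr3 // k4.
  have eq37 : eval W s' (Bin Eq (entry 4 (var 20) (var 21)) (var 37)) = (own u v == id).
    by apply: (eval_eq W_gt e4); rewrite eval_var fr.
  have oW : own u v < W by apply: leq_ltn_trans (own_le bk u v) _; move: n_W; clear; nia.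
  have E : own' u v = own u v * (nat_of_bool (own u v == id) == 0).
    by rewrite /own'; case: (own u v == id); rewrite ?muln0 ?muln1.
  rewrite E; apply: eval_mul => //; first exact: (eval_not W_gt eq37).
  by apply: leq_ltn_trans oW; case: (_ == _); rewrite ?muln0 ?muln1.
move=> s4 [fr4 s44].
have s45 j : s4 5 j = s 5 j by rewrite fr4 // fr3.
have s46 j : s4 6 j = s 6 j by rewrite fr4 // fr3.
have s47 j : s4 7 j = s 7 j by rewrite fr4 // fr3.
have s42 j : s4 2 j = s 2 j by rewrite fr4 // fr3.
have s438 : s4 38 0 = l by rewrite fr4.
have s435 : s4 35 0 = zp by rewrite fr4.
have s400 : s4 0 0 = dir by rewrite fr4 // fr3.
pose s5 := update s4 5 x (nstarts dir P x - 1).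
apply: (r_then s5).
  apply: (r_lower (iv := x) (v := 1)); first by rewrite e2.
  - exact: eval_const.
  - by rewrite s45 k5; have := S_d x; move: dW; clear; lia.
  - by rewrite s45 k5.
pose s6 := update s5 6 l (nends dir P l - 1).
have s56 : s5 6 l = nends dir P l by rewrite /s5 updE // s46 k6.
apply: (r_then s6).
  apply: (r_lower (iv := l) (v := 1)); first by rewrite eval_var /s5 updE.
  - exact: eval_const.
  - by rewrite s56; have := E_d l; move: dW; clear; lia.
  - by rewrite s56.
pose s7 := update s6 5 l (nstarts dir P l - und).
have s65 : s6 5 l = nstarts dir P l.
  rewrite /s6 updE // /s5 updD val_eqE s45 k5; by rewrite eq_sym (negPf xl).
apply: (r_then s7).
  apply: (r_lower (iv := l) (v := und)); first by rewrite eval_var /s6 /s5 !updE.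
  - by apply: (eval_und (G := G) W_gt); rewrite /s6 /s5 !updE.
  - by rewrite s65; have := S_d l; move: dW; clear; lia.
  - by rewrite s65.
pose s8 := update s7 6 x (nends dir P x - und).
have s76 : s7 6 x = nends dir P x.
  by rewrite /s7 updE // /s6 updD val_eqE (negPf xl) /s5 updE // s46 k6.
apply: (r_then s8).
  apply: (r_lower (iv := x) (v := und)); first by rewrite e2 // => j; rewrite /s7 /s6 /s5 !updE.
  - by apply: (eval_und (G := G) W_gt); rewrite /s7 /s6 /s5 !updE.
  - by rewrite s76; have := E_d x; move: dW; clear; lia.
  - by rewrite s76.
have fr8 : frame [:: 5; 6] s4 s8 by do 4 (apply: frame_upd => //).
have s87 (v : 'I_n) : s8 7 v = @ntokens V dir code P z v by rewrite fr8 // s47 k7.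
apply: (r_lower (iv := zp) (v := und.+1)); first by rewrite eval_var fr8.
- have -> : und.+1 = 1 + und by rewrite add1n.
  apply: eval_add; first exact: eval_const.
    by apply: (eval_und (G := G) W_gt); rewrite fr8.
  by move: W_gt; case: (~~ dir); clear; lia.
- by rewrite s87; have := Z_d zp; move: dW d_gt; clear; lia.
have own'E u v : own' u v = if (1 < size p) && (own u v == lab code p) then 0 else own u v by [].
exists own', z; split=> //.
- exact: (booked_remove neq0 bk' own'E).
- exact: (escapable_remove adj_und neq0 bk' own'E esc').
have frz : frame [:: 5; 6; 7] s4 (update s8 7 zp (s8 7 zp - und.+1)).
  by do 5 (apply: frame_upd => //).
split.
- exact: (stable_frame frz isT isT (stable_frame fr4 isT isT (stable_frame fr3 isT isT st))).
- by move=> u v; rewrite frz.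
- split=> v.
  + rewrite updE // /s8 updE // /s7 updD val_eqE.
    case: eqP => [->|/eqP vl]; first by rewrite SE sigE eq_sym (negPf xl) eqxx muln1 addKn.
    rewrite /s6 updE // /s5 updD val_eqE; case: eqP => [->|/eqP vx]; last first.
      by rewrite s45 k5 SE sigE (negPf vl) (negPf vx) muln0.
    by rewrite SE sigE eqxx (negPf xl) muln0 addn0 addKn.
  + rewrite updE // /s8 updD val_eqE.
    case: eqP => [->|/eqP vx]; first by rewrite EE epsE (negPf xl) eqxx muln1 addKn.
    rewrite /s7 updE // /s6 updD val_eqE; case: eqP => [->|/eqP vl]; last first.
      by rewrite /s5 updE // s46 k6 EE epsE (negPf vl) (negPf vx) muln0.
    by rewrite EE epsE eqxx eq_sym (negPf xl) muln0 addn0 addKn.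
  + rewrite updD val_eqE; case: eqP => [->|/eqP vz]; first by rewrite s87 ZE eqxx muln1 addKn.
    by rewrite s87 ZE eq_sym (negPf vz) muln0.
- by move=> q /rl qP; rewrite frz // fr4 // fr3 // k8.
Qed.

Lemma nth_adjacency (u v : 'I_n) :
  nth 0 [seq nat_of_bool (adj G u v) | u <- enum 'I_n, v <- enum 'I_n] (u * n + v) = adj G u v.
Proof.
have H (s : seq 'I_n) i : i < size s -> nth 0 [seq nat_of_bool (adj G u v) | u <- s, v <- enum 'I_n] (i * n + v)
   = adj G (nth u s i) v.
  elim: s i => //= w s IH [_|i lt].
    by rewrite nth_cat size_map size_enum_ord mul0n add0n ltn_ord (nth_map v) ?size_enum_ord // nth_ord_enum.
  rewrite nth_cat size_map size_enum_ord mulSn -addnA ltnNge leq_addr /= addKn.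
  exact: IH.
by rewrite H ?size_enum_ord // nth_ord_enum.
Qed.

Lemma Inv_init : 0 < n -> Inv (initial_store G d) [::].
Proof.
move=> n0; exists (fun _ _ => 0), (fun _ => Ordinal n0); split.
- exact: booked0.
- exact: escapable0.
- by move=> x; rewrite /= muln0 addn_gt0 orbT.
- split=> //.
  + by split=> // u v; rewrite /= nth_adjacency.
  + by split=> x; rewrite /nstarts /nends /ntokens big_nil.
Qed.

Lemma Inv_receive (q : request n) s P : Inv s P -> Inv (receive q s) P.
Proof. by move=> [own [z [bk esc few [st k4 k567 k8]]]]; exists own, z. Qed.

End Requests.

(** * Determinism and running time *)

Import Order.TTheory GRing.Theory Num.Theory.

(** Determinism identifies the store picked by [advance] with that of any actual run. *)
Lemma exec_det W c s k1 s1 k2 s2 :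
  exec W c s k1 s1 -> exec W c s k2 s2 -> k1 = k2 /\ s1 = s2.
Proof.
move=> H; elim: H k2 s2 => {c s k1 s1}.
- by move=> s k2 s2 H; inversion H.
- by move=> x e1 e2 s k2 s2 H; inversion H.
- move=> c1 c2 s k1 s1 k2 s2 _ IH1 _ IH2 k s' H; inversion H as [| |? ? ? l1 t1 l2 t2 E1 E2| | |]; subst.
  by have [? ?] := IH1 _ _ E1; subst; have [? ?] := IH2 _ _ E2; subst.
- move=> e c1 c2 s k s' _ IH k2 s2 H; inversion H as [| | |? ? ? ? l t E| |]; subst.
  by have [? ?] := IH _ _ E; subst.
- move=> e c s e0 k2 s2 H; inversion H as [| | | |? ? ? E|? ? ? ? ? ? ? N E1 E2]; subst => //.
  by rewrite e0 in N.
- move=> e c s k1 s1 k2 s2 nz _ IH1 _ IH2 k s' H.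
  inversion H as [| | | |? ? ? E|? ? ? l1 t1 l2 t2 N E1 E2]; subst; first by rewrite E in nz.
  by have [? ?] := IH1 _ _ E1; subst; have [? ?] := IH2 _ _ E2; subst.
Qed.

(** [konst] bounds the number of steps up to the factors [n] and [d] that loops
    contribute; [loops] is the nesting depth of the loops that contribute [d]
    (counter 40) or [n] (the other counters). *)
Fixpoint konst (c : cmd) : nat :=
  match c with
  | Skip => 1
  | Set_ x e1 e2 => (cost e1 + cost e2).+1
  | Seq c1 c2 => (konst c1 + konst c2).+1
  | If e c1 c2 => (cost e + konst c1 + konst c2).+1
  | While e c => 3 * (cost e + konst c).+1 + (cost e).+1
  end.

Fixpoint loops (in40 : bool) (c : cmd) : nat :=
  match c with
  | Skip => 0
  | Set_ _ _ _ => 0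
  | Seq c1 c2 => maxn (loops in40 c1) (loops in40 c2)
  | If _ c1 c2 => maxn (loops in40 c1) (loops in40 c2)
  | While e c =>
      match e with
      | Bin Lt (Get x _) _ => ((x == 40) == in40) + loops in40 c
      | _ => 0
      end
  end.

(** The factor 3 of a loop in [konst] accounts for the [3 * d] rounds that [lim] grants to counter
    40. *)
Lemma bound_le n d c : 0 < n -> 0 < d ->
  bound (lim n d) c <= konst c * (n ^ loops false c * d ^ loops true c).
Proof.
move=> n0 d0; have mono i j i' j' : i <= i' -> j <= j' -> n ^ i * d ^ j <= n ^ i' * d ^ j'.
  by move=> ii jj; apply: leq_mul; apply: leq_pexp2l.
have pos i j : 0 < n ^ i * d ^ j by rewrite muln_gt0 !expn_gt0 n0 d0.
elim: c => /=.
- by [].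
- by move=> x e1 e2; rewrite !expn0 !muln1.
- move=> c1 IH1 c2 IH2; set M := n ^ _ * d ^ _.
  have B1 : bound (lim n d) c1 <= konst c1 * M.
    by apply: leq_trans IH1 _; rewrite /M leq_mul2l mono ?leq_maxl ?orbT.
  have B2 : bound (lim n d) c2 <= konst c2 * M.
    by apply: leq_trans IH2 _; rewrite /M leq_mul2l mono ?leq_maxr ?orbT.
  by rewrite mulSn mulnDl -add1n leq_add ?leq_add // pos.
- move=> e c1 IH1 c2 IH2; set M := n ^ _ * d ^ _.
  have B1 : bound (lim n d) c1 <= konst c1 * M.
    by apply: leq_trans IH1 _; rewrite /M leq_mul2l mono ?leq_maxl ?orbT.
  have B2 : bound (lim n d) c2 <= konst c2 * M.
    by apply: leq_trans IH2 _; rewrite /M leq_mul2l mono ?leq_maxr ?orbT.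
  by rewrite mulSn !mulnDl -add1n leq_add ?leq_add ?leq_pmulr // pos.
- move=> e c IH; case: e => // -[] // [] // x e1 e2.
  have := pos (loops false c) (loops true c); move: IH.
  rewrite /lim; set B := bound _ c; set K := konst c; set a := cost _; set M := n ^ _ * d ^ _.
  case: eqP => _ /=; rewrite ?add0n ?add1n expnS => IH Mpos.
    have -> : n ^ loops false c * (d * d ^ loops true c) = d * M by rewrite mulnCA.
    have : d <= d * M by rewrite leq_pmulr.
    have : d * B <= d * (K * M) by rewrite leq_mul2l IH orbT.
    clearbody B K a M; move: d0; clear; nia.
  have -> : n * n ^ loops false c * d ^ loops true c = n * M by rewrite mulnA.
  have : n <= n * M by rewrite leq_pmulr.
  have : n * B <= n * (K * M) by rewrite leq_mul2l IH orbT.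
  clearbody B K a M; move: n0; clear; nia.
Qed.

(** The costliest nest is that of [Flow]: vertices, units of demand and an [n] by [n] table, which
    gives [n ^ 3 * d]. *)
Lemma router_time n d : 0 < n -> 0 < d ->
  bound (lim n d) Router <= konst Router * (n ^ 3 * d ^ 3).
Proof.
move=> n0 d0; apply: leq_trans (bound_le _ n0 d0) _; rewrite leq_mul2l; apply/orP; right.
have -> : loops false Router = 3 by vm_compute.
have -> : loops true Router = 1 by vm_compute.
by rewrite leq_mul2l leq_pexp2l ?orbT.
Qed.

(** * Playing the game *)

Section Play.

Variables (W n d Q : nat) (G : graph n) (R : realType) (r : R).
Hypothesis W_gt : 1000 < W.
Hypothesis n_W : 1000 * n * n < W.
Hypothesis d_n : d < n.
Local Notation V := (vertices n).
Hypothesis regular_out : forall x : V, cnt (ind (adj G)) [set x] setT = d.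
Hypothesis regular_in : forall x : V, cnt (ind (adj G)) setT [set x] = d.
Hypothesis d_gt : 200 < d.
Hypothesis small_sparse : forall X : {set V},
  Q * #|X| <= 2 * #|V| -> 500 * cnt (ind (adj G)) X X <= d * #|X|.
Hypothesis half_sparse : forall X : {set V},
  2 * #|X| <= #|V| -> 3 * cnt (ind (adj G)) X X <= 2 * d * #|X|.
Hypothesis Qn : Q <= #|V|.
Hypothesis r_small : forall m : nat, (m%:R < r)%R -> 21 * Q * (m * span V) <= n * d.

Local Notation Inv := (@Inv n d Q G).

Lemma Inv_length s P p : Inv s P -> p \in P -> path_length p <= span V.
Proof.
move=> [own [z [bk _ _ _]]] pP; case: (ltnP 1 (size p)) => sp.
  by apply: reserved_size (b_res bk _); rewrite mem_filter sp.
by case: p sp {pP} => [|x [|y q]].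
Qed.

Definition after (P : family_of_paths n) (q : request n) (p : seq 'I_n) :=
  match q with FindPath _ _ => p :: P | RemovePath p' => rem p' P end.

(** The single statement about one turn from which winning and timing follow by induction on the
    history. *)
Lemma turn s P q : Inv s P -> legal d r P q ->
  exists k s' p, [/\ exec W Router (receive q s) k s', k <= konst Router * (n ^ 3 * d ^ 3),
    fulfilled G P q p, Inv s' (after P q p) &
    if q is FindPath _ _ then answer s' = map val p else True].
Proof.
move=> iv; have iv' := Inv_receive q iv.
have time := router_time (leq_ltn_trans (leq0n _) d_n) (leq_ltn_trans (leq0n _) d_gt).
have e0 : eval W (receive q s) (Get 2 (Const 0)) = nth 0 (encode_request q) 0.
  by rewrite (eval_get _ (eval_const W_gt _ _)).
case: q iv' e0 => [a b|p] iv' e0 /=.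
  move=> [ca cb /r_small light].
  have fd := @r_find_path W n d Q G W_gt n_W d_n regular_out regular_in d_gt small_sparse half_sparse Qn
     _ P a b iv' (erefl _) (erefl _) ca cb light.
  have : runs W (lim n d) Router (receive (FindPath a b) s)
    (fun s' => exists p, [/\ is_path G a b p, all (edge_disjoint G p) P,
           answer s' = [seq \val i | i <- p] & Inv s' (p :: P)]).
    by apply: r_if; rewrite e0.
  move=> [k [s' [H1 H2 [p [H3 H4 H5 H6]]]]]; exists k, s', p; split=> //.
  exact: leq_trans H2 time.
move=> pP; have : runs W (lim n d) Router (receive (RemovePath p) s) (fun s' => Inv s' (rem p P)).
  apply: r_if; rewrite e0 // => _.
  exact: (r_remove W_gt n_W d_n regular_out regular_in d_gt iv' pP).
move=> [k [s' [H1 H2 H3]]]; exists k, s', p; split=> //.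
exact: leq_trans H2 time.
Qed.

(** The store is picked from the relation [exec] by classical choice. [s] is only a default, since
    by [turn] the program halts on every legal request. *)
Definition advance (s : store) (q : request n) : store :=
  match pselect (exists s' k, exec W Router (receive q s) k s') with
  | left H => projT1 (cid H)
  | right _ => s
  end.

Lemma advanceE s q k s' : exec W Router (receive q s) k s' -> advance s q = s'.
Proof.
rewrite /advance => H; case: pselect => [H'|[]]; last by exists s', k.
by case: (cid H') => s'' /= [k'' H'']; have [] := exec_det H'' H.
Qed.

Variable v0 : 'I_n.

Definition router_store (h : seq (request n)) := foldl advance (initial_store G d) h.
(** Router plays whatever the program answers; [v0] stands in for numbers that are not vertices. *)
Definition router_strategy : strategy n := fun h => map (insubd v0) (answer (router_store h)).

Lemma router_storeS w t : router_store (mkseq w t.+1) = advance (router_store (mkseq w t)) (w t).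
Proof. by rewrite /router_store mkseqS foldl_rcons. Qed.

Lemma insubd_map p : [seq insubd v0 x | x <- map val p] = p.
Proof. by rewrite -map_comp map_id_in // => x _ /=; rewrite valKd. Qed.

Lemma run_store w t s : run W Router G d w t s -> s = router_store (mkseq w t).
Proof.
elim: t s => [|t IH] s H; inversion H as [|t' s0 k s1 H1 H2]; subst => //.
by rewrite router_storeS -(IH _ H1) (advanceE H2).
Qed.

Lemma router_inv w t : legal_before d r router_strategy w t ->
  Inv (router_store (mkseq w t)) (family router_strategy w t).
Proof.
elim: t => [|t IH] lg.
  apply: Inv_init => //; exact: leq_ltn_trans (leq0n _) (ltn_ord v0).
have {}IH := IH (fun i lt => lg i (ltnW lt)).
have [k [s' [p [H1 _ _ H4 H5]]]] := turn IH (lg t (ltnSn t)).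
rewrite router_storeS (advanceE H1) /=.
case E : (w t) H1 H4 H5 => [a b|p'] H1 H4 H5 //.
by rewrite /router_strategy router_storeS E (advanceE H1) H5 insubd_map.
Qed.

Lemma router_wins : wins G d r router_strategy.
Proof.
move=> w t lg; have iv := router_inv (fun i lt => lg i (ltnW lt)).
have [k [s' [p [H1 _ H3 _ H5]]]] := turn iv (lg t (ltnSn t)).
case E : (w t) H1 H3 H5 => [a b|p'] H1 H3 H5 //.
by rewrite /router_strategy router_storeS E (advanceE H1) H5 insubd_map.
Qed.

Lemma router_implements :
  implements W Router G d r router_strategy (konst Router * (n ^ 3 * d ^ 3)).
Proof.
move=> w t s lg /run_store ->; have iv := router_inv (fun i lt => lg i (ltnW lt)).
have [k [s' [p [H1 H2 _ _ H5]]]] := turn iv (lg t (ltnSn t)).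
exists k, s'; split=> //; case E : (w t) H1 H5 => [a b|//] H1 H5.
by rewrite /router_strategy router_storeS E (advanceE H1) H5 insubd_map.
Qed.

Lemma router_short : forall (w : nat -> request n) (t : nat), legal_before d r router_strategy w t ->
  forall q, q \in family router_strategy w t -> path_length q <= span V.
Proof. by move=> w t /router_inv iv q; apply: Inv_length iv. Qed.

End Play.

(** * From edges to arcs *)

Section Graph.

Variables (n : nat) (G : graph n).
Local Notation V := (vertices n).

Lemma cnt_adj_card (X Y : {set V}) :
  cnt (ind (adj G)) X Y = #|[set u : V * V | [&& u.1 \in X, u.2 \in Y & adj G u.1 u.2]]|.
Proof.
rewrite /cnt pair_big_dep /= -sum1_card big_mkcond [RHS]big_mkcond.
apply: eq_bigr => -[u v] _; rewrite inE /ind /=.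
by case: (u \in X); case: (v \in Y); case: (adj G u v).
Qed.

(** An arc of a digraph is an edge of its own; in an undirected graph only the two orientations
    share an edge. *)
Lemma arcs_le_edges (S : {set V}) :
  cnt (ind (adj G)) S S <= (~~ directed G).+1 * edges_in G S.
Proof.
rewrite cnt_adj_card; set A := [set u | _]; set E := [set x in edges G | ends x \subset S].
pose f (u : V * V) := edge G u.1 u.2.
have fE u : u \in A -> f u \in E.
  case: u => u v; rewrite inE => /and3P[/= uS vS uv].
  rewrite inE; apply/andP; split; first by apply/imsetP; exists (u, v); rewrite // inE.
  rewrite /f /edge; case: (directed G) => /=; apply/subsetP => w; rewrite !inE => /orP[] /eqP-> //.
rewrite -sum1_card (partition_big f (mem E)) //=.
rewrite mulnC -sum_nat_const; apply: leq_sum => x _; rewrite sum1dep_card.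
case: (pickP (fun u => (u \in A) && (f u == x))) => [[u v] /andP[uA /eqP fx]|none]; last first.
  rewrite (_ : [set _ | _] = set0) ?cards0 //; apply/setP => u; rewrite !inE -/(f u).
  by have := none u; rewrite inE.
apply: leq_trans (subset_leq_card (_ : _ \subset if directed G then [set (u, v)] else [set (u, v); (v, u)])) _.
  apply/subsetP => -[u' v']; rewrite inE => /andP[u'A /eqP]; rewrite -fx /f /edge /=.
  case: (directed G) => /=; first by case=> -> ->; rewrite inE.
  case=> /setP H; move: u'A uA; rewrite !inE /= => /and3P[_ _ uv'] /and3P[_ _ uv].
  have nu : u' != v' by apply: contraTneq uv' => ->; rewrite adj_irr.
  have := H u'; have := H v'; rewrite !inE !eqxx orbT /= => /esym/orP[] /eqP ev /esym/orP[] /eqP eu;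
    move: nu; rewrite ev eu ?eqxx // => _; by rewrite ?orbT.
case: (directed G); first by rewrite cards1.
by rewrite cards2; case: (_ != _).
Qed.

Lemma regular_cnt d : regular G d ->
  (forall x : V, cnt (ind (adj G)) [set x] setT = d) /\
  (forall x : V, cnt (ind (adj G)) setT [set x] = d).
Proof.
move=> reg; split=> x.
  rewrite -(reg x).1 cnt1 -sum1_card big_mkcond [RHS]big_mkcond /=.
  by apply: eq_bigr => v _; rewrite !inE /ind; case: adj.
rewrite -cntT -(reg x).2 cnt1 -sum1_card big_mkcond [RHS]big_mkcond /=.
by apply: eq_bigr => v _; rewrite !inE /ind; case: adj.
Qed.

End Graph.

(** With [t] the binary logarithm rounded down, [t >= 1] gives [32 * (t + 1) <= 64 * t], and
    [t * ln 2 <= ln n]. *)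
Lemma span_ln (R : realType) n : 1 < n -> ((span (vertices n))%:R <= 64%:R / ln 2%:R * ln n%:R :> R)%R.
Proof.
move=> n1; rewrite /span /radius card_ord; set t := trunc_log 2 n.
have t1 : 0 < t by rewrite trunc_log_gt0.
have ln2 : (0 < ln (2%:R : R))%R by rewrite ln_gt0 // ltr1n.
have le : (ln (2%:R : R) *+ t <= ln n%:R)%R.
  rewrite -lnXn ?ltr0n // ler_ln ?posrE ?exprn_gt0 ?ltr0n //; last by apply: ltn_trans n1.
  by rewrite -natrX ler_nat trunc_logP // ltnW.
have h : ((8 * (4 * t.+1))%:R <= 64%:R * t%:R :> R)%R by rewrite -natrM ler_nat; lia.
apply: le_trans h _; rewrite mulrAC ler_pdivlMr // -mulrA ler_wpM2l ?ler0n //.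
by rewrite mulrC mulr_natr.
Qed.

(** * Constants from the expansion hypothesis *)

Section Constants.

Variables (R : realType) (beta gamma : R).
Hypotheses (beta_gt0 : (0 < beta)%R) (gamma_lt : (gamma < 1 / 1000%:R)%R).

(** In an undirected graph there are at most twice as many arcs as edges and the degree is [d]; in a
    digraph there are as many and the degree is [2 * d]. Either way [X] spans at most
    [2 * gamma * d] arcs per vertex, which is below [d / 500]. The condition on [q] places [X] in
    the range up to [beta * n]. *)
Lemma expander_sparse (q n d : nat) (G : graph n) (X : {set vertices n}) :
  1 < q -> (1 <= q%:R * beta)%R -> expander G d beta gamma -> q * #|X| <= n ->
  500 * cnt (ind (adj G)) X X <= d * #|X|.
Proof.
move=> q1 qb [_ ex] small; have half : 2 * #|X| <= n.
  by apply: leq_trans small; rewrite leq_mul2r q1 orbT.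
have := ex X half; rewrite /underlying_degree; have := arcs_le_edges G X.
set c := cnt _ _ _; set e := edges_in G X; set s := #|X| in small half * => ce.
have sb : (s%:R <= beta * n%:R :> R)%R.
  have h : (q%:R * s%:R <= n%:R :> R)%R by rewrite -natrM ler_nat.
  have s0 : (0 <= s%:R :> R)%R by rewrite ler0n.
  apply: le_trans (_ : beta * (q%:R * s%:R) <= _)%R; last by rewrite ler_wpM2l // ltW.
  by rewrite mulrA [(beta * _)%R]mulrC ler_peMl.
move=> [/(_ sb) le _].
have ceR : (c%:R <= (~~ directed G).+1%:R * e%:R :> R)%R by rewrite -natrM ler_nat.
have ds0 : (0 <= d%:R * s%:R :> R)%R by rewrite -natrM ler0n.
have gds : (gamma * (d%:R * s%:R) <= 1 / 1000%:R * (d%:R * s%:R))%R by rewrite ler_wpM2r // ltW.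
rewrite -(ler_nat R) !natrM.
by case: (directed G) le ceR => /=; rewrite ?natrM => le ceR; lra.
Qed.

(** As [gamma < 1 / 3], the bound [D * s / 3] holds in both ranges of the definition. *)
Lemma expander_half (n d : nat) (G : graph n) (X : {set vertices n}) :
  expander G d beta gamma -> 2 * #|X| <= n ->
  3 * cnt (ind (adj G)) X X <= 2 * d * #|X|.
Proof.
move=> [_ ex] half; have := ex X half; rewrite /underlying_degree; have := arcs_le_edges G X.
set c := cnt _ _ _; set e := edges_in G X; set s := #|X| in half * => ce [le1 le2].
have ceR : (c%:R <= (~~ directed G).+1%:R * e%:R :> R)%R by rewrite -natrM ler_nat.
have ds0 : (0 <= d%:R * s%:R :> R)%R by rewrite -natrM ler0n.
have gds : (gamma * (d%:R * s%:R) <= 1 / 1000%:R * (d%:R * s%:R))%R by rewrite ler_wpM2r // ltW.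
rewrite -(ler_nat R) !natrM.
have le : (e%:R <= (if directed G then 2 * d else d)%:R * s%:R / 3%:R :> R)%R.
  case: (leP (s%:R)%R (beta * n%:R)%R) => [/le1 H|/le2 //]; apply: le_trans H _.
  by case: (directed G); rewrite ?natrM; lra.
by case: (directed G) le ceR => /=; rewrite ?natrM => le ceR; lra.
Qed.

End Constants.

(* Words have w * log_2 n bits; the program c and all constants depend on
   beta and gamma only. *)
Theorem theorem1p2 (R : realType) (beta gamma : R) :
  (0 < beta)%R -> (0 < gamma)%R -> (gamma < 1 / 1000%:R)%R ->
  exists (eps : R) (n0 : nat), (0 < eps)%R /\
  exists (Clen : R) (Ctime w : nat) (c : cmd),
  forall (n d : nat) (G : graph n),
    n0 <= n -> 200 < d -> d < n -> expander G d beta gamma ->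
    let r := (eps * n%:R * d%:R / ln n%:R)%R in
    exists sigma : strategy n,
      [/\ wins G d r sigma,
          implements (n ^ w) c G d r sigma (Ctime * (n ^ 3 * d ^ 3))
        & short_paths d r sigma (Clen * ln n%:R)%R].
Proof.
move=> beta_gt0 _ gamma_lt.
(* [q] exceeds [1 / beta] and is at least 2. [Q] is [2 * q] because sparsity is needed up to
   [2 * n / Q], that is [n / q], vertices. *)
pose q := (Num.bound (beta^-1)%R).+2; pose Q := 2 * q.
have [C C0 spanC] : exists2 C : R, (0 < C)%R & forall n, 1 < n ->
    ((span (vertices n))%:R <= C * ln n%:R)%R.
  exists (64%:R / ln 2%:R)%R; last exact: span_ln.
  by rewrite divr_gt0 ?ltr0n // ln_gt0 // ltr1n.
have qb : (1 <= q%:R * beta)%R.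
  have : (beta^-1 < (Num.bound (beta^-1)%R)%:R)%R by apply: archi_boundP; rewrite invr_ge0 ltW.
  move=> h; rewrite -[leLHS](mulVf (lt0r_neq0 beta_gt0)) ler_wpM2r // ltW //.
  by apply: lt_le_trans h _; rewrite ler_nat /q ltnW.
(* With this [eps], [m < r] means [21 * Q * C * m * ln n < n * d], and [C * ln n] bounds [span]. For
   [n > 1000] the word size [n ^ 3] exceeds [1000 * n * n]. *)
exists (1 / ((21 * Q)%:R * C))%R, (maxn 1001 Q); split.
  by rewrite divr_gt0 ?ltr01 // mulr_gt0 // ltr0n.
exists C, (konst Router), 3, Router => n d G; rewrite geq_max => /andP[n1001 Qn] d_gt d_n ex r.
have n1 : 1 < n by apply: leq_trans n1001.
have n0 : 0 < n by apply: ltnW.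
have lnn : (0 < ln (n%:R : R))%R by rewrite ln_gt0 // ltr1n.
have [rout rin] := regular_cnt ex.1.
have n_W : 1000 * n * n < n ^ 3.
  by rewrite !expnS expn0 muln1 mulnA ltn_mul2r n0 /= ltn_mul2r n0.
have W_gt : 1000 < n ^ 3.
  by apply: leq_ltn_trans n_W; rewrite -mulnA leq_pmulr // muln_gt0 n0.
have sp (X : {set vertices n}) : Q * #|X| <= 2 * #|'I_n| -> 500 * cnt (ind (adj G)) X X <= d * #|X|.
  rewrite card_ord /Q -mulnA leq_pmul2l // => h.
  by apply: (expander_sparse beta_gt0 gamma_lt (q := q)).
have hs (X : {set vertices n}) : 2 * #|X| <= #|'I_n| -> 3 * cnt (ind (adj G)) X X <= 2 * d * #|X|.
  by rewrite card_ord; apply: expander_half ex.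
have Qn' : Q <= #|'I_n| by rewrite card_ord.
have span_le := spanC n n1.
have small m : (m%:R < r)%R -> 21 * Q * (m * span (vertices n)) <= n * d.
  rewrite /r ltr_pdivlMr // => h; rewrite -(ler_nat R) natrM (natrM _ m) (natrM _ n).
  set S := (span _)%:R%R in span_le *.
  have k0 : (0 < (21 * Q)%:R * C)%R by rewrite mulr_gt0 // ltr0n.
  have h' : ((21 * Q)%:R * C * (m%:R * ln n%:R) <= n%:R * d%:R :> R)%R.
    apply: le_trans (ler_wpM2l (ltW k0) (ltW h)) _.
    by rewrite div1r !mulrA mulfV ?mul1r // lt0r_neq0.
  apply: le_trans h'; rewrite -mulrA ler_wpM2l ?ler0n // mulrCA ler_wpM2l ?ler0n //.
exists (router_strategy (n ^ 3) d G (Ordinal n0)); split.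
- exact: (router_wins W_gt n_W d_n rout rin d_gt sp hs Qn' small).
- exact: (router_implements W_gt n_W d_n rout rin d_gt sp hs Qn' small).
- move=> w t lg p pf; apply: le_trans span_le; rewrite ler_nat.
  exact: (router_short W_gt n_W d_n rout rin d_gt sp hs Qn' small lg pf).
Qed.
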